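(* Let $0<\alpha,\beta<1$ and suppose that the weak problem $$(u_t,\chi)=-\frac{\alpha}{\beta}t^{\alpha-1}\left(D_{\alpha/\beta}^{\beta-1,1-\beta}u_x,\chi_x\right)\quad\text{for all }\chi\in H^1(\mathbb{R}),\ t\in(0,T],$$ with initial condition $u(0,x)=u_0(x)$, $u_0\in H^2(\mathbb{R})$, has a unique solution $u(t,x)$, and that for some constant $C$ and all $t\in(0,T]$, $$\|u\|+t^{1-\alpha}\|u_t\|+t^{2-\alpha}\|u_{tt}\|\le C,\qquad \|u_x\|+t^{1-\alpha}\|u_{tx}\|+t^{2-\alpha}\|u_{ttx}\|\le C.$$ Let $U^n\in H^1(\mathbb{R})$, $n\in\mathbb{N}$, be the solution of the time-discrete problem $$\left(\frac{U^n-U^{n-1}}{k},\chi\right)=-\frac{\alpha}{\beta}t_n^{\alpha-1}\left(G_{\alpha/\beta}^{\beta-1,1-\beta}U_x^n,\chi_x\right)\quad\text{for all }\chi\in H^1(\mathbb{R}),\qquad U^0=u(0,\cdot),$$ with time step $0<k<1$ and $t_n=nk\le T$. Then, for arbitrarily small $\mu>0$, there exists a positive constant $D$, independent of $k$ and $n$, such that $$\|U^n-u(t_n)\|\le D\begin{cases}k^{\alpha-\mu/2} & \text{for }\alpha\neq\beta,\\ k^{\alpha}\left((-\log k)^{1/2}+k^{-\mu/2}\right) & \text{for }\alpha=\beta.\end{cases}$$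
   Context: $(\cdot,\cdot)$ and $\|\cdot\|$ denote the inner product and norm of $L^2(\mathbb{R})$ (in the variable $x$); subscripts $t,x$ denote (weak) partial derivatives. Erdélyi–Kober operators (acting in the time variable): $$I_{\alpha/\beta}^{0,\beta}\phi(t)=\frac{\alpha}{\beta\Gamma(\beta)}\int_0^1 x^{\frac{\alpha}{\beta}-1}\left(1-x^{\frac{\alpha}{\beta}}\right)^{\beta-1}\phi(xt)\,dx,\qquad D_{\alpha/\beta}^{\beta-1,1-\beta}\phi(t)=\left(\beta+\frac{\beta}{\alpha}t\frac{d}{dt}\right)I_{\alpha/\beta}^{0,\beta}\phi(t).$$ For $1\le i\le n$ put $$c_{n,i}=\frac{1}{\beta\Gamma(\beta)}\left(\left(1-\left(\tfrac{i-1}{n}\right)^{\alpha/\beta}\right)^{\beta}-\left(1-\left(\tfrac{i}{n}\right)^{\alpha/\beta}\right)^{\beta}\right).$$ The discrete operator applied to the sequence $(U^i_x)_i$ is $$G_{\alpha/\beta}^{\beta-1,1-\beta}U_x^n=\beta\sum_{i=1}^n c_{n,i}U_x^i+\frac{\beta}{\alpha}\,\frac{t_n}{k}\left(\sum_{i=1}^n c_{n,i}U_x^i-\sum_{i=1}^{n-1}c_{n-1,i}U_x^i\right),$$ where for $n=1$ the last sum is empty and equals $0$. The constant $D$ may depend on $\mu$, $\alpha$, $\beta$, $T$ and $u$. *)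

(* Defs.v *)
From HB Require Import structures.
From mathcomp Require Import all_boot all_order all_algebra.
From mathcomp Require Import all_classical all_reals all_analysis.

Set Implicit Arguments.
Unset Strict Implicit.
Unset Printing Implicit Defensive.

Import Order.TTheory GRing.Theory Num.Theory.
Import numFieldNormedType.Exports.

Local Open Scope classical_set_scope.
Local Open Scope ring_scope.

Section Spaces.
Context {R : realType}.
Local Notation mu := (@lebesgue_measure R).
Implicit Types (f g : R -> R) (a b : \bar R).

Definition L2 f : Prop := f \in Lfun mu 2%:E.

Definition L2norm f : R := fine ('N[mu]_2%:E[EFin \o f])%E.

Definition L2dot f g : R := \int[mu]_x (f x * g x).

Definition smooth f : Prop := forall (n : nat) (x : R), derivable (derive1n n f) x 1.

(* C_c^oo of the open interval (a, b), extended by zero; (a, b) = (-oo, +oo)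
   gives C_c^oo(R). *)
Definition test_function a b f : Prop :=
  smooth f /\
  exists c d : R, [/\ (a < c%:E)%E, (d%:E < b)%E &
    forall x, x \notin `[c, d] -> f x = 0].

(* f belongs to H^1(R) and f' is (a representative of) its weak derivative. *)
Definition H1_deriv f f' : Prop :=
  [/\ L2 f, L2 f' & forall phi, test_function -oo%E +oo%E phi ->
    \int[mu]_x (f x * derive1 phi x) = - \int[mu]_x (f' x * phi x)].

Definition H2 f : Prop := exists f' f'', H1_deriv f f' /\ H1_deriv f' f''.

End Spaces.

(* Functions of (t, x) are written [v : R -> R -> R], time first, and are read
   as families [v t] of elements of L^2(R). *)
Section TimeDependent.
Context {R : realType}.
Local Notation mu := (@lebesgue_measure R).
Implicit Types (T t : R) (v w : R -> R -> R).

Definition L2_family T v : Prop :=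
  measurable_fun (`]0, T] `*` [set: R])
    (fun z : measurableTypeR R * measurableTypeR R => v z.1 z.2) /\
  forall t, 0 < t <= T -> L2 (v t).

(* L^1_loc(0, T; L^2(R)) *)
Definition L1loc_L2 T v : Prop :=
  L2_family T v /\
  forall a b : R, 0 < a -> a < b -> b < T ->
    mu.-integrable `[a, b] (fun t => (L2norm (v t))%:E).

(* [w] is the weak time derivative of [v] on (0, T) as an L^2(R)-valued
   distribution: int_0^T psi' v dt = - int_0^T psi w dt in L^2(R), the equality
   being tested against every chi in L^2(R). *)
Definition weak_dt T v w : Prop :=
  [/\ L1loc_L2 T v, L1loc_L2 T w &
    forall psi chi, test_function 0%:E T%:E psi -> L2 chi ->
      \int[mu]_(t in `[0, T]) (derive1 psi t * L2dot (v t) chi) =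
      - \int[mu]_(t in `[0, T]) (psi t * L2dot (w t) chi)].

(* C([0, T]; L^2(R)) *)
Definition continuous_L2 T v : Prop :=
  (forall t, 0 <= t <= T -> L2 (v t)) /\
  forall t, 0 <= t <= T ->
    L2norm (fun x => v s x - v t x) @[s --> within `[0, T] (nbhs t)] --> (0 : R).

End TimeDependent.

Section ErdelyiKober.
Context {R : realType}.
Local Notation mu := (@lebesgue_measure R).
Implicit Types (alpha beta T t k : R) (v w : R -> R -> R) (V : nat -> R -> R).

Definition Gamma (z : R) : R :=
  \int[mu]_(s in `]0, +oo[) (s `^ (z - 1) * expR (- s)).

Definition EK_kernel alpha beta (y : R) : R :=
  y `^ (alpha / beta - 1) * (1 - y `^ (alpha / beta)) `^ (beta - 1).

Definition EK_int alpha beta v t (x : R) : R :=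
  alpha / (beta * Gamma beta) *
  \int[mu]_(y in `[0, 1]) (EK_kernel alpha beta y * v (y * t) x).

(* [w] is (beta + (beta / alpha) t d/dt) applied to [EK_int alpha beta v].
   The integrability clause says that the L^2(R)-valued integral defining
   [EK_int alpha beta v t] converges absolutely. *)
Definition EK_deriv alpha beta T v w : Prop :=
  [/\ L2_family T v,
      forall t, 0 < t <= T ->
        mu.-integrable `[0, 1]
          (fun y => (EK_kernel alpha beta y * L2norm (v (y * t)))%:E) &
      exists2 dI, weak_dt T (EK_int alpha beta v) dI &
        forall t x, 0 < t <= T ->
          w t x = beta * EK_int alpha beta v t x + beta / alpha * t * dI t x].

Definition EK_coef alpha beta (n i : nat) : R :=
  (beta * Gamma beta)^-1 *
  ((1 - (i.-1%:R / n%:R) `^ (alpha / beta)) `^ beta -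
   (1 - (i%:R / n%:R) `^ (alpha / beta)) `^ beta).

Definition EK_discrete alpha beta k V (n : nat) (x : R) : R :=
  beta * (\sum_(1 <= i < n.+1) EK_coef alpha beta n i * V i x) +
  beta / alpha * (n%:R * k / k) *
  (\sum_(1 <= i < n.+1) EK_coef alpha beta n i * V i x -
   \sum_(1 <= i < n) EK_coef alpha beta n.-1 i * V i x).

End ErdelyiKober.

Section Problems.
Context {R : realType}.
Local Notation mu := (@lebesgue_measure R).

(* [u] solves the weak problem, with time derivative [ut] and space derivative
   [ux]. *)
Record weak_solution (alpha beta T : R) (u0 : R -> R) (u ut ux : R -> R -> R) :
    Prop := WeakSolution {
  ws_continuous : continuous_L2 T u;
  ws_initial : u 0 = u0 %[ae mu];
  ws_dx : forall t, 0 < t <= T -> H1_deriv (u t) (ux t);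
  ws_dt : weak_dt T u ut;
  ws_equation : exists2 Dux, EK_deriv alpha beta T ux Dux &
    forall t chi chix, 0 < t <= T -> H1_deriv chi chix ->
      L2dot (ut t) chi =
      - (alpha / beta * t `^ (alpha - 1) * L2dot (Dux t) chix)
}.

(* [U n], with space derivative [Ux n], solves the time-discrete problem at the
   levels n k <= T. *)
Record discrete_solution (alpha beta T k : R) (u_init : R -> R)
    (U Ux : nat -> R -> R) : Prop := DiscreteSolution {
  ds_initial : U 0%N = u_init %[ae mu];
  ds_dx : forall n, n%:R * k <= T -> H1_deriv (U n) (Ux n);
  ds_equation : forall n chi chix,
    (0 < n)%N -> n%:R * k <= T -> H1_deriv chi chix ->
      L2dot (fun x => (U n x - U n.-1 x) / k) chi =
      - (alpha / beta * (n%:R * k) `^ (alpha - 1) *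
         L2dot (EK_discrete alpha beta k Ux n) chix)
}.

End Problems.

(* Main.v *)
Require Import Defs.
From HB Require Import structures.
From mathcomp Require Import finmap.
From mathcomp Require Import all_boot all_order all_algebra.
From mathcomp Require Import all_classical all_reals all_analysis.
From mathcomp Require Import measurable_realfun.
From mathcomp Require Import ring lra zify.

Set Implicit Arguments.
Unset Strict Implicit.
Unset Printing Implicit Defensive.

Import Order.TTheory GRing.Theory Num.Theory.
Import numFieldNormedType.Exports.

Local Open Scope classical_set_scope.
Local Open Scope ring_scope.

(* Testing with chi in H^1 and integrating in time turns the weak problem into
   (u(t) - u(0), chi) = - t^alpha (I u_x(t), chi_x), where I is the Erdelyi-Kober
   integral, and the discrete problem is a discretization of this identity: over one
   step it replaces the increment of t^alpha I u_x by
   t_n^alpha ((1 + alpha / n) S_n - S_(n-1)), with S_n the quadrature sum of I at t_n.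

   Stability. In the quadratic form sum_n t_n^alpha ((1 + alpha / n) S_n - S_(n-1), v_n)
   the off-diagonal coefficients are nonpositive, the column sums are nonnegative by
   Bernoulli's inequality, and the n-th row sum is at least a constant times
   alpha t_n^(alpha - 1); this gives coercivity.

   Consistency. In the variable x = t / k the quadrature error of t_n^alpha I u_x(t_n) is
   E_n = sum_(i < n) int_i^(i+1) (f(x) - f(i + 1)) d(- (n^a - x^a)^beta), a = alpha / beta,
   and E_n - E_(n-1) = O(n^(alpha - 1)): on [0, n/2] the two weights are compared directly,
   and on [n/2, n] they are compared directly if a <= 1 and after a unit shift of x, using
   the bound on u_ttx, if a >= 1. What remains of the residual is
   r_n (u_x(0), chi_x) with sum_n |r_n| = O(k^alpha), where the derivative is moved back to
   u_0 in H^2. An energy argument then yields the error bound D k^alpha, which implies both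
   cases. *)

(** The coefficient (alpha/beta) t^(alpha-1) turns the Erdelyi-Kober derivative of u_x into d/dt
    (t^alpha I u_x); hence only increments of t^alpha I u_x occur. As u_x is tied to u_tx and u_ttx
    only through weak derivatives of u, time estimates are made for the scalar functions (u, phi')
    with phi a test function, and reach (u_x, v) for all v in L^2 by density. This yields a bound K
    |v| (t^alpha - s^alpha) on increments, valid from s = 0 on, and a second-difference bound away
    from 0; the quadrature analysis rests on these two. The Stieltjes integrals are replaced by sums
    over M subcells per step, bounded uniformly in M. Orders: let V_n be the x-derivative of the
    error e_n. The residual k^(2 alpha) n^(alpha-1) |V_n| is absorbed by Young's inequality into the
    coercive term k^alpha n^(alpha-1) |V_n|^2, leaving k^(3 alpha) sum n^(alpha-1) = O(k^(2 alpha)).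
    The part with r_n cannot be treated so: r_1 is of order k^alpha, which would leave only
    k^(alpha/2) for the error. Paired with |e_n| instead, thanks to u_0 in H^2, it contributes
    O(k^alpha) max |e_n|. *)

Section L2Theory.
Context {R : realType}.
Local Notation mu := (@lebesgue_measure R).
Implicit Types (f g h : R -> R) (c : R).

(** * The Hilbert space structure of L^2(R) *)

Lemma L2_measurable f : L2 f -> measurable_fun setT f.
Proof. by move=> /andP[] /[!inE]. Qed.

Lemma L2_sqr_integrable f :
  L2 f -> mu.-integrable setT (EFin \o (fun x => f x ^+ 2)).
Proof. exact: Lfun2_integrable_sqr. Qed.

Lemma L2I f : measurable_fun setT f ->
  mu.-integrable setT (EFin \o (fun x => f x ^+ 2)) -> L2 f.
Proof.
move=> mf /integrableP[_ ioo]; rewrite /L2 inE; apply/andP; split.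
  by rewrite inE.
rewrite inE /= /finite_norm unlock /Lnorm poweR_lty//.
apply: le_lt_trans ioo; rewrite ge0_le_integral//.
- by move=> x _; rewrite lee_fin powR_ge0.
- apply/measurable_EFinP.
  apply: (@measurableT_comp _ _ _ _ _ _ (fun x : R => x `^ 2)) => //.
  exact: measurableT_comp.
- apply: measurableT_comp => //; apply/measurable_EFinP.
  exact: measurable_funX.
- by move=> x _; rewrite /= lee_fin normrX powR_mulrn.
Qed.

Lemma L2_mul_integrable f g :
  L2 f -> L2 g -> mu.-integrable setT (EFin \o (fun x => f x * g x)).
Proof.
by move=> f2 g2; apply/Lfun1_integrable; exact: Lfun2_mul_Lfun1.
Qed.

Lemma L2D f g : L2 f -> L2 g -> L2 (fun x => f x + g x).
Proof.
move=> f2 g2; have [_] := @Lfun_addr_closed _ _ R mu 2%:E (lee1n 2).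
exact.
Qed.

Lemma L2N f : L2 f -> L2 (fun x => - f x).
Proof. by move=> f2; exact: (@Lfun_oppr_closed _ _ R mu 2%:E f f2). Qed.

Lemma L2B f g : L2 f -> L2 g -> L2 (fun x => f x - g x).
Proof. by move=> f2 g2; apply: L2D => //; exact: L2N. Qed.

Lemma L2Z c f : L2 f -> L2 (fun x => c * f x).
Proof.
move=> f2; have := @Lfun_scale _ _ _ mu f c 2 (ler1n _ 2) f2.
rewrite (_ : c \o* f = (fun x => c * f x))//.
by apply/funext => x /=; rewrite mulrC.
Qed.

Lemma L2_0 : L2 (fun _ : R => 0).
Proof.
apply: L2I; first exact: measurable_cst.
by apply: eq_integrable (integrable0 mu setT) => // x _ /=; rewrite expr0n.
Qed.

Lemma L2dotC f g : L2dot f g = L2dot g f.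
Proof. by apply: eq_Rintegral => x _; rewrite mulrC. Qed.

Lemma L2dotDl f g h : L2 f -> L2 g -> L2 h ->
  L2dot (fun x => f x + g x) h = L2dot f h + L2dot g h.
Proof.
move=> f2 g2 h2; rewrite /L2dot -RintegralD//.
- by apply: eq_Rintegral => x _; rewrite mulrDl.
- exact: L2_mul_integrable.
- exact: L2_mul_integrable.
Qed.

Lemma L2dotZl c f h : L2 f -> L2 h ->
  L2dot (fun x => c * f x) h = c * L2dot f h.
Proof.
move=> f2 h2; rewrite /L2dot -RintegralZl//.
- by apply: eq_Rintegral => x _; rewrite mulrA.
- exact: L2_mul_integrable.
Qed.

Lemma L2dotNl f h : L2 f -> L2 h -> L2dot (fun x => - f x) h = - L2dot f h.
Proof.
move=> f2 h2; rewrite -mulN1r -L2dotZl//.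
by apply: eq_Rintegral => x _; rewrite mulN1r.
Qed.

Lemma L2dotBl f g h : L2 f -> L2 g -> L2 h ->
  L2dot (fun x => f x - g x) h = L2dot f h - L2dot g h.
Proof. by move=> f2 g2 h2; rewrite L2dotDl ?L2dotNl//; exact: L2N. Qed.

Lemma L2dotDr f g h : L2 f -> L2 g -> L2 h ->
  L2dot h (fun x => f x + g x) = L2dot h f + L2dot h g.
Proof. by move=> *; rewrite L2dotC L2dotDl// ![L2dot _ h]L2dotC. Qed.

Lemma L2dotBr f g h : L2 f -> L2 g -> L2 h ->
  L2dot h (fun x => f x - g x) = L2dot h f - L2dot h g.
Proof. by move=> *; rewrite L2dotC L2dotBl// ![L2dot _ h]L2dotC. Qed.

Lemma L2dotZr c f h : L2 f -> L2 h ->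
  L2dot h (fun x => c * f x) = c * L2dot h f.
Proof. by move=> *; rewrite L2dotC L2dotZl// [L2dot _ h]L2dotC. Qed.

Lemma L2norm_ge0 f : 0 <= L2norm f.
Proof. by rewrite fine_ge0// Lnorm_ge0. Qed.

Lemma L2dot_sqr f : L2 f -> L2dot f f = L2norm f ^+ 2.
Proof.
move=> f2.
have ff : (\int[mu]_x (`|f x| `^ 2)%:E = (L2dot f f)%:E)%E.
  rewrite /L2dot /Rintegral fineK; last first.
    by apply: integrable_fin_num => //; exact: L2_mul_integrable.
  by apply: eq_integral => x _; rewrite powR_mulrn// real_normK ?num_real.
rewrite /L2norm unlock /Lnorm /= ff poweR_EFin /= -powR_mulrn ?powR_ge0//.
rewrite -powRrM mulVf ?pnatr_eq0// powRr1// -lee_fin -ff integral_ge0//.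
Qed.

Lemma L2dot_ge0 f : 0 <= L2dot f f.
Proof. by apply: Rintegral_ge0 => x _; rewrite -expr2 sqr_ge0. Qed.

Lemma L2norm_le f c : L2 f -> 0 <= c -> L2dot f f <= c ^+ 2 -> L2norm f <= c.
Proof.
by move=> f2 c0; rewrite L2dot_sqr// ler_sqr// nnegrE// L2norm_ge0.
Qed.

Lemma L2_CauchySchwarz f g : L2 f -> L2 g ->
  `|L2dot f g| <= L2norm f * L2norm g.
Proof.
move=> f2 g2; rewrite -(ler_pXn2r (ltn0Sn 1))// ?nnegrE ?mulr_ge0 ?L2norm_ge0//.
rewrite real_normK ?num_real// exprMn -!L2dot_sqr//.
have H c e : 0 <= c ^+ 2 * L2dot f f + 2 * (c * e * L2dot f g) + e ^+ 2 * L2dot g g.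
  have := L2dot_ge0 (fun x => c * f x + e * g x).
  rewrite L2dotDl ?L2dotDr ?L2dotZl ?L2dotZr//;
    try by do ?[apply: L2D|apply: L2Z].
  by rewrite (L2dotC g f); move=> /le_trans; apply; rewrite le_eqVlt; apply/orP; left; apply/eqP; ring.
have := H (L2dot g g) (- L2dot f g); have := H (L2dot f g) (- L2dot f f).
have := H 1 (- L2dot f g); have := H (- L2dot f g) 1.
have := L2dot_ge0 f; have := L2dot_ge0 g.
move: (L2dot f f) (L2dot g g) (L2dot f g) => A B C B0 A0 H1 H2 H3 H4.
have {}H3 : 0 <= A * (A * B - C ^+ 2) by apply: le_trans H3 _; rewrite le_eqVlt; apply/orP; left; apply/eqP; ring.
have {}H4 : 0 <= B * (A * B - C ^+ 2) by apply: le_trans H4 _; rewrite le_eqVlt; apply/orP; left; apply/eqP; ring.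
rewrite -subr_ge0.
have [A1|A1] := ltP 0 A; first by rewrite -(pmulr_rge0 _ A1).
have [B1|B1] := ltP 0 B; first by rewrite -(pmulr_rge0 _ B1).
have ? : A = 0 by apply/le_anti; rewrite A0 A1.
have ? : B = 0 by apply/le_anti; rewrite B0 B1.
by subst A B; move: H2; nra.
Qed.

Lemma L2normD f g : L2 f -> L2 g ->
  L2norm (fun x => f x + g x) <= L2norm f + L2norm g.
Proof.
move=> f2 g2; apply: L2norm_le; rewrite ?addr_ge0 ?L2norm_ge0//; first exact: L2D.
rewrite L2dotDl ?L2dotDr//; last exact: L2D.
rewrite (L2dotC g f) !L2dot_sqr// sqrrD.
have := L2_CauchySchwarz f2 g2; rewrite ler_norml => /andP[_].
rewrite mulr2n; lra.
Qed.

Lemma L2normZ c f : L2 f -> L2norm (fun x => c * f x) = `|c| * L2norm f.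
Proof.
move=> f2; apply/eqP; rewrite -(@eqrXn2 _ 2)// ?mulr_ge0 ?L2norm_ge0//.
rewrite -L2dot_sqr; last exact: L2Z.
rewrite L2dotZl ?L2dotZr//; last exact: L2Z.
by rewrite L2dot_sqr// exprMn real_normK ?num_real//; apply/eqP; ring.
Qed.

Lemma L2norm0 : L2norm (fun _ : R => 0 : R) = 0.
Proof.
have := L2normZ 0 L2_0.
rewrite (_ : (fun x : R => 0 * 0) = fun=> 0); last first.
  by apply/funext => x; rewrite mul0r.
by rewrite normr0 mul0r.
Qed.

Lemma L2normN f : L2 f -> L2norm (fun x => - f x) = L2norm f.
Proof.
move=> f2; have := L2normZ (-1) f2; rewrite normrN1 mul1r => <-.
by congr L2norm; apply/funext => x; rewrite mulN1r.
Qed.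

Lemma L2normB f g : L2 f -> L2 g ->
  L2norm (fun x => f x - g x) <= L2norm f + L2norm g.
Proof. by move=> f2 g2; rewrite -(L2normN g2) L2normD//; exact: L2N. Qed.

Lemma ae_eq_L2dot f g h : L2 f -> L2 g -> L2 h -> f = g %[ae mu] ->
  L2dot f h = L2dot g h.
Proof.
move=> f2 g2 h2 fg; congr fine; apply: ae_eq_integral => //.
- exact: (measurable_int _ (L2_mul_integrable f2 h2)).
- exact: (measurable_int _ (L2_mul_integrable g2 h2)).
- move: fg; apply: filterS; first exact: (ae_filter_ringOfSetsType mu).
  by move=> x /(_ Logic.I) /= fg _; rewrite fg.
Qed.

Lemma ae_eq_L2norm f g : L2 f -> L2 g -> f = g %[ae mu] ->
  L2norm f = L2norm g.
Proof.
move=> f2 g2 fg; apply/eqP; rewrite -(@eqrXn2 _ 2)// ?L2norm_ge0//.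
rewrite -!L2dot_sqr// (ae_eq_L2dot f2 g2 f2)// L2dotC (ae_eq_L2dot f2 g2 g2)//.
Qed.

End L2Theory.

(** * Smooth functions and bumps *)

Section SmoothFunctions.
Context {R : realType}.
Local Notation mu := (@lebesgue_measure R).
Implicit Types (f g F : R -> R) (a b c d x : R) (n : nat).

(** Inductive form of smoothness that carries the derivatives as witnesses: closure under products
    and affine substitution becomes an induction on [n], without any formula for [derive1n]. *)
Fixpoint diffn n f : Prop :=
  if n is m.+1 then exists2 g, (forall x, is_derive x 1 f (g x)) & diffn m g
  else True.

Lemma diffnW n f : diffn n.+1 f -> diffn n f.
Proof. by elim: n f => //= n IH f [g fg gn]; exists g => //; exact: IH. Qed.

Lemma is_derive_derive1 f g : (forall x, is_derive x 1 f (g x)) -> derive1 f = g.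
Proof. by move=> fg; apply/funext => x; rewrite derive1E; case: (fg x). Qed.

Lemma smoothP f : smooth f <-> forall n, diffn n f.
Proof.
split=> [sf n|df n x].
  elim: n f sf => //= n IH f sf; exists (derive1 f).
    by move=> x; rewrite derive1E; apply/derivableP; exact: (sf 0%N x).
  by apply: IH => m x; have := sf m.+1 x; rewrite derive1Sn.
move: (df n.+1) => {df}; elim: n f => [|n IH] f [g fg gn].
  by rewrite derive1n0; case: (fg x).
by rewrite derive1Sn (is_derive_derive1 fg); exact: IH.
Qed.

Lemma smooth_is_derive f : smooth f -> forall x, is_derive x 1 f (derive1 f x).
Proof. by move=> sf x; rewrite derive1E; apply/derivableP; exact: (sf 0%N x). Qed.

Lemma smooth_derive1 f : smooth f -> smooth (derive1 f).
Proof. by move=> sf n x; have := sf n.+1 x; rewrite derive1Sn. Qed.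

Lemma smooth_primitive F f : smooth f -> (forall x, is_derive x 1 F (f x)) ->
  smooth F.
Proof. by move=> /smoothP sf Ff; apply/smoothP => -[|n] //=; exists f. Qed.

Lemma is_derive_continuous f g : (forall x, is_derive x 1 f (g x)) ->
  continuous f.
Proof.
by move=> fg x; apply/differentiable_continuous/derivable1_diffP; case: (fg x).
Qed.

Lemma smooth_continuous f : smooth f -> continuous f.
Proof. by move=> /smooth_is_derive; exact: is_derive_continuous. Qed.

Lemma diffn_cst n c : diffn n (fun=> c).
Proof.
by elim: n c => //= n IH c; exists (fun=> 0) => // x; exact: is_derive_cst.
Qed.

Lemma diffnD n f g : diffn n f -> diffn n g -> diffn n (fun x => f x + g x).
Proof.
elim: n f g => //= n IH f g [f' ff' nf'] [g' gg' ng'].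
by exists (fun x => f' x + g' x); [move=> x; exact: is_deriveD|exact: IH].
Qed.

Lemma diffnM n f g : diffn n f -> diffn n g -> diffn n (fun x => f x * g x).
Proof.
elim: n f g => //= n IH f g [f' ff' nf'] [g' gg' ng'].
exists (fun x => f x * g' x + g x * f' x); first by move=> x; exact: is_deriveM.
apply: diffnD; apply: IH => //; apply: diffnW => /=.
  by exists f'.
by exists g'.
Qed.

Lemma diffn_affine n f a b : diffn n f -> diffn n (fun x => f (a * x + b)).
Proof.
elim: n f => //= n IH f [f' ff' nf'].
exists (fun x => a * f' (a * x + b)); last first.
  by apply: diffnM; [exact: diffn_cst|exact: IH].
move=> x; rewrite mulrC; apply: is_derive1_comp.
have := is_deriveD (is_deriveZ a (is_derive_id x (1 : R))) (is_derive_cst b x (1 : R)).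
by rewrite addr0 [a *: _]mulr1.
Qed.

Lemma smoothD f g : smooth f -> smooth g -> smooth (fun x => f x + g x).
Proof. by move=> /smoothP sf /smoothP sg; apply/smoothP => n; exact: diffnD. Qed.

Lemma smoothM f g : smooth f -> smooth g -> smooth (fun x => f x * g x).
Proof. by move=> /smoothP sf /smoothP sg; apply/smoothP => n; exact: diffnM. Qed.

Lemma smooth_cst c : smooth (fun=> c).
Proof. by apply/smoothP => n; exact: diffn_cst. Qed.

Lemma smooth_affine f a b : smooth f -> smooth (fun x => f (a * x + b)).
Proof. by move=> /smoothP sf; apply/smoothP => n; exact: diffn_affine. Qed.

Lemma is_derive_quadratic f c : f 0 = 0 -> (forall x, `|f x| <= c * x ^+ 2) ->
  is_derive (0 : R) 1 f 0.
Proof.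
move=> f0 fc; apply/is_derive1_caratheodory; exists (fun x => f x / x).
split; last by rewrite f0 mul0r.
  move=> z; rewrite f0 !subr0; have [->|z0] := eqVneq z 0.
    by rewrite f0 mulr0.
  by rewrite divfK.
have c0 : 0 <= c by have := le_trans (normr_ge0 _) (fc 1); rewrite expr1n mulr1.
apply/cvgrPdist_le => e e0 /=; rewrite f0 mul0r.
near=> z; rewrite sub0r normrN normrM normfV.
have [->|z0] := eqVneq z 0; first by rewrite f0 normr0 mul0r ltW.
rewrite ler_pdivrMr ?normr_gt0//; apply: le_trans (fc z) _.
rewrite -real_normK ?num_real// expr2 mulrA ler_wpM2r//.
have : `|z| <= e / (c + 1).
  by near: z; apply: (@nbhs0_le _ R); rewrite divr_gt0// ltr_wpDl.
rewrite ler_pdivlMr ?ltr_wpDl//; apply: le_trans.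
by rewrite mulrC ler_wpM2l// lerDl.
Unshelve. all: by end_near. Qed.

(** The classical flat function exp(-1/x) with all powers x^-n in front of it: the linear span of
    this family is stable under differentiation, which makes every member smooth by induction. *)
Definition flat n x : R := if 0 < x then x ^- n * expR (- x^-1) else 0.

(** Comes from exp(y) = exp(y/m)^m >= (y/m)^m at y = 1/x with m = n + 2. Two spare powers of x are
    kept because the derivative at 0 is obtained from quadratic decay. *)
Lemma flat_bound n x : `|flat n x| <= (n + 2)%:R ^+ (n + 2) * x ^+ 2.
Proof.
rewrite /flat; case: ifPn => [x0|_]; last first.
  rewrite normr0; apply: mulr_ge0; last exact: sqr_ge0.
  by apply: exprn_ge0; exact: ler0n.
rewrite ger0_norm; last by rewrite mulr_ge0 ?expR_ge0// invr_ge0 exprn_ge0// ltW.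
rewrite expRN ler_pdivrMr ?expR_gt0//.
have k0 : 0 < (n + 2)%:R :> R by rewrite ltr0n addn2.
have H : (x^-1 / (n + 2)%:R) ^+ (n + 2) <= expR x^-1.
  rewrite -[in leRHS](@divfK _ (n + 2)%:R _ x^-1) ?gt_eqF// expRM_natr.
  apply: lerXn2r; rewrite ?nnegrE ?expR_ge0//.
    by rewrite divr_ge0// ?invr_ge0 ltW.
  by apply: le_trans (expR_ge1Dx _); rewrite lerDr.
rewrite exprMn exprVn exprVn ler_pdivrMr ?exprn_gt0// in H.
have := ler_wpM2r (sqr_ge0 x) H.
rewrite -exprVn exprD -mulrA -exprMn mulVf ?gt_eqF// expr1n mulr1 exprVn.
move=> h; apply: (le_trans h); rewrite le_eqVlt; apply/orP; left; apply/eqP.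
ring.
Qed.

Lemma is_derive_flat n x :
  is_derive x 1 (flat n) (flat (n + 2) x - n%:R * flat n.+1 x).
Proof.
have [x0|x0|->] := ltgtP x 0.
- rewrite /flat ltNge (ltW x0)/= mulr0 subrr.
  apply: (@near_eq_is_derive _ _ _ (cst 0)).
  near=> z; rewrite ltNge ltW//; near: z; exact: lt_nbhsl.
- apply: (@near_eq_is_derive _ _ _ (fun x => x ^- n * expR (- x^-1))).
    by near=> z; rewrite /flat ifT//; near: z; exact: lt_nbhsr.
  rewrite /flat x0.
  have xn : x != 0 by rewrite gt_eqF.
  have dV : is_derive x 1 (fun y : R => y^-1) (- x ^- 2 *: 1).
    exact: (@is_deriveV _ id).
  have dn : is_derive x 1 ((fun y : R => y^-1) ^+ n) _ := is_deriveX n dV.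
  have dN : is_derive x 1 (- (fun y : R => y^-1)) _ := is_deriveN dV.
  have dE : is_derive x 1 (expR \o (- (fun y : R => y^-1))) _ :=
    is_derive1_comp (is_derive_expR _) dN.
  have dM := is_deriveM dn dE.
  have E : ((fun y : R => y^-1) ^+ n * (expR \o - (fun y : R => y^-1))) =
     (fun x : R => x ^- n * expR (- x^-1)).
    by apply/funext => y /=; rewrite !fctE exprVn.
  rewrite -E; apply: (is_derive_eq dM).
  rewrite !fctE /= /GRing.scale /= !mulr1 -!exprVn.
  case: n {dn dM E} => [|n]; first by rewrite !expr0 !addn2 /=; ring.
  by rewrite /= !addn2 !exprS; ring.
- have f00 m : flat m 0 = 0 by rewrite /flat ltxx.
  rewrite !f00 mulr0 subrr.
  apply: (@is_derive_quadratic _ ((n + 2)%:R ^+ (n + 2))).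
    exact: f00.
  exact: flat_bound.
Unshelve. all: by end_near. Qed.

Lemma smooth_flat n : smooth (flat n).
Proof.
apply/smoothP => m; elim: m n => //= m IH n.
exists (fun x => flat (n + 2) x + (- n%:R) * flat n.+1 x).
  by move=> x; rewrite mulNr; exact: is_derive_flat.
by apply: diffnD => //; apply: diffnM => //; exact: diffn_cst.
Qed.

Lemma bump_exists c d : exists b : R -> R, [/\ smooth b, forall x, 0 <= b x,
  forall x, c < x < d -> 0 < b x & forall x, ~~ (c < x < d) -> b x = 0].
Proof.
have f0 x : 0 <= flat 0 x by rewrite /flat; case: ifP => // _; rewrite expr0 invr1 mul1r expR_ge0.
exists (fun x => flat 0 (1 * x + - c) * flat 0 (- 1 * x + d)); split.
- by apply: smoothM; apply: smooth_affine; exact: smooth_flat.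
- by move=> x; rewrite mulr_ge0.
- move=> x /andP[cx xd]; rewrite mul1r mulN1r /flat subr_gt0 cx [- x + d]addrC subr_gt0 xd.
  by rewrite !expr0 invr1 !mul1r mulr_gt0 ?expR_gt0.
- move=> x; rewrite negb_and -!leNgt mul1r mulN1r => /orP[xc|dx].
    by rewrite /flat ltNge subr_le0 xc mul0r.
  by rewrite /flat [in X in _ * X]ltNge [- x + d]addrC subr_le0 dx mulr0.
Qed.

End SmoothFunctions.

(** * Primitives and mollifiers *)

Section Primitives.
Context {R : realType}.
Local Notation mu := (@lebesgue_measure R).
Implicit Types (f g F b B : R -> R) (a c d e x y : R).

Lemma continuous_integrable_itv f a c : continuous f ->
  mu.-integrable `[a, c] (EFin \o f).
Proof.
move=> cf; apply: continuous_compact_integrable; first exact: segment_compact.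
exact: continuous_subspaceT.
Qed.

Lemma Rintegral_itv_derive F f a c : (forall x, is_derive x 1 F (f x)) ->
  continuous f -> a <= c -> \int[mu]_(x in `[a, c]) f x = F c - F a.
Proof.
move=> Ff cf; rewrite le_eqVlt => /predU1P[->|ac].
  by rewrite subrr set_itv1 Rintegral_set1.
have cF := is_derive_continuous Ff.
rewrite /Rintegral (@continuous_FTC2 _ f F)//.
- exact: continuous_subspaceT.
- split.
  + by move=> x _; case: (Ff x).
  + exact/cvg_at_right_filter/cF.
  + exact/cvg_at_left_filter/cF.
- by move=> x _; rewrite derive1E; case: (Ff x).
Qed.

Lemma primitive_exists f c : continuous f -> (forall x, x < c -> f x = 0) ->
  exists2 F : R -> R, forall x, is_derive x 1 F (f x) &
                      forall x, x < c -> F x = 0.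
Proof.
(* The base point lies strictly to the left of [c], so that the fundamental theorem of calculus also
   applies at x = c. *)
move=> cf f0; pose F x := \int[mu]_(t in `[c - 1, x]) f t.
have F0 x : x < c -> F x = 0.
  move=> xc; rewrite /F (@eq_Rintegral _ _ _ mu _ (fun=> 0)) ?Rintegral_cst ?mul0r//.
  move=> y; rewrite inE/= in_itv/= => /andP[_ yx]; apply: f0.
  exact: le_lt_trans xc.
exists F => // x; have [xc|cx] := ltP x c.
  rewrite f0//; apply: (@near_eq_is_derive _ _ _ (cst 0)).
  by near=> y; rewrite /= F0//; near: y; exact: lt_nbhsl.
have xx : x < x + 1 by rewrite ltrDl.
have c1x : c - 1 < x by rewrite ltrBlDr (le_lt_trans cx)// ltrDl.
have [dF dE] := continuous_FTC1_closed xx (continuous_integrable_itv _ _ cf) c1x (cf x).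
by apply: DeriveDef; [exact: dF|rewrite -derive1E].
Unshelve. all: by end_near. Qed.

Lemma is_derive0_cst f a c : (forall x, a < x < c -> is_derive x 1 f 0) ->
  continuous f -> a <= c -> f a = f c.
Proof.
move=> df cf ac; apply/esym/eqP; rewrite -subr_eq0; apply/eqP.
have cfw : {within `[a, c], continuous f} by exact: continuous_subspaceT.
have dfi x : x \in `]a, c[ -> is_derive x 1 f 0.
  by rewrite in_itv; exact: df.
by have [_ _ ->] := MVT_segment ac dfi cfw; rewrite mul0r.
Qed.

Lemma primitive_cst F f d x : (forall x, is_derive x 1 F (f x)) ->
  (forall x, d < x -> f x = 0) -> d <= x -> F x = F d.
Proof.
move=> Ff f0 dx; apply/esym/is_derive0_cst => //; last exact: is_derive_continuous Ff.
by move=> y /andP[dy _]; rewrite -(f0 y).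
Qed.

Lemma primitive_lipschitz F f a c m : (forall x, is_derive x 1 F (f x)) ->
  (forall x, `|f x| <= m) -> `|F a - F c| <= m * `|a - c|.
Proof.
move=> Ff fm; wlog ac : a c / c <= a.
  move=> H; have [/H//|/ltW /H] := leP c a.
  by rewrite distrC [X in _ -> _ <= _ * X]distrC.
have cF : {within `[c, a], continuous F}.
  exact/continuous_subspaceT/(is_derive_continuous Ff).
have [x _ ->] := MVT_segment ac (fun x _ => Ff x) cF.
by rewrite normrM ler_wpM2r.
Qed.

Lemma primitive_homo F f a c : (forall x, is_derive x 1 F (f x)) ->
  (forall x, 0 <= f x) -> a <= c -> F a <= F c.
Proof.
move=> Ff f0 ac; rewrite -subr_ge0.
have cF : {within `[a, c], continuous F}.
  exact/continuous_subspaceT/(is_derive_continuous Ff).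
have [x _ ->] := MVT_segment ac (fun x _ => Ff x) cF.
by rewrite mulr_ge0// subr_ge0.
Qed.

(** One bump, normalized by its mass, provides both tools used later: [b] as an approximate Dirac
    mass, and its primitive [B] as a smooth step from which cutoffs are built. *)
Lemma mollifier_exists e : 0 < e -> exists b B,
  [/\ smooth b /\ forall x, is_derive x 1 B (b x),
      forall x, 0 <= b x, forall x, e <= `|x| -> b x = 0,
      forall x, x <= - e -> B x = 0 & forall x, e <= x -> B x = 1].
Proof.
move=> e0; have [b [sb b0 bp bN]] := bump_exists (- e) e.
have cb := smooth_continuous sb.
have [B Bb B0] : exists2 B, forall x, is_derive x 1 B (b x) &
    forall x, x < - e -> B x = 0.
  by apply: primitive_exists => // x xe; apply: bN; rewrite ltNge ltW.
have {}B0 x : x <= - e -> B x = 0.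
  move=> xe; have : B (- e - 1) = B (- e).
    apply: is_derive0_cst; last by rewrite gerDl lerN10.
    - move=> y /andP[_ ye]; rewrite -(bN y)//.
      by rewrite negb_and -leNgt (ltW ye).
    - exact: is_derive_continuous Bb.
  rewrite B0 ?gtrDl ?ltrN10// => Be.
  by move: xe; rewrite le_eqVlt => /predU1P[->//|/B0].
have Bpos : 0 < B e.
  have cB : {within `[- e, e], continuous B}.
    exact/continuous_subspaceT/(is_derive_continuous Bb).
  have [|x] := MVT _ (fun x _ => Bb x) cB; first by rewrite gt0_cp.
  rewrite in_itv/= => xe; rewrite (B0 (- e))// subr0 => ->.
  by rewrite mulr_gt0 ?bp// opprK addr_gt0.
exists (fun x => (B e)^-1 * b x), (fun x => (B e)^-1 * B x); split.
- split; first by apply: smoothM; [exact: smooth_cst|by []].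
  by move=> x; apply: is_deriveZ.
- by move=> x; rewrite mulr_ge0// invr_ge0 ltW.
- move=> x xe; rewrite bN ?mulr0//; apply: contraL xe.
  by rewrite -ltNge ltr_norml.
- by move=> x /B0 ->; rewrite mulr0.
- move=> x ex; rewrite (@primitive_cst B b e)// ?mulVf// ?gt_eqF//.
  by move=> y ey; apply: bN; rewrite negb_and -!leNgt (ltW ey) orbT.
Qed.

End Primitives.

(** * Test functions *)

Section TestFunctions.
Context {R : realType}.
Local Notation mu := (@lebesgue_measure R).
Implicit Types (f g F phi : R -> R) (a b : \bar R) (c d e x y : R).

Lemma test_continuous a b phi : test_function a b phi -> continuous phi.
Proof. by move=> [/smooth_continuous]. Qed.

Lemma test_measurable a b phi : test_function a b phi ->
  measurable_fun setT phi.
Proof. by move=> /test_continuous; exact: continuous_measurable_fun. Qed.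

Lemma test_derive1 a b phi : test_function a b phi ->
  test_function a b (derive1 phi).
Proof.
move=> [s [c [d [ac db H]]]]; split; first exact: smooth_derive1.
exists c, d; split => // x xcd; rewrite derive1E.
have cdo : open (~` [set` `[c, d]]) by apply: closed_openC; exact: itv_closed.
rewrite (@near_eq_derive _ _ _ phi (cst 0)) ?derive_cst//.
have : nbhs x (~` [set` `[c, d]]).
  by apply: open_nbhs_nbhs; split=> //=; exact/negP.
by apply: filterS => y /= /negP yN; rewrite H.
Qed.

Lemma testD a b f g : test_function a b f -> test_function a b g ->
  test_function a b (fun x => f x + g x).
Proof.
move=> [sf [c [d [ac db Hf]]]] [sg [c' [d' [ac' db' Hg]]]].
split; first exact: smoothD.
exists (Num.min c c'), (Num.max d d'); split.
- by rewrite /Num.min; case: ifP.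
- by rewrite /Num.max; case: ifP.
- move=> x; rewrite in_itv/= negb_and -!ltNge lt_min gt_max => H.
  rewrite Hf ?Hg ?addr0// in_itv/= negb_and -!ltNge.
  + by case/orP: H => /andP[H1 H2]; rewrite ?H1 ?H2 ?orbT.
  + by case/orP: H => /andP[H1 H2]; rewrite ?H1 ?H2 ?orbT.
Qed.

Lemma testZ a b c f : test_function a b f ->
  test_function a b (fun x => c * f x).
Proof.
move=> [sf [x [y [ax yb H]]]]; split.
  by apply: smoothM; [exact: smooth_cst|by []].
by exists x, y; split => // z /H ->; rewrite mulr0.
Qed.

Lemma test0 a b c : (a < c%:E)%E -> (c%:E < b)%E ->
  test_function a b (fun _ : R => 0).
Proof. by move=> ac cb; split; [exact: smooth_cst|exists c, c]. Qed.

Lemma Rintegral_support f c d : (forall x, x \notin `[c, d] -> f x = 0) ->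
  \int[mu]_x f x = \int[mu]_(x in `[c, d]) f x.
Proof.
move=> f0; rewrite [RHS]Rintegral_mkcond; apply: eq_Rintegral => x _.
rewrite patchE; case: ifPn => //; rewrite notin_setE => xN; apply: f0.
by apply/negP.
Qed.

Lemma integrable_support f c d : continuous f ->
  (forall x, x \notin `[c, d] -> f x = 0) ->
  mu.-integrable setT (EFin \o f).
Proof.
move=> cf f0; have := continuous_integrable_itv c d cf.
rewrite integrable_mkcond//; apply: eq_integrable => // x _.
rewrite patchE; case: ifPn => //; rewrite notin_setE => xN /=; rewrite f0//.
by apply/negP.
Qed.

Lemma test_L2 a b phi : test_function a b phi -> L2 phi.
Proof.
move=> tf; apply: L2I; first exact: test_measurable tf.
have [s [c [d [_ _ H]]]] := tf.
apply: (@integrable_support _ c d); last by move=> x /H ->; rewrite expr0n.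
by apply: smooth_continuous; rewrite (_ : (fun x => _) = (fun x => phi x * phi x));
  [exact: smoothM|apply/funext => x; rewrite expr2].
Qed.

End TestFunctions.

(** * Density of test functions in L^2(R) *)

Section L2Density.
Context {R : realType}.
Local Notation mu := (@lebesgue_measure R).
Implicit Types (f g v w phi : R -> R) (a b c d e x y : R) (A : set R).

Lemma L2_bounded_support f c d m : measurable_fun setT f -> c <= d ->
  (forall x, `|f x| <= m) -> (forall x, x \notin `[c, d] -> f x = 0) ->
  L2 f /\ L2dot f f <= m ^+ 2 * (d - c).
Proof.
move=> mf cd fm f0.
have mff : measurable_fun setT (fun x => f x * f x) by exact: measurable_funM.
have ic : mu.-integrable `[c, d] (EFin \o cst (m ^+ 2)).
  by apply: continuous_integrable_itv; exact: cst_continuous.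
have iff : mu.-integrable `[c, d] (EFin \o (fun x => f x * f x)).
  apply: le_integrable ic => //.
    by apply/measurable_EFinP; exact: measurable_funTS.
  move=> x _ /=; rewrite lee_fin normrM (ger0_norm (sqr_ge0 m)) -expr2.
  by rewrite lerXn2r// nnegrE// (le_trans _ (fm x)).
have ff0 x : x \notin `[c, d] -> f x * f x = 0 by move=> /f0 ->; rewrite mul0r.
split.
  apply: L2I => //; move: iff; rewrite integrable_mkcond//; apply: eq_integrable => // x _.
  rewrite patchE /= expr2; case: ifPn => // /negP xN; rewrite ff0//.
  by apply/negP => xi; apply: xN; rewrite inE.
rewrite /L2dot (Rintegral_support ff0).
apply: (@le_trans _ _ (\int[mu]_(x in `[c, d]) m ^+ 2)).
  apply: le_Rintegral => // x _; rewrite -expr2 -real_normK ?num_real//.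
  by rewrite lerXn2r// nnegrE// (le_trans _ (fm x)).
rewrite Rintegral_cst//= lebesgue_measure_itv/= lte_fin.
by case: ifPn => //= _; rewrite mulr0 mulr_ge0 ?sqr_ge0 ?subr_ge0.
Qed.

(** The passage to the limit in both approximations below, by countable unions of sets and by simple
    functions. Dominated convergence is applied to (f - f_n)^2 with majorant (2 g)^2. *)
Lemma L2_dominated (f_ : nat -> R -> R) f g : L2 g ->
  (forall n, measurable_fun setT (f_ n)) -> measurable_fun setT f ->
  (forall n x, `|f_ n x| <= g x) -> (forall x, f_ n x @[n --> \oo] --> f x) ->
  L2 f /\ forall e, 0 < e -> exists n, L2norm (fun x => f x - f_ n x) <= e.
Proof.
move=> g2 mf_ mf fg cf.
have fgl x : `|f x| <= g x.
  have H : `|f_ n x| @[n --> \oo] --> `|f x| by apply: cvg_norm; exact: cf.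
  by apply: (cvgr_to_le H); exact: nearW.
have g0 x : 0 <= g x by exact: le_trans (fgl x).
have L2le (h : R -> R) c : measurable_fun setT h -> (forall x, `|h x| <= c * g x) -> L2 h.
  move=> mh hg; apply: L2I => //.
  apply: le_integrable (L2_sqr_integrable (L2Z c g2)) => //.
    by apply/measurable_EFinP; exact: measurable_funX.
  move=> x _ /=; rewrite lee_fin !normrX lerXn2r ?nnegrE//.
  by apply: le_trans (hg x) _; exact: ler_norm.
have f2 : L2 f by apply: (L2le f 1) => // x; rewrite mul1r.
split=> // e e0.
have h2 n : L2 (fun x => f x - f_ n x).
  apply: (L2le _ 2); first exact: measurable_funB.
  move=> x; apply: le_trans (ler_normB _ _) _.
  by rewrite mulr_natl mulr2n lerD.
pose h n x := ((f x - f_ n x) ^+ 2)%:E.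
have H1 n : measurable_fun setT (h n).
  apply/measurable_EFinP; apply: measurable_funX; exact: measurable_funB.
have H2 : {ae mu, forall x, setT x -> h ^~ x @ \oo --> 0%E}.
  apply: aeW => x _ /=; rewrite /h; apply: cvg_EFin; first exact: nearW.
  rewrite (_ : 0 = (f x - f x) * (f x - f x)); last by rewrite subrr mul0r.
  rewrite (_ : _ \o _ = (fun n => (f x - f_ n x) * (f x - f_ n x))).
    by apply: cvgM; apply: cvgB => //; exact: cvg_cst.
  by apply/funext => n /=; rewrite expr2.
have H3 : {ae mu, forall x n, setT x -> (`|h n x| <= ((2 * g x) ^+ 2)%:E)%E}.
  apply: aeW => x n _; rewrite /h lee_fin ger0_norm ?sqr_ge0//.
  rewrite -real_normK ?num_real// lerXn2r ?nnegrE ?mulr_ge0//.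
  apply: le_trans (ler_normB _ _) _.
  by rewrite mulr_natl mulr2n lerD.
have [_ _] := @dominated_convergence _ _ R mu setT measurableT h (cst 0%E) _
  H1 (measurable_cst 0%E) H2 (L2_sqr_integrable (L2Z 2 g2)) H3.
rewrite integral0 => /fine_cvgP[_] /cvgrPdist_le /(_ (e ^+ 2)).
rewrite exprn_gt0// => /(_ isT) [N _ /(_ N)] /= /(_ (leqnn N)).
rewrite sub0r normrN => H; exists N; apply: L2norm_le (h2 N) (ltW e0) _.
apply: le_trans H; rewrite /L2dot.
apply: le_trans (ler_norm _) _; rewrite le_eqVlt; apply/orP; left; apply/eqP.
by congr (`|fine _|); apply: eq_integral => x _; rewrite /h expr2.
Qed.

Definition L2closure v : Prop := L2 v /\
  forall e, 0 < e -> exists phi, test_function -oo%E +oo%E phi /\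
    L2norm (fun x => v x - phi x) <= e.

Lemma L2closure_test phi : test_function -oo%E +oo%E phi -> L2closure phi.
Proof.
move=> tp; split; first exact: test_L2 tp.
move=> e e0; exists phi; split => //; rewrite (_ : (fun x => _) = (fun=> 0)).
  by rewrite L2norm0 ltW.
by apply/funext => x; rewrite subrr.
Qed.

Lemma L2closure_lim v : L2 v ->
  (forall e, 0 < e -> exists2 w, L2closure w & L2norm (fun x => v x - w x) <= e) ->
  L2closure v.
Proof.
move=> v2 H; split=> // e e0; have e2 : 0 < e / 2 by rewrite divr_gt0.
have [w [w2 /(_ _ e2)[phi [tp wp]]] vw] := H _ e2.
exists phi; split => //; have p2 := test_L2 tp.
rewrite (_ : (fun x => _) = (fun x => (v x - w x) + (w x - phi x))).
  apply: le_trans (L2normD (L2B v2 w2) (L2B w2 p2)) _.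
  by rewrite [leRHS]splitr lerD.
by apply/funext => x; ring.
Qed.

Lemma L2closureD v w : L2closure v -> L2closure w ->
  L2closure (fun x => v x + w x).
Proof.
move=> [v2 Hv] [w2 Hw]; split=> [|e e0]; first exact: L2D.
have e2 : 0 < e / 2 by rewrite divr_gt0.
have [p [tp vp]] := Hv _ e2; have [q [tq wq]] := Hw _ e2.
exists (fun x => p x + q x); split; first exact: testD.
rewrite (_ : (fun x => _) = (fun x => (v x - p x) + (w x - q x))).
  apply: le_trans (L2normD (L2B v2 (test_L2 tp)) (L2B w2 (test_L2 tq))) _.
  by rewrite [leRHS]splitr lerD.
by apply/funext => x; ring.
Qed.

Lemma L2closureZ c v : L2closure v -> L2closure (fun x => c * v x).
Proof.
move=> [v2 Hv]; split=> [|e e0]; first exact: L2Z.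
have c1 : 0 < `|c| + 1 by rewrite ltr_wpDl.
have [|p [tp vp]] := Hv (e / (`|c| + 1)); first by rewrite divr_gt0.
exists (fun x => c * p x); split; first exact: testZ.
rewrite (_ : (fun x => _) = (fun x => c * (v x - p x))); last first.
  by apply/funext => x; ring.
rewrite L2normZ; last exact: L2B v2 (test_L2 tp).
apply: le_trans (ler_wpM2l (normr_ge0 _) vp) _.
rewrite mulrA ler_pdivrMr// mulrC ler_wpM2l ?ltW//.
by rewrite ltrDl.
Qed.

Lemma L2closure_itv a b : L2closure (\1_(`]a, b]%classic : set R)).
Proof.
have [ab|ba] := leP a b; last first.
  rewrite set_itv_ge ?bnd_simp -?leNgt ?ltW// indic0.
  by apply: L2closure_test; exact: (test0 (ltNyr 0) (ltry 0)).
have [i2 _] : L2 (\1_(`]a, b]%classic : set R)) /\ L2dot (\1_(`]a, b]%classic : set R)) \1_(`]a, b]%classic : set R) <= 1 ^+ 2 * (b - a).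
  apply: L2_bounded_support => //.
  - by move=> x; rewrite indicE; case: (_ \in _); rewrite ?normr1 ?normr0.
  - move=> x xN; rewrite indicE memNset//= in_itv/= => /andP[ax xb].
    by move: xN; rewrite in_itv/= (ltW ax) xb.
(* Each jump is smoothed over an interval of length 2 d, where the error is at most 1; its norm is
   then at most sqrt(2 d) = e / 2. *)
split=> // e e0; pose d := (e / 2) ^+ 2 / 2.
have d0 : 0 < d by rewrite divr_gt0// exprn_gt0// divr_gt0.
have [m [M [[sm Mm] m0 mN MN M1]]] := mollifier_exists d0.
have sM := smooth_primitive sm Mm.
have M01 x : 0 <= M x <= 1.
  apply/andP; split.
    have [/MN ->//|xd] := leP x (- d).
    by rewrite -(MN _ (lexx _)); apply: (primitive_homo Mm) => //; exact: ltW.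
  have [/M1 ->//|xd] := leP d x.
  by rewrite -(M1 _ (lexx _)); apply: (primitive_homo Mm) => //; exact: ltW.
pose D c x := \1_(`]c, +oo[%classic : set R) x - M (x - c).
have D2 c : L2 (D c) /\ L2norm (D c) <= e / 2.
  have [] : L2 (D c) /\ L2dot (D c) (D c) <= 1 ^+ 2 * ((c + d) - (c - d)).
    apply: L2_bounded_support.
    - apply: measurable_funB => //; apply: continuous_measurable_fun.
      move=> x; apply: continuous_comp; last exact: smooth_continuous.
      by apply: continuousB; [exact: cvg_id|exact: cst_continuous].
    - by rewrite lerD2l ge0_cp// ltW.
    - move=> x; have := M01 (x - c); rewrite /D indicE.
      case: (_ \in _) => /andP[? ?] /=; first by rewrite ger0_norm; lra.
      by rewrite sub0r normrN ger0_norm.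
    - move=> x; rewrite in_itv/= negb_and -!ltNge => /orP[xc|cx].
        rewrite /D indicE memNset/= ?in_itv/= ?MN ?subrr//; first lra.
        by apply/negP; rewrite andbT -leNgt; lra.
      by rewrite /D indicE mem_set/= ?in_itv/= ?andbT ?M1 ?subrr//; lra.
  move=> D2 DD; split=> //; apply: L2norm_le => //; first lra.
  apply: (le_trans DD); rewrite expr1n mul1r /d; lra.
exists (fun x => M (x - a) - M (x - b)); split.
  split.
    have H c : smooth (fun x => M (x - c)).
      rewrite (_ : (fun x => _) = (fun x => M (1 * x + - c))).
        exact: smooth_affine.
      by apply/funext => x; rewrite mul1r.
    rewrite (_ : (fun x => _) = (fun x => M (x - a) + (-1) * M (x - b))).
      by apply: smoothD; [exact: H|apply: smoothM; [exact: smooth_cst|exact: H]].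
    by apply/funext => x; rewrite mulN1r.
  exists (a - d), (b + d); split; rewrite ?ltNyr ?ltry// => x.
  rewrite in_itv/= negb_and -!ltNge => /orP[xa|bx].
    by rewrite !MN ?subrr//; lra.
  by rewrite !M1 ?subrr//; lra.
rewrite (_ : (fun x => _) = (fun x => D a x - D b x)).
  have [Da Da'] := D2 a; have [Db Db'] := D2 b.
  by apply: le_trans (L2normB Da Db) _; rewrite [leRHS]splitr lerD.
apply/funext => x; rewrite /D !indicE !mem_setE /= !in_itv /= !andbT.
case: (ltP b x) => [bx|xb]; first by rewrite (le_lt_trans ab bx) /=; ring.
by rewrite andbT; case: (a < x) => /=; ring.
Qed.

End L2Density.

Section L2DensityMain.
Context {R : realType}.
Local Notation mu := (@lebesgue_measure R).
Implicit Types (f g v w phi : R -> R) (a b c d e x y : R) (A : set R).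

Let I n : set R := `](- n%:R), n%:R]%classic.

Let L2I_ n : L2 (\1_(I n) : R -> R).
Proof. by have [] := L2closure_itv (- n%:R : R) n%:R. Qed.

(** A Dynkin argument over the half-open intervals. The window [I n] keeps every indicator square
    integrable, and complements are taken inside it, where they are linear combinations. *)
Lemma L2closure_measurable A n : measurable A -> L2closure (\1_(A `&` I n) : R -> R).
Proof.
move=> mA; have {}mA : <<s @ocitv R >> A by [].
move: A mA n; apply: (@dynkin_induction _ (measurableTypeR R) (@ocitv R)
  (fun A => forall n, L2closure (\1_(A `&` I n) : R -> R))).
- by [].
- exact: ocitvI.
- by move=> n; rewrite setTI; exact: L2closure_itv.
- move=> A oA n; have [|x _ <-] := @ocitvI R A (I n) oA; first exact: is_ocitv.
  exact: L2closure_itv.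
- move=> A mA HA n.
  rewrite (_ : \1_(~` A `&` I n) =
    (fun x => \1_(I n) x + (-1) * \1_(A `&` I n) x) :> (R -> R)).
    by apply: L2closureD; [exact: L2closure_itv|exact: L2closureZ].
  apply/funext => x; rewrite !indicE !in_setI in_setC.
  by case: (x \in A); case: (x \in I n) => /=; ring.
- move=> F mF tF HF n; set B := \bigcup_k F k.
  have mB : measurable B by exact: bigcup_measurable.
  (* Disjointness makes these partial sums indicators again, dominated by that of [I n]. *)
  pose f_ m x : R := \sum_(k < m) \1_(F k `&` I n) x.
  have f_V m : L2closure (f_ m).
    elim: m => [|m IH].
      rewrite (_ : f_ 0%N = fun=> 0).
        by apply: L2closure_test; exact: (test0 (ltNyr 0) (ltry 0)).
      by apply/funext => x; rewrite /f_ big_ord0.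
    rewrite (_ : f_ m.+1 = (fun x => f_ m x + \1_(F m `&` I n) x)).
      exact: L2closureD.
    by apply/funext => x; rewrite /f_ big_ord_recr.
  have f_in m k x : F k x -> I n x -> (k < m)%N -> f_ m x = 1.
    move=> Fk Ix km; rewrite /f_ (bigD1 (Ordinal km))//= big1 => [|i ik].
      by rewrite indicE mem_set// addr0.
    rewrite indicE memNset// => -[Fi _].
    suff ki : i = k :> nat by move/eqP: ik; apply; apply/val_inj.
    by apply: tF => //; exists x.
  have f_out m x : ~ (B `&` I n) x -> f_ m x = 0.
    move=> BN; rewrite /f_ big1// => i _; rewrite indicE memNset// => -[Fi Ix].
    by apply: BN; split => //; exists i.
  have f_01 m x : `|f_ m x| <= \1_(I n) x.
    have [[[k _ Fk] Ix]|BN] := pselect ((B `&` I n) x); last first.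
      by rewrite f_out// normr0 indicE.
    rewrite [leRHS]indicE mem_set//=.
    have [km|mk] := ltnP k m; first by rewrite (f_in _ k)// normr1.
    rewrite /f_ big1 ?normr0// => i _; rewrite indicE memNset// => -[Fi _].
    have ik : i = k :> nat by apply: tF => //; exists x.
    by have := ltn_ord i; rewrite ltnNge ik mk.
  have [||||B2 Bl] := @L2_dominated R f_ (\1_(B `&` I n)) (\1_(I n)) (L2I_ n).
  + by move=> m; have [/L2_measurable] := f_V m.
  + apply: measurable_indic; apply: measurableI; [exact: mB|exact: measurable_itv].
  + exact: f_01.
  + move=> x; apply/cvgrPdist_le => e e0.
    have [[[k _ Fk] Ix]|BN] := pselect ((B `&` I n) x).
      exists k.+1 => // m /= km; rewrite (f_in _ k)// indicE mem_set ?subrr ?normr0 ?ltW//.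
      by split => //; exists k.
    by near=> m; rewrite f_out// indicE memNset// subrr normr0 ltW.
  apply: L2closure_lim => // e e0; have [m fm] := Bl _ e0.
  by exists (f_ m).
Unshelve. all: by end_near. Qed.

Import HBSimple HBNNSimple.

(** Simple functions below [v], cut off to [I n], are dominated by [v] and converge to it pointwise,
    since the window eventually contains any given point. *)
Lemma L2closure_ge0 v : L2 v -> (forall x, 0 <= v x) -> L2closure v.
Proof.
move=> v2 v0; have mv := L2_measurable v2.
have mEv : measurable_fun setT (EFin \o v) by exact/measurable_EFinP.
have [g [nd gv]] := @approximation _ _ R setT measurableT _ mEv
  (fun x _ => v0 x).
have {}gv x : g n x @[n --> \oo] --> v x.
  by have := gv x Logic.I; move/fine_cvgP => [].
have gle n x : g n x <= v x.
  rewrite -(cvg_lim _ (gv x))//; apply: nondecreasing_cvgn_le; last exact: cvgP (gv x).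
  by move=> p q pq; have := nd p q pq; move/lefP.
pose f_ n x := g n x * \1_(I n) x.
have f_V n : L2closure (f_ n).
  set s := fset_set (range (g n)).
  pose h m x := \sum_(i < m) (s`_i * \1_((g n) @^-1` [set s`_i] `&` I n) x).
  have -> : f_ n = h #|`s|.
    apply/funext => x; rewrite /f_ fimfunEord mulr_suml; apply: eq_bigr => i _.
    by rewrite -mulrA indicI.
  elim: #|`s| => [|m IH].
    rewrite (_ : h 0%N = fun=> 0).
      by apply: L2closure_test; exact: (test0 (ltNyr 0) (ltry 0)).
    by apply/funext => x; rewrite /h big_ord0.
  rewrite (_ : h m.+1 = (fun x => h m x +
    s`_m * \1_((g n) @^-1` [set s`_m] `&` I n) x)); last first.
    by apply/funext => x; rewrite /h big_ord_recr.
  by apply: L2closureD => //; apply: L2closureZ; exact: L2closure_measurable.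
have H1 n : measurable_fun setT (f_ n) by have [/L2_measurable] := f_V n.
have H2 n x : `|f_ n x| <= v x.
  have gn0 : 0 <= g n x by exact: fun_ge0.
  rewrite /f_ indicE ger0_norm ?mulr_ge0//.
  by case: (_ \in _); rewrite ?mulr1 ?mulr0.
have H3 x : f_ n x @[n --> \oo] --> v x.
  apply: cvg_trans (gv x); apply: near_eq_cvg.
  exists (Num.trunc `|x|).+1 => // n /= xn.
  have {}xn : `|x| < n%:R.
    by apply: lt_le_trans (truncnS_gt _) _; rewrite ler_nat.
  rewrite /f_ indicE mem_set ?mulr1// /I /= in_itv/=.
  by move: xn; rewrite ltr_norml => /andP[-> /ltW ->].
have [_ Hl] := L2_dominated v2 H1 mv H2 H3.
apply: L2closure_lim => // e e0; have [m fm] := Hl _ e0.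
by exists (f_ m).
Qed.

Theorem L2_test_dense v : L2 v -> L2closure v.
Proof.
move=> v2; have mv := L2_measurable v2.
have Lmax (s : R) : L2 (fun x => Num.max (s * v x) 0).
  apply: L2I.
    by apply: measurable_maxr => //; exact: measurable_funM.
  apply: le_integrable (L2_sqr_integrable (L2Z s v2)) => //.
    apply/measurable_EFinP; apply: measurable_funX; apply: measurable_maxr => //.
    exact: measurable_funM.
  move=> x _ /=; rewrite lee_fin !normrX lerXn2r ?nnegrE//.
  by rewrite /Num.max; case: ifP => // _; rewrite normr0.
rewrite (_ : v = fun x => Num.max (1 * v x) 0 + (-1) * Num.max (- 1 * v x) 0).
  apply: L2closureD; [|apply: L2closureZ].
    by apply: L2closure_ge0 => // x; rewrite le_max lexx orbT.
  by apply: L2closure_ge0 => // x; rewrite le_max lexx orbT.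
apply/funext => x; rewrite mul1r !mulN1r /Num.max oppr_lt0.
by case: ltgtP => // [_|_|->]; rewrite ?subr0 ?opprK ?add0r.
Qed.

(** Weak derivatives are only known through test functions; density turns a bound obtained against
    those into one against all of L^2, with the same constant. *)
Lemma L2_dual_bound f (m : R) : L2 f -> 0 <= m ->
  (forall phi, test_function -oo%E +oo%E phi -> `|L2dot f phi| <= m * L2norm phi) ->
  forall v, L2 v -> `|L2dot f v| <= m * L2norm v.
Proof.
move=> f2 m0 H v v2; apply/ler_addgt0Pr => e e0.
have [_ /(_ (e / (L2norm f + m + 1)))] := L2_test_dense v2.
have M1 : 0 < L2norm f + m + 1 by rewrite ltr_wpDl// addr_ge0// L2norm_ge0.
rewrite divr_gt0// => /(_ isT)[phi [tp pv]]; have p2 := test_L2 tp.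
set d := L2norm (fun x => v x - phi x) in pv.
have -> : L2dot f v = L2dot f (fun x => v x - phi x) + L2dot f phi.
  by rewrite L2dotBr// subrK.
apply: le_trans (ler_normD _ _) _.
have pd : L2norm phi <= L2norm v + d.
  rewrite (_ : phi = fun x => v x - (v x - phi x)).
    by apply: L2normB => //; exact: L2B.
  by apply/funext => x; rewrite opprB addrC subrK.
have h1 := L2_CauchySchwarz f2 (L2B v2 p2); rewrite -/d in h1.
have h2 := H _ tp; have h3 := ler_wpM2l m0 pd.
have d0 : 0 <= d by exact: L2norm_ge0.
have h4 : d * (L2norm f + m + 1) <= e by rewrite -ler_pdivlMr.
nra.
Qed.

End L2DensityMain.

(** * Translations of the line *)

Section Translations.
Context {R : realType}.
Local Notation mu := (@lebesgue_measure R).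
Implicit Types (f g : R -> R) (h : R) (A : set R).

Let shift_measurable h : measurable_fun setT
  ((fun x : R => x + h) : measurableTypeR R -> measurableTypeR R).
Proof. exact: (@measurable_funD _ _ R setT id (cst h)). Qed.

(** Uniqueness of Lebesgue measure: its image under a translation agrees with it on half-open
    intervals. *)
Lemma lebesgue_measure_shift h A : measurable A ->
  mu ((fun x : R => x + h) @^-1` A) = mu A.
Proof.
move=> mA; pose m : {measure set (measurableTypeR R) -> \bar R} :=
  measure_function_pushforward__canonical__measure_function_Measure mu
    (shift_measurable h).
apply/esym; apply: (@lebesgue_measure_unique R m) => // X [[a b] _ <-] /=.
rewrite /m /= /pushforward.
rewrite (_ : _ @^-1` _ = `]a - h, b - h]%classic); last first.
  by apply/seteqP; split=> x /=; rewrite !in_itv/= ltrBlDr lerBrDr.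
rewrite !lebesgue_measure_itv/= !lte_fin ltrD2r; case: ifP => // _.
by rewrite -!EFinB; congr EFin; ring.
Qed.

Lemma ge0_integral_shift (f : R -> \bar R) h : measurable_fun setT f ->
  (forall x, 0 <= f x)%E ->
  (\int[mu]_x f (x + h)%R = \int[mu]_x f x)%E.
Proof.
move=> mf f0.
have := @ge0_integral_pushforward _ _ _ _ R _ (shift_measurable h) mu setT f
  measurableT mf (fun x _ => f0 x).
rewrite preimage_setT => <-; apply/esym.
pose m : {measure set (measurableTypeR R) -> \bar R} :=
  measure_function_pushforward__canonical__measure_function_Measure mu
    (shift_measurable h).
apply: (@eq_measure_integral _ (measurableTypeR R) R setT m mu f) => A mA _.
by rewrite /m /= /pushforward lebesgue_measure_shift.
Qed.

Lemma integral_shift (f : R -> \bar R) h : measurable_fun setT f ->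
  (\int[mu]_x f (x + h)%R = \int[mu]_x f x)%E.
Proof.
move=> mf; rewrite integralE [RHS]integralE; congr (_ - _)%E.
  have := ge0_integral_shift h (measurable_funepos mf) (funepos_ge0 f).
  by move=> <-; apply: eq_integral => x _; rewrite !funeposE.
have := ge0_integral_shift h (measurable_funeneg mf) (funeneg_ge0 f).
by move=> <-; apply: eq_integral => x _; rewrite !funenegE.
Qed.

Lemma L2_shift f h : L2 f -> L2 (fun x => f (x + h)).
Proof.
move=> f2; have mf := L2_measurable f2; apply: L2I.
  exact: (@measurableT_comp _ _ _ _ _ _ f) (shift_measurable h).
have /integrableP[mff ioo] := L2_sqr_integrable f2; apply/integrableP; split.
  apply/measurable_EFinP; apply: measurable_funX.
  exact: (@measurableT_comp _ _ _ _ _ _ f) (shift_measurable h).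
have ma : measurable_fun setT (fun x => `|(f x ^+ 2)%:E|%E).
  exact: measurableT_comp mff.
by have := integral_shift h ma => /= ->.
Qed.

Lemma L2dot_shift f g h : L2 f -> L2 g ->
  L2dot (fun x => f (x + h)) (fun x => g (x + h)) = L2dot f g.
Proof.
move=> f2 g2; rewrite /L2dot /Rintegral.
rewrite (@integral_shift (fun x => (f x * g x)%:E))//.
apply/measurable_EFinP.
by apply: measurable_funM; exact: L2_measurable.
Qed.

Lemma L2dot_shiftr f g h : L2 f -> L2 g ->
  L2dot f (fun x => g (x - h)) = L2dot (fun x => f (x + h)) g.
Proof.
move=> f2 g2; rewrite -(L2dot_shift h f2 (L2_shift (- h) g2)).
by congr (L2dot _ _); apply/funext => x; rewrite addrK.
Qed.

End Translations.

(** * Difference quotients and integration by parts in H^1(R) *)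

Section H1Calculus.
Context {R : realType}.
Local Notation mu := (@lebesgue_measure R).
Implicit Types (f g phi Phi : R -> R) (h e x y : R).

Lemma H1_dot_derive1 f f' phi : H1_deriv f f' ->
  test_function -oo%E +oo%E phi -> L2dot f (derive1 phi) = - L2dot f' phi.
Proof. by move=> [_ _]; exact. Qed.

Lemma H1D f f' g g' : H1_deriv f f' -> H1_deriv g g' ->
  H1_deriv (fun x => f x + g x) (fun x => f' x + g' x).
Proof.
move=> [f2 f2' Hf] [g2 g2' Hg]; split; [exact: L2D|exact: L2D|].
move=> phi tp; have p2 := test_L2 tp; have p2' := test_L2 (test_derive1 tp).
rewrite -/(L2dot _ (derive1 phi)) -/(L2dot _ phi) !L2dotDl//.
by rewrite opprD; congr (_ + _); [exact: Hf|exact: Hg].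
Qed.

Lemma H1Z (c : R) f f' : H1_deriv f f' ->
  H1_deriv (fun x => c * f x) (fun x => c * f' x).
Proof.
move=> [f2 f2' Hf]; split; [exact: L2Z|exact: L2Z|].
move=> phi tp; have p2 := test_L2 tp; have p2' := test_L2 (test_derive1 tp).
rewrite -/(L2dot _ (derive1 phi)) -/(L2dot _ phi) !L2dotZl//.
by rewrite -mulrN; congr (_ * _); exact: Hf.
Qed.

Lemma H1B f f' g g' : H1_deriv f f' -> H1_deriv g g' ->
  H1_deriv (fun x => f x - g x) (fun x => f' x - g' x).
Proof.
move=> Hf Hg; have := H1D Hf (H1Z (-1) Hg).
by congr H1_deriv; apply/funext => x; rewrite mulN1r.
Qed.

Lemma ae_eq_H1 f f' g : L2 g -> f = g %[ae mu] -> H1_deriv f f' ->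
  H1_deriv g f'.
Proof.
move=> g2 fg [f2 f2' H]; split => // phi tp; rewrite -H//.
apply/esym; apply: ae_eq_L2dot => //; exact: test_L2 (test_derive1 tp).
Qed.

(** [Phi] is the integral of [phi] over the sliding window [x - h, x]. Used as a test function it
    converts a weak derivative into a finite difference, and its norm is what bounds that difference
    by h times the norm of the weak derivative. *)
Lemma test_window phi h : test_function -oo%E +oo%E phi -> 0 < h ->
  exists Phi, [/\ test_function -oo%E +oo%E Phi,
    derive1 Phi = (fun x => phi x - phi (x - h)),
    L2norm Phi <= h * L2norm phi &
    forall x, exists2 y, x - h <= y <= x & Phi x = h * phi y].
Proof.
move=> tp h0; have [sp [c [d [_ _ p0]]]] := tp.
have cp := smooth_continuous sp.
have plt x : x < c -> phi x = 0.
  by move=> xc; rewrite p0// in_itv/= leNgt xc.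
have pgt x : d < x -> phi x = 0.
  by move=> dx; rewrite p0// in_itv/= negb_and -!ltNge dx orbT.
have spp := smoothM sp sp; have cpp := smooth_continuous spp.
have [P Pp P0] := primitive_exists cp plt.
have [|Q Qp Q0] := @primitive_exists R (fun x => phi x * phi x) c cpp.
  by move=> x /plt ->; rewrite mulr0.
have cQ := is_derive_continuous Qp.
have [W Wp W0] := primitive_exists cQ Q0.
have shiftD (F f : R -> R) : (forall x : R, is_derive x 1 F (f x)) ->
    forall x : R, is_derive x 1 (fun x => F x - F (x - h)) (f x - f (x - h)).
  move=> Ff x; apply: is_deriveB.
  have Hs : is_derive x 1 (fun y : R => y - h) 1 by exact: is_derive_shift.
  have := @is_derive1_comp _ F (fun y => y - h) x _ _ (Ff _) Hs.
  by rewrite mulr1.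
pose Phi x := P x - P (x - h).
have PhiD := shiftD _ _ Pp.
have sPhi : smooth Phi.
  apply: (smooth_primitive _ PhiD).
  rewrite (_ : (fun x => _) = (fun x => phi x + -1 * phi (1 * x + - h))).
    apply: smoothD; [by []|apply: smoothM; first exact: smooth_cst].
    exact: smooth_affine.
  by apply/funext => x; rewrite mul1r mulN1r.
have Phi0 x : x \notin `[c, d + h] -> Phi x = 0.
  rewrite in_itv/= negb_and -!ltNge /Phi => /orP[xc|dx].
    by rewrite !P0 ?subrr// ltrBlDr (lt_trans xc)// ltrDl.
  rewrite !(@primitive_cst _ P phi d)//; try lra.
have tPhi : test_function -oo%E +oo%E Phi.
  by split => //; exists c, (d + h); rewrite ?ltNyr ?ltry.
exists Phi; split => //; first exact: is_derive_derive1 PhiD.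
  2: {
  move=> x; have xh : x - h <= x by rewrite gerBl ltW.
  have [y yi PE] := MVT_segment xh (fun x _ => Pp x)
    (continuous_subspaceT (is_derive_continuous Pp)).
  by exists y => //; rewrite /Phi PE mulrC; congr (_ * _); ring.
  }
apply: L2norm_le; first exact: test_L2 tPhi.
  by rewrite mulr_ge0 ?L2norm_ge0 ?ltW.
rewrite exprMn -L2dot_sqr; last exact: test_L2 tp.
(* The interval [c, d] may be empty, and then [phi] vanishes identically. *)
have [cd|dc] := leP c d; last first.
  rewrite {1}/L2dot (@Rintegral_support _ (fun x => Phi x * Phi x) (d + h) (d + h)) ?set_itv1 ?Rintegral_set1; last first.
    move=> x _; rewrite /Phi.
    have pz y : phi y = 0 by have [/plt//|/(lt_le_trans dc)/pgt] := ltP y c.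
    have -> : P x = P (x - h).
      by apply: is_derive_0_is_cst => y; rewrite -(pz y).
    by rewrite subrr mul0r.
  by rewrite mulr_ge0 ?sqr_ge0// L2dot_ge0.
(* Cauchy-Schwarz on the window, obtained by integrating (phi - l)^2 >= 0 with [l] the mean of [phi]
   over it; [Q] is a primitive of phi^2. *)
have CS x : Phi x * Phi x <= h * (Q x - Q (x - h)).
  pose l := Phi x / h.
  pose f y := phi y * phi y - 2 * l * phi y + l ^+ 2.
  have fD y : is_derive y 1 (fun y => Q y - 2 * l * P y + l ^+ 2 * y) (f y).
    have := is_deriveD (is_deriveB (Qp y) (is_deriveZ (2 * l) (Pp y)))
      (is_deriveZ (l ^+ 2) (is_derive_id y 1)).
    by rewrite [_ *: 1]mulr1.
  have f0 y : 0 <= f y.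
    by rewrite (_ : f y = (phi y - l) ^+ 2) ?sqr_ge0// /f; ring.
  have := primitive_homo fD f0 (_ : x - h <= x); rewrite gerBl ltW// => /(_ isT).
  have -> : Phi x * Phi x = h * (l * Phi x) by rewrite /l; field; rewrite gt_eqF.
  rewrite ler_pM2l// => H.
  have e1 : l ^+ 2 * h = l * Phi x by rewrite /l; field; rewrite gt_eqF.
  rewrite /Phi in e1 *; nra.
rewrite /L2dot (@Rintegral_support _ (fun x => Phi x * Phi x) c (d + h)); last first.
  by move=> x /Phi0 ->; rewrite mulr0.
rewrite (@Rintegral_support _ (fun x => phi x * phi x) c d); last first.
  by move=> x /p0 ->; rewrite mulr0.
have cQs : continuous (fun x => h * (Q x - Q (x - h))).
  move=> x; apply: cvgM; first exact: cvg_cst.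
  exact: (is_derive_continuous (shiftD _ _ Qp)).
apply: (@le_trans _ _ (\int[mu]_(x in `[c, d + h]) (h * (Q x - Q (x - h))))).
  apply: le_Rintegral => //; try exact: continuous_integrable_itv.
  apply: continuous_integrable_itv; apply: smooth_continuous; exact: smoothM.
have hWD x : is_derive x 1 (fun x => h * (W x - W (x - h))) (h * (Q x - Q (x - h))).
  by apply: is_deriveZ; exact: (shiftD _ _ Wp).
rewrite (Rintegral_itv_derive hWD)//; last by rewrite ler_wpDr// ltW.
rewrite (Rintegral_itv_derive Qp)// addrK.
have Qc : Q c = 0.
  have : Q (c - 1) = Q c.
    apply: is_derive0_cst => //; last by rewrite gerBl.
    by move=> y /andP[_ yc]; have := Qp y; rewrite plt// mulr0.
  by rewrite Q0// ltrBlDr ltrDl.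
have Wc x : x <= c -> W x = 0.
  rewrite le_eqVlt => /predU1P[->|/W0//].
  have : W (c - 1) = W c.
    apply: is_derive0_cst; [|exact: is_derive_continuous Wp|by rewrite gerBl].
    by move=> y /andP[_ yc]; rewrite -(Q0 y yc).
  by rewrite W0// ltrBlDr ltrDl.
rewrite Qc !subr0 [W c]Wc// [W (c - h)]Wc; last by rewrite gerBl ltW.
rewrite subrr mulr0 subr0 expr2 -mulrA ler_pM2l//.
(* Beyond [d] the primitive [Q] is constant, so [W], a primitive of [Q], gains exactly h Q(d) over
   [d, d + h]. *)
have H y : d <= y <= d + h -> Q y = Q d.
  move=> /andP[dy _]; apply: (@primitive_cst _ Q (fun x => phi x * phi x)) => //.
  by move=> x /pgt ->; rewrite mulr0.
have : W (d + h) - Q d * (d + h) = W d - Q d * d.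
  apply/esym; apply: (@is_derive0_cst _ (fun y => W y - Q d * y)).
  - move=> y /andP[dy yd].
    have := is_deriveB (Wp y) (is_deriveZ (Q d) (is_derive_id y 1)).
    by rewrite [_ *: 1]mulr1 H ?subrr// (ltW dy) ltW.
  - move=> x; apply: cvgB; first exact: (is_derive_continuous Wp).
    by apply: cvgM; [exact: cvg_cst|exact: cvg_id].
  - by rewrite lerDl ltW.
by move=> E; rewrite le_eqVlt; apply/orP; left; apply/eqP; lra.
Qed.

End H1Calculus.

Section H1IntegrationByParts.
Context {R : realType}.
Local Notation mu := (@lebesgue_measure R).
Implicit Types (f g phi Phi : R -> R) (h e x y : R).

Lemma test_bounded phi : test_function -oo%E +oo%E phi ->
  exists M : R, 0 <= M /\ forall x, `|phi x| <= M.
Proof.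
move=> [sp [c [d [_ _ p0]]]]; have [cd|dc] := leP c d; last first.
  exists 0; split => // x; rewrite p0 ?normr0// in_itv/= negb_and -!ltNge.
  by have [//|/(lt_le_trans dc) ->] := ltP x c; rewrite orbT.
have cn : {within `[c, d], continuous (fun x => `|phi x|)}.
  apply: continuous_subspaceT => x; apply: cvg_norm.
  exact: smooth_continuous sp x.
have [y yi My] := EVT_max cd cn; exists `|phi y|; split => // x.
have [/My//|/p0 ->] := boolP (x \in `[c, d]); by rewrite normr0.
Qed.

(** By the mean value form of [Phi], the difference is pointwise at most h^2 sup |phi'|, and for h <
    1 it lives on a fixed bounded interval; so the constant does not depend on [h]. *)
Lemma test_window_approx phi : test_function -oo%E +oo%E phi ->
  exists K : R, 0 <= K /\ forall h Phi, 0 < h < 1 ->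
    test_function -oo%E +oo%E Phi ->
    (forall x, exists2 y, x - h <= y <= x & Phi x = h * phi y) ->
    L2norm (fun x => Phi x - h * phi x) <= K * h ^+ 2.
Proof.
move=> tp; have [M [M0 HM]] := test_bounded (test_derive1 tp).
have [sp [c [d [_ _ p0]]]] := tp.
pose d' := Num.max d c + 1.
have cd' : c <= d' by rewrite /d' ler_wpDr// le_max lexx orbT.
have dd' : d + 1 <= d' by rewrite /d' lerD2r le_max lexx.
exists (M * (d' - c + 1)); split; first by rewrite mulr_ge0//; lra.
move=> h Phi /andP[h0 h1] tPhi HPhi.
have [|||x|P2 PP] := @L2_bounded_support R (fun x => Phi x - h * phi x) c d' (M * h ^+ 2).
- apply: measurable_funB; first exact: test_measurable tPhi.
  exact: test_measurable (testZ h tp).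
- by [].
- move=> x; have [y /andP[yx xy] ->] := HPhi x.
  rewrite -mulrBr normrM gtr0_norm// expr2 mulrCA ler_pM2l//.
  apply: le_trans (primitive_lipschitz y x (smooth_is_derive sp) HM) _.
  by apply: ler_wpM2l => //; rewrite distrC ger0_norm; lra.
- rewrite in_itv/= negb_and -!ltNge => H.
  have [y /andP[yx xy] ->] := HPhi x.
  rewrite !p0 ?mulr0 ?subrr// in_itv/= negb_and -!ltNge.
    by case/orP: H => H; apply/orP; [left|right]; lra.
  by case/orP: H => H; apply/orP; [left|right]; lra.
apply: L2norm_le => //.
  by rewrite !mulr_ge0 ?sqr_ge0//; lra.
apply: (le_trans PP).
have E : (M * (d' - c + 1) * h ^+ 2) ^+ 2 = (M * h ^+ 2) ^+ 2 * (d' - c + 1) ^+ 2 by ring.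
rewrite E ler_wpM2l ?sqr_ge0//.
rewrite expr2; nra.
Qed.

Let D f h x := f (x + h) - f x.

Let D2 f h : L2 f -> L2 (D f h).
Proof. by move=> f2; apply: L2B => //; exact: L2_shift. Qed.

Let D_window f f' phi Phi h : H1_deriv f f' -> test_function -oo%E +oo%E phi ->
  test_function -oo%E +oo%E Phi ->
  derive1 Phi = (fun x => phi x - phi (x - h)) ->
  L2dot (D f h) phi = L2dot f' Phi.
Proof.
move=> Hf tp tPhi PhiE; have [f2 f2' _] := Hf; have p2 := test_L2 tp.
rewrite L2dotBl//; last exact: L2_shift.
rewrite -L2dot_shiftr// -L2dotBr//; last exact: L2_shift (- h) p2.
have := H1_dot_derive1 Hf tPhi; rewrite PhiE => E.
rewrite -[RHS]opprK -E -L2dotNl//.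
  rewrite /L2dot; apply: eq_Rintegral => x _; ring.
by apply: L2B => //; exact: L2_shift (- h) p2.
Qed.

Let D_bound f f' v h : H1_deriv f f' -> 0 < h -> L2 v ->
  `|L2dot (D f h) v| <= h * L2norm f' * L2norm v.
Proof.
move=> Hf h0 v2; have [f2 f2' _] := Hf.
apply: L2_dual_bound => //; first exact: D2.
  by rewrite mulr_ge0 ?L2norm_ge0 ?ltW.
move=> phi tp; have [Phi [tPhi PhiE Phin _]] := test_window tp h0.
rewrite (D_window Hf tp tPhi PhiE).
apply: le_trans (L2_CauchySchwarz f2' (test_L2 tPhi)) _.
by rewrite [h * _]mulrC -mulrA ler_wpM2l ?L2norm_ge0.
Qed.

(** Weak convergence of difference quotients. For test functions it follows from
    [test_window_approx]; a general [g] is replaced by a nearby test function, at a cost uniform in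
    [h] because finite differences are bounded by h times the norm of f'. *)
Lemma H1_difference f f' g : H1_deriv f f' -> L2 g ->
  forall e, 0 < e -> exists2 d, 0 < d & forall h, 0 < h < d ->
    `|L2dot (fun x => f (x + h) - f x) g - h * L2dot f' g| <= e * h.
Proof.
move=> Hf g2 e e0; have [f2 f2' _] := Hf.
set N := L2norm f'; have N0 : 0 <= N by exact: L2norm_ge0.
have [_ /(_ (e / (4 * (N + 1))))] := L2_test_dense g2.
rewrite divr_gt0 ?mulr_gt0 ?ltr_wpDl// => /(_ isT)[phi [tp gp]].
have p2 := test_L2 tp.
have [K [K0 HK]] := test_window_approx tp.
have NK : 0 < 2 * (N * K + 1) by rewrite mulr_gt0// ltr_wpDl// mulr_ge0.
exists (Num.min 1 (e / (2 * (N * K + 1)))).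
  by rewrite lt_min ltr01 divr_gt0.
move=> h /andP[h0]; rewrite lt_min => /andP[h1 he].
have [Phi [tPhi PhiE _ PhiM]] := test_window tp h0.
have Df2 := D2 h f2; have P2 := test_L2 tPhi.
have h01 : 0 < h < 1 by rewrite h0.
have -> : L2dot (fun x => f (x + h) - f x) g - h * L2dot f' g =
  L2dot (D f h) (fun x => g x - phi x) +
  (L2dot f' (fun x => Phi x - h * phi x) - h * L2dot f' (fun x => g x - phi x)).
  rewrite !L2dotBr//; last exact: L2Z.
  by rewrite L2dotZr// (D_window Hf tp tPhi PhiE) -/(D f h); ring.
apply: le_trans (ler_normD _ _) _.
have gp2 := L2B g2 p2.
have a1 := D_bound Hf h0 gp2.
have a2 := L2_CauchySchwarz f2' (L2B P2 (L2Z h p2)).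
have a3 := L2_CauchySchwarz f2' gp2.
have a4 := HK _ _ h01 tPhi PhiM.
apply: le_trans (lerD (lexx _) (ler_normB _ _)) _.
rewrite normrM (gtr0_norm h0).
rewrite -/N in a1 a2 a3.
set G := L2norm (fun x => g x - phi x) in gp a1 a3.
have {}gp : G * (4 * (N + 1)) <= e by rewrite -ler_pdivlMr// mulr_gt0// ltr_wpDl.
have {}he : h * (2 * (N * K + 1)) < e by rewrite -ltr_pdivlMr.
have G0 : 0 <= G by exact: L2norm_ge0.
have b1 : 4 * (N * G) <= e by nra.
have b2 : N * K * h * 2 <= e by nra.
have b3 : N * L2norm (fun x => Phi x - h * phi x) <= N * K * h * h.
  by have := ler_wpM2l N0 a4; rewrite expr2 !mulrA.
have b4 : h * `|L2dot f' (fun x => g x - phi x)| <= h * (N * G) by rewrite ler_pM2l.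
have b5 := ler_pM2l h0 (4 * (N * G)) e; rewrite b1 in b5.
have b6 := ler_pM2l h0 (N * K * h * 2) e; rewrite b2 in b6.
move: b5 b6 a1 => /idP b5 /idP b6 a1.
lra.
Qed.

(** [H1_deriv] only offers test functions, while here both factors are merely in H^1. Translation
    invariance gives (D f, g) = - (f, D g) - (D f, D g) for finite differences D; the last term is
    O(h^2), and dividing by h leaves the claim as h tends to 0. *)
Lemma H1_integration_by_parts f f' g g' : H1_deriv f f' -> H1_deriv g g' ->
  L2dot f' g = - L2dot f g'.
Proof.
move=> Hf Hg; have [f2 f2' _] := Hf; have [g2 g2' _] := Hg.
apply/eqP; rewrite -subr_eq0 opprK -normr_le0; apply/ler_addgt0Pr => e e0.
rewrite add0r.
have e3 : 0 < e / 3 by rewrite divr_gt0.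
have [d d0 Hd] := H1_difference Hf g2 e3.
have [d' d0' Hd'] := H1_difference Hg f2 e3.
set N := L2norm f'; set N' := L2norm g'.
have N0 : 0 <= N by exact: L2norm_ge0.
have N0' : 0 <= N' by exact: L2norm_ge0.
have NN : 0 < N * N' + 1 by rewrite ltr_wpDl// mulr_ge0.
pose h := Num.min (d / 2) (Num.min (d' / 2) ((e / 3) / (N * N' + 1))).
have h0 : 0 < h by rewrite !lt_min !divr_gt0.
have hd : h < d by rewrite gt_min gtr_pMr// invf_lt1// ltr1n.
have hd' : h < d' by rewrite !gt_min orbA gtr_pMr// invf_lt1// ltr1n orbT.
have he : h * (N * N' + 1) <= e / 3.
  by rewrite -ler_pdivlMr// !ge_min lexx !orbT.
have {}Hd := Hd h; rewrite h0 hd in Hd; have {}Hd := Hd isT.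
have {}Hd' := Hd' h; rewrite h0 hd' in Hd'; have {}Hd' := Hd' isT.
have Df2 := D2 h f2; have Dg2 := D2 h g2.
have E : L2dot (D f h) g = - L2dot (D g h) f - L2dot (D g h) (D f h).
  have -> : - L2dot (D g h) f - L2dot (D g h) (D f h) =
      - L2dot (D g h) (fun x => f (x + h)).
    rewrite -opprD -L2dotDr//; congr (- L2dot _ _); apply/funext => x.
    by rewrite /D addrC subrK.
  rewrite L2dotBl//; last exact: L2_shift.
  rewrite L2dotBl//; [|exact: L2_shift..].
  rewrite (L2dotC (fun x => g (x + h))) L2dot_shift// (L2dotC g).
  by rewrite opprB.
have DD : `|L2dot (D g h) (D f h)| <= h * h * (N * N').
  apply: le_trans (D_bound Hg h0 Df2) _.
  have : L2norm (D f h) <= h * N.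
    have := D_bound Hf h0 Df2; rewrite L2dot_sqr// ger0_norm ?sqr_ge0//.
    have n0 := L2norm_ge0 (D f h); rewrite -/N expr2.
    move: n0; rewrite le_eqVlt => /predU1P[<- _|n0].
      by rewrite mulr_ge0// ltW.
    by rewrite ler_pM2r.
  have hN : 0 <= h * N' by rewrite mulr_ge0// ltW.
  move=> /(ler_wpM2l hN) H.
  by apply: (le_trans H); rewrite le_eqVlt; apply/orP; left; apply/eqP; ring.
rewrite -(ler_pM2l h0) -{1}(gtr0_norm h0) -normrM.
rewrite -/(D f h) -/(D g h) E in Hd; rewrite -/(D g h) in Hd'.
rewrite (L2dotC f).
have := ler_pM2l h0 (h * (N * N' + 1)) (e / 3); rewrite he => /idP he'.
move: Hd Hd' DD; rewrite !ler_norml => /andP[u1 u2] /andP[u3 u4] /andP[u5 u6].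
by apply/andP; split; nra.
Qed.

End H1IntegrationByParts.

(** * Measurability in time of inner products *)

Section TimeMeasurability.
Context {R : realType}.
Local Notation mu := (@lebesgue_measure R).

Lemma measurable_integral_section
    (F : measurableTypeR R * measurableTypeR R -> \bar R) :
  measurable_fun setT F ->
  measurable_fun [set: measurableTypeR R] (fun t => \int[mu]_x F (t, x))%E.
Proof.
move=> mF.
have mp := @measurable_fun_fubini_tonelli_F _ _ _ (measurableTypeR R) R mu _
  (measurable_funepos mF) (funepos_ge0 _).
have mn := @measurable_fun_fubini_tonelli_F _ _ _ (measurableTypeR R) R mu _
  (measurable_funeneg mF) (funeneg_ge0 _).
have := emeasurable_funB mp mn; apply: eq_measurable_fun => t _.
rewrite [RHS]integralE; congr (_ - _)%E; apply: eq_integral => x _.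
  by rewrite /= !funeposE.
by rewrite /= !funenegE.
Qed.

Lemma L2dot_family_measurable (T : R) (w : R -> R -> R) (chi : R -> R) :
  L2_family T w -> L2 chi ->
  measurable_fun `]0, T]%classic (fun t : R => L2dot (w t) chi).
Proof.
move=> [mw _] c2; have mc := L2_measurable c2.
pose D : set (measurableTypeR R * measurableTypeR R) := `]0, T]%classic `*` [set: R].
have mD : measurable D by apply: measurableX => //; exact: measurable_itv.
pose F : measurableTypeR R * measurableTypeR R -> R := fun z => w z.1 z.2 * chi z.2.
have mF : measurable_fun D F.
  apply: measurable_funM => //.
  by apply: measurable_funTS; apply: (@measurableT_comp _ _ _ _ _ _ chi).
pose G := (EFin \o F) \_ D.
have mG : measurable_fun setT G.
  by apply/(measurable_restrictT _ _).1 => //; exact/measurable_EFinP.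
have := measurable_integral_section mG => mI.
have mI' : measurable_fun setT (fine \o (fun t : measurableTypeR R => \int[mu]_x G (t, x))%E).
  exact: measurableT_comp mI.
have := measurable_funTS (D := `]0, T]%classic) mI'.
apply: eq_measurable_fun => t /set_mem tT.
rewrite /L2dot /Rintegral; congr fine; apply: eq_integral => x _.
by rewrite /G patchE mem_set.
Qed.

End TimeMeasurability.

(** * From weak time derivatives to increments of continuous functions *)

Section WeakIncrements.
Context {R : realType}.
Local Notation mu := (@lebesgue_measure R).
Implicit Types (p q b B psi f : R -> R) (T a c d e k m s t x y M : R).

Lemma restrict_support f T a c : 0 <= a -> c <= T ->
  (forall x, x \notin `[a, c] -> f x = 0) -> f \_ `[0, T] = f \_ `[a, c].
Proof.
move=> a0 cT f0; apply/funext => x; rewrite !patchE.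
case: ifPn => xT; case: ifPn => xa //.
  by apply: f0; apply/negP => xi; move/negP: xa; apply; exact: mem_set.
move/set_mem: xa => /=; rewrite in_itv/= => /andP[ax xc].
exfalso; move/negP: xT; apply; apply: mem_set; rewrite /= in_itv/=.
by rewrite (le_trans a0 ax) (le_trans xc cT).
Qed.

Lemma Rintegral_bound f T a c M : 0 < a -> a <= c -> c <= T ->
  measurable_fun `]0, T]%classic f ->
  (forall x, x \in `[a, c] -> `|f x| <= M) ->
  (forall x, x \notin `[a, c] -> f x = 0) ->
  mu.-integrable `[0, T] (EFin \o f) /\
  `|\int[mu]_(x in `[0, T]) f x| <= M * (c - a).
Proof.
move=> a0 ac cT mf fM f0.
have M0 : 0 <= M by apply: le_trans (fM a _); rewrite // in_itv/= lexx ac.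
have ih : mu.-integrable `[a, c] (EFin \o cst M).
  by apply: continuous_integrable_itv; exact: cst_continuous.
have if' : mu.-integrable `[a, c] (EFin \o f).
  apply: le_integrable ih => //.
    apply/measurable_EFinP; apply: measurable_funS mf => // x /=.
    by rewrite !in_itv/= => /andP[ax xc]; rewrite (lt_le_trans a0 ax) (le_trans xc).
  move=> x /= xa; rewrite lee_fin (ger0_norm M0); exact: fM.
split.
  move: if'; rewrite integrable_mkcond// [X in _ -> X]integrable_mkcond//.
  rewrite !restrict_EFin.
  by rewrite (restrict_support (ltW a0) cT).
rewrite Rintegral_mkcond (restrict_support (ltW a0) cT)// -Rintegral_mkcond.
apply: le_trans (le_normr_Rintegral _ if') _ => //.
apply: (@le_trans _ _ (\int[mu]_(x in `[a, c]) M)).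
  apply: le_Rintegral => //.
  move/integrable_abse : if'; exact.
rewrite Rintegral_cst//= lebesgue_measure_itv/= lte_fin.
by case: ifPn => //= _; rewrite mulr0 mulr_ge0// subr_ge0.
Qed.

(** Recovers the point value [p s] from integrals against b(x - s). The threshold [d0] serves every
    mollifier of smaller width, so that several points can share one mollifier. *)
Lemma mollifier_limit p T s : 0 < s < T -> {within `[0, T], continuous p} ->
  forall e, 0 < e -> exists2 d0, 0 < d0 &
    forall d b B, 0 < d < d0 ->
      smooth b /\ (forall x, is_derive x 1 B (b x)) ->
      (forall x, 0 <= b x) -> (forall x, d <= `|x| -> b x = 0) ->
      (forall x, x <= - d -> B x = 0) -> (forall x, d <= x -> B x = 1) ->
      mu.-integrable `[0, T] (EFin \o (fun x => b (x - s) * p x)) /\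
      `|\int[mu]_(x in `[0, T]) (b (x - s) * p x) - p s| <= e.
Proof.
move=> /andP[s0 sT] cp e e0.
have : {for s, continuous p}.
  by apply: (within_continuous_continuous _ cp); rewrite ?(lt_trans s0)// in_itv/= s0 sT.
move=> /cvgrPdist_le /(_ e e0) [d1 /= d10 Hd1].
exists (Num.min (Num.min s (T - s)) d1); first by rewrite !lt_min s0 subr_gt0 sT d10.
move=> d b B /andP[d0]; rewrite !lt_min => /andP[/andP[ds dT] dd1].
move=> [sb Bb] b0 bN BN B1.
have cb : continuous (fun x => b (x - s)).
  move=> x; apply: continuous_comp; last exact: smooth_continuous.
  by apply: cvgB; [exact: cvg_id|exact: cvg_cst].
have cbw : {within `[0, T], continuous (fun x => b (x - s))}.
  exact: continuous_subspaceT.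
have ibp : mu.-integrable `[0, T] (EFin \o (fun x => b (x - s) * p x)).
  apply: continuous_compact_integrable; first exact: segment_compact.
  by move=> x; apply: cvgM; [exact: cbw|exact: cp].
have ib : mu.-integrable `[0, T] (EFin \o (fun x => b (x - s))).
  exact: continuous_integrable_itv.
have b1 : \int[mu]_(x in `[0, T]) b (x - s) = 1.
  have dB x : is_derive x 1 (fun x => B (x - s)) (b (x - s)).
    have Hs : is_derive x 1 (fun y : R => y - s) 1 by exact: is_derive_shift.
    have := @is_derive1_comp _ B (fun y => y - s) x _ _ (Bb _) Hs.
    by rewrite mulr1.
  rewrite (Rintegral_itv_derive dB cb); last by rewrite ltW// (lt_trans s0).
  by rewrite B1 ?BN ?subr0//; lra.
split=> //.
have ibs : mu.-integrable `[0, T] (EFin \o (fun x => b (x - s) * p s)).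
  apply: continuous_integrable_itv => x; apply: cvgM; [exact: cb|exact: cvg_cst].
have -> : p s = \int[mu]_(x in `[0, T]) (b (x - s) * p s).
  by rewrite RintegralZr// b1 mul1r.
rewrite -RintegralB//.
have iB : mu.-integrable `[0, T] (EFin \o (fun x => b (x - s) * p x - b (x - s) * p s)).
  by apply: eq_integrable (integrableB _ ibp ibs).
apply: le_trans (le_normr_Rintegral _ iB) _ => //.
apply: (@le_trans _ _ (\int[mu]_(x in `[0, T]) (b (x - s) * e))); last first.
  by rewrite RintegralZr// b1 mul1r.
apply: le_Rintegral => //.
- by move/integrable_abse : iB; exact.
- by apply: continuous_integrable_itv => x; apply: cvgM; [exact: cb|exact: cvg_cst].
- move=> x _; rewrite -mulrBr normrM ger0_norm//.
  have [dx|xd] := leP d `|x - s|; first by rewrite bN// !mul0r.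
  apply: ler_wpM2l => //; rewrite distrC; apply: Hd1.
  by rewrite /ball/= distrC (lt_trans xd).
Qed.

End WeakIncrements.

Section WeakIncrementBounds.
Context {R : realType}.
Local Notation mu := (@lebesgue_measure R).
Implicit Types (p q b B psi f : R -> R) (T a c d e k m s t x y M : R).

Lemma integrable_subr (D : set (measurableTypeR R)) f g : measurable D ->
  mu.-integrable D (EFin \o f) -> mu.-integrable D (EFin \o g) ->
  mu.-integrable D (EFin \o (fun x => f x - g x)).
Proof. by move=> mD fi gi; apply: eq_integrable (integrableB mD fi gi). Qed.

Lemma integrable_addr (D : set (measurableTypeR R)) f g : measurable D ->
  mu.-integrable D (EFin \o f) -> mu.-integrable D (EFin \o g) ->
  mu.-integrable D (EFin \o (fun x => f x + g x)).
Proof. by move=> mD fi gi; apply: eq_integrable (integrableD mD fi gi). Qed.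

Let is_derive_sub F f s : (forall x, is_derive x 1 F (f x)) ->
  forall x, is_derive x 1 (fun x => F (x - s)) (f (x - s)).
Proof.
move=> Ff x; have Hs : is_derive x 1 (fun y : R => y - s) 1 by exact: is_derive_shift.
have := @is_derive1_comp _ F (fun y => y - s) x _ _ (Ff _) Hs.
by rewrite mulr1.
Qed.

Let smooth_sub f s : smooth f -> smooth (fun x => f (x - s)).
Proof.
move=> sf; rewrite (_ : (fun x => _) = (fun x => f (1 * x + - s))).
  exact: smooth_affine.
by apply/funext => x; rewrite mul1r.
Qed.

Let smooth_sub2 f s t : smooth f -> smooth (fun x => f (x - s) - f (x - t)).
Proof.
move=> sf; rewrite (_ : (fun x => _) = (fun x => f (x - s) + -1 * f (x - t))).
  apply: smoothD; first exact: smooth_sub.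
  by apply: smoothM; [exact: smooth_cst|exact: smooth_sub].
by apply/funext => x; rewrite mulN1r.
Qed.

Let step01 b B d x : 0 < d -> (forall x, is_derive x 1 B (b x)) ->
  (forall x, 0 <= b x) -> (forall x, x <= - d -> B x = 0) ->
  (forall x, d <= x -> B x = 1) -> 0 <= B x <= 1.
Proof.
move=> d0 Bb b0 BN B1; apply/andP; split.
  have [/BN ->//|xd] := leP x (- d).
  by rewrite -(BN _ (lexx _)); apply: (primitive_homo Bb) => //; exact: ltW.
have [/B1 ->//|xd] := leP d x.
by rewrite -(B1 _ (lexx _)); apply: (primitive_homo Bb) => //; exact: ltW.
Qed.

(** The test function is B(x - s) - B(x - t), a smoothed indicator of [s, t]: the integral of its
    derivative against [p] tends to p(s) - p(t) as the width [d] shrinks, while the assumed bound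
    tends to M (t - s). *)
Lemma weak_increment p T s t M d1 : 0 < s -> s <= t -> t < T -> 0 <= M -> 0 < d1 ->
  {within `[0, T], continuous p} ->
  (forall psi d, 0 < d < d1 -> test_function 0%:E T%:E psi ->
     (forall x, `|psi x| <= 1) -> (forall x, x \notin `[s - d, t + d] -> psi x = 0) ->
     `|\int[mu]_(x in `[0, T]) (derive1 psi x * p x)| <= M * (t - s + 2 * d)) ->
  `|p t - p s| <= M * (t - s).
Proof.
move=> s0 st tT M0 d10 cp H; apply/ler_addgt0Pr => e e0.
have e3 : 0 < e / 4 by rewrite divr_gt0.
have sT : 0 < s < T by rewrite s0 (le_lt_trans st).
have tT' : 0 < t < T by rewrite (lt_le_trans s0).
have [ds ds0 Hs] := mollifier_limit sT cp e3.
have [dt dt0 Ht] := mollifier_limit tT' cp e3.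
(* The last entry keeps the excess 2 d M of the assumed bound below e / 2; the two mollified point
   values cost e / 4 each. *)
pose d2 := Num.min (Num.min (Num.min ds dt) (Num.min s (T - t)))
  (Num.min d1 (e / (4 * (M + 1)))).
have M1 : 0 < 4 * (M + 1) by rewrite mulr_gt0// ltr_wpDl.
have d20 : 0 < d2 by rewrite !lt_min ds0 dt0 s0 subr_gt0 tT d10 divr_gt0.
pose d := d2 / 2; have d0 : 0 < d by rewrite divr_gt0.
have : d < d2 by rewrite gtr_pMr// invf_lt1// ltr1n.
rewrite !lt_min -!andbA => /and5P[dds ddt dds' ddT /andP[dd1 ddM]].
have [b [B [[sb Bb] b0 bN BN B1]]] := mollifier_exists d0.
have [is_ Is] := Hs d b B (introT andP (conj d0 dds)) (conj sb Bb) b0 bN BN B1.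
have [it_ It] := Ht d b B (introT andP (conj d0 ddt)) (conj sb Bb) b0 bN BN B1.
have B01 x := step01 x d0 Bb b0 BN B1.
have sB := smooth_primitive sb Bb.
pose psi x := B (x - s) - B (x - t).
have psi0 x : x \notin `[s - d, t + d] -> psi x = 0.
  rewrite in_itv/= negb_and -!ltNge /psi => /orP[xs|tx].
    by rewrite !BN ?subrr//; clear -xs st d0; lra.
  by rewrite !B1 ?subrr//; clear -tx st d0; lra.
have tpsi : test_function 0%:E T%:E psi.
  split; first exact: smooth_sub2.
  by exists (s - d), (t + d); split; rewrite ?lte_fin//; clear -dds' ddT; lra.
have psiE : derive1 psi = (fun x => b (x - s) - b (x - t)).
  by apply: is_derive_derive1 => x; apply: is_deriveB; exact: is_derive_sub.
have psi1 x : `|psi x| <= 1.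
  rewrite /psi; have /andP[u1 u2] := B01 (x - s); have /andP[u3 u4] := B01 (x - t).
  by clear -u1 u2 u3 u4; rewrite ler_norml; apply/andP; split; lra.
have d01 : 0 < d < d1 by rewrite d0.
have := H psi d d01 tpsi psi1 psi0; rewrite psiE.
have -> : \int[mu]_(x in `[0, T]) ((b (x - s) - b (x - t)) * p x) =
   \int[mu]_(x in `[0, T]) (b (x - s) * p x) - \int[mu]_(x in `[0, T]) (b (x - t) * p x).
  by rewrite -RintegralB//; apply: eq_Rintegral => x _; rewrite mulrBl.
have Md : 4 * (d * M) <= e.
  apply: (@le_trans _ _ (d * (4 * (M + 1)))); last by rewrite -ler_pdivlMr// ltW.
  by rewrite mulrCA ler_pM2l// ler_pM2l// lerDl.
have E : M * (t - s + 2 * d) = M * (t - s) + 2 * (d * M) by ring.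
rewrite E {E}.
move: Is It; set X := \int[mu]_(x in _) _; set Y := \int[mu]_(x in _) _.
rewrite !ler_norml => /andP[u1 u2] /andP[u3 u4] /andP[u5 u6].
by clear -u1 u2 u3 u4 u5 u6 Md e0; apply/andP; split; lra.
Qed.

(** The second primitive of four signed mollifiers at s - k, s, t - k, t is, up to sign, a smoothed
    trapezoid supported near [s - k, t]. Its height is at most the smaller of k and t - s, called m,
    and m (t - s + k) <= 2 k (t - s) produces the product k (t - s). *)
Lemma weak_increment2 p T s t k M d1 : 0 < s - k -> 0 < k -> s <= t -> t < T ->
  0 <= M -> 0 < d1 ->
  {within `[0, T], continuous p} ->
  (forall psi d m, 0 < d < d1 -> test_function 0%:E T%:E psi -> 0 <= m ->
     m <= k -> m <= t - s ->
     (forall x, `|psi x| <= m) -> (forall x, x \notin `[s - k - d, t + d] -> psi x = 0) ->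
     `|\int[mu]_(x in `[0, T]) (derive1 (derive1 psi) x * p x)| <=
        M * m * (t - s + k + 2 * d)) ->
  `|p s - p (s - k) - p t + p (t - k)| <= M * (2 * (k * (t - s))).
Proof.
move=> sk0 k0 st tT M0 d10 cp H; apply/ler_addgt0Pr => e e0.
have e3 : 0 < e / 8 by rewrite divr_gt0.
have i1 : 0 < s < T by apply/andP; split; lra.
have i2 : 0 < t < T by apply/andP; split; lra.
have i3 : 0 < s - k < T by apply/andP; split; lra.
have i4 : 0 < t - k < T by apply/andP; split; lra.
have [ds ds0 Hs] := mollifier_limit i1 cp e3.
have [dt dt0 Ht] := mollifier_limit i2 cp e3.
have [es es0 Gs] := mollifier_limit i3 cp e3.
have [et et0 Gt] := mollifier_limit i4 cp e3.
pose m := Num.min k (t - s).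
have m0 : 0 <= m by rewrite le_min ltW// subr_ge0.
have mk : m <= k by rewrite ge_min lexx.
have mts : m <= t - s by rewrite ge_min lexx orbT.
pose d2 := Num.min (Num.min (Num.min (Num.min ds dt) (Num.min es et))
  (Num.min (s - k) (T - t))) (Num.min d1 (e / (8 * (M * m + 1)))).
have M1 : 0 < 8 * (M * m + 1) by rewrite mulr_gt0// ltr_wpDl// mulr_ge0.
have d20 : 0 < d2.
  by rewrite !lt_min ds0 dt0 es0 et0 sk0 subr_gt0 tT d10 divr_gt0.
pose d := d2 / 2; have d0 : 0 < d by rewrite divr_gt0.
have : d < d2 by rewrite gtr_pMr// invf_lt1// ltr1n.
rewrite !lt_min -!andbA => /and5P[dds ddt des det /and4P[dds' ddT dd1 ddM]].
have [b [B [[sb Bb] b0 bN BN B1]]] := mollifier_exists d0.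
have [is_ Is] := Hs d b B (introT andP (conj d0 dds)) (conj sb Bb) b0 bN BN B1.
have [it_ It] := Ht d b B (introT andP (conj d0 ddt)) (conj sb Bb) b0 bN BN B1.
have [js_ Js] := Gs d b B (introT andP (conj d0 des)) (conj sb Bb) b0 bN BN B1.
have [jt_ Jt] := Gt d b B (introT andP (conj d0 det)) (conj sb Bb) b0 bN BN B1.
have B01 x := step01 x d0 Bb b0 BN B1.
have sB := smooth_primitive sb Bb; have cB := smooth_continuous sB.
have [|W WB W0] := @primitive_exists _ B (- d) cB.
  by move=> x xd; rewrite BN// ltW.
have sW := smooth_primitive sB WB.
have B1n x : `|B x| <= 1.
  by have /andP[u1 u2] := B01 x; rewrite ger0_norm.
have B0 x : 0 <= B x by have /andP[] := B01 x.
(* Past the step, [W] is affine with slope 1, so its four translates cancel to the right of the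
   trapezoid. *)
have W1 x : d <= x -> W x = W d + (x - d).
  move=> dx; have : W d - d = W x - x.
    apply: (@is_derive0_cst _ (fun x => W x - x)) => //.
      move=> y /andP[dy _].
      have := is_deriveB (WB y) (is_derive_id y 1).
      by rewrite B1 ?subrr// ltW.
    move=> y; apply: cvgB; last exact: cvg_id.
    exact: smooth_continuous sW y.
  clear; lra.
pose psi x := (W (x - s) - W (x - (s - k))) - (W (x - t) - W (x - (t - k))).
have psi0 x : x \notin `[s - k - d, t + d] -> psi x = 0.
  rewrite in_itv/= negb_and -!ltNge /psi => /orP[xs|tx].
    by rewrite !W0 ?subrr//; clear -xs k0 st d0; lra.
  rewrite (W1 (x - s)) ?(W1 (x - t)) ?(W1 (x - (s - k))) ?(W1 (x - (t - k)));
    by clear -tx k0 st d0; lra.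
have spsi : smooth psi.
  rewrite (_ : psi = (fun x => (W (x - s) - W (x - (s - k))) +
     -1 * (W (x - t) - W (x - (t - k))))).
    apply: smoothD; first exact: smooth_sub2.
    by apply: smoothM; [exact: smooth_cst|exact: smooth_sub2].
  by apply/funext => x; rewrite mulN1r.
have tpsi : test_function 0%:E T%:E psi.
  by split => //; exists (s - k - d), (t + d); split; rewrite ?lte_fin//; clear -dds' ddT; lra.
have psiE : derive1 (derive1 psi) = (fun x => (b (x - s) - b (x - (s - k))) -
    (b (x - t) - b (x - (t - k)))).
  have -> : derive1 psi = (fun x => (B (x - s) - B (x - (s - k))) -
    (B (x - t) - B (x - (t - k)))).
    by apply: is_derive_derive1 => x; apply: is_deriveB; apply: is_deriveB;
      exact: is_derive_sub.
  by apply: is_derive_derive1 => x; apply: is_deriveB; apply: is_deriveB;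
      exact: is_derive_sub.
have Wd x y : x <= y -> 0 <= W y - W x <= y - x.
  move=> xy; rewrite subr_ge0 (primitive_homo WB B0 xy)/=.
  have := primitive_lipschitz y x WB B1n; rewrite mul1r [X in _ <= X]ger0_norm ?subr_ge0//.
  exact: le_trans (ler_norm _).
have psim x : `|psi x| <= m.
  have /andP[a1 a2] : 0 <= W (x - (s - k)) - W (x - s) <= (x - (s - k)) - (x - s).
    by apply: Wd; clear -k0 st; lra.
  have /andP[a3 a4] : 0 <= W (x - (t - k)) - W (x - t) <= (x - (t - k)) - (x - t).
    by apply: Wd; clear -k0 st; lra.
  have /andP[a5 a6] : 0 <= W (x - s) - W (x - t) <= (x - s) - (x - t).
    by apply: Wd; clear -k0 st; lra.
  have /andP[a7 a8] : 0 <= W (x - (s - k)) - W (x - (t - k)) <=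
      (x - (s - k)) - (x - (t - k)).
    by apply: Wd; clear -k0 st; lra.
  rewrite /psi le_min !ler_norml; clear -a1 a2 a3 a4 a5 a6 a7 a8; apply/andP; split; apply/andP; split; lra.
have d01 : 0 < d < d1 by rewrite d0.
have := H psi d m d01 tpsi m0 mk mts psim psi0; rewrite psiE.
have ijs := integrable_subr (measurable_itv _) is_ js_.
have ijt := integrable_subr (measurable_itv _) it_ jt_.
have -> : \int[mu]_(x in `[0, T]) ((b (x - s) - b (x - (s - k)) -
     (b (x - t) - b (x - (t - k)))) * p x) =
   (\int[mu]_(x in `[0, T]) (b (x - s) * p x) -
    \int[mu]_(x in `[0, T]) (b (x - (s - k)) * p x)) -
   (\int[mu]_(x in `[0, T]) (b (x - t) * p x) -
    \int[mu]_(x in `[0, T]) (b (x - (t - k)) * p x)).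
  rewrite -!RintegralB//.
  by apply: eq_Rintegral => x _; rewrite !mulrBl.
have Md : d * (8 * (M * m + 1)) < e by rewrite -ltr_pdivlMr.
have mm : m * (t - s + k) <= 2 * (k * (t - s)).
  rewrite mulrDr mulr2n mulrDl mul1r lerD//.
    by rewrite ler_wpM2r// subr_ge0.
  by rewrite [m * k]mulrC ler_wpM2l// ltW.
have Mmm := ler_wpM2l M0 mm.
move: Is It Js Jt; set X1 := \int[mu]_(x in _) _; set X2 := \int[mu]_(x in _) _.
set X3 := \int[mu]_(x in _) _; set X4 := \int[mu]_(x in _) _.
rewrite !ler_norml => /andP[u1 u2] /andP[u3 u4] /andP[u5 u6] /andP[u7 u8] /andP[u9 u10].
have E : M * m * (t - s + k + 2 * d) = M * (m * (t - s + k)) + 2 * (d * (M * m)) by ring.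
rewrite E in u9 u10.
have Md' : 8 * (d * (M * m)) <= e by clear -Md d0; lra.
by clear -u1 u2 u3 u4 u5 u6 u7 u8 u9 u10 Md' Mmm e0; apply/andP; split; lra.
Qed.

End WeakIncrementBounds.

(** * Inequalities for real powers *)

Section PowerInequalities.
Context {R : realType}.
Implicit Types (a b d l r t x y z : R).

(** Young's inequality for the product of r^b and 1 with exponents 1 / b and 1 / (1 - b); b = 0 and
    b = 1 are treated apart because there a conjugate exponent degenerates. *)
Lemma powR_bernoulli r b : 0 <= r -> 0 <= b <= 1 -> r `^ b <= 1 + b * (r - 1).
Proof.
move=> r0 /andP[]; rewrite le_eqVlt => /predU1P[<- _|b0].
  by rewrite powRr0 mul0r addr0.
rewrite le_eqVlt => /predU1P[->|b1]; first by rewrite powRr1// mul1r addrC subrK.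
have c0 : 0 < 1 - b by rewrite subr_gt0.
have := @conjugate_powR R (r `^ b) 1 b^-1 (1 - b)^-1.
rewrite mulr1 -powRrM mulfV ?gt_eqF// powRr1// powR1 !invrK.
move=> /(_ (powR_ge0 _ _) ler01 (ltac:(by rewrite invr_gt0)) (ltac:(by rewrite invr_gt0))).
move=> H; apply: le_trans (H _) _; first by ring.
by rewrite le_eqVlt; apply/orP; left; apply/eqP; ring.
Qed.

Lemma powR_tangent b x z : 0 <= b <= 1 -> 0 <= x -> 0 < z ->
  x `^ b <= z `^ b + b * z `^ (b - 1) * (x - z).
Proof.
move=> b01 x0 z0; have xz : 0 <= x / z by rewrite divr_ge0// ltW.
have := powR_bernoulli xz b01.
rewrite -(ler_pM2l (powR_gt0 b z0)) -powRM ?(ltW z0)// mulrC divfK ?gt_eqF//.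
move=> /le_trans; apply; rewrite le_eqVlt; apply/orP; left; apply/eqP.
rewrite powRB ?(gt_eqF z0) ?implybT// powRr1 ?(ltW z0)//.
by field; rewrite gt_eqF.
Qed.

Lemma powR_concave b t x y : 0 <= b <= 1 -> 0 <= x -> 0 <= y -> 0 <= t <= 1 ->
  t * x `^ b + (1 - t) * y `^ b <= (t * x + (1 - t) * y) `^ b.
Proof.
move=> b01 x0 y0 /andP[t0 t1]; have t1' : 0 <= 1 - t by rewrite subr_ge0.
have z0 : 0 <= t * x + (1 - t) * y by rewrite addr_ge0// mulr_ge0.
have [->|tn] := eqVneq t 0; first by rewrite !mul0r !add0r subr0 !mul1r.
have [->|tn'] := eqVneq t 1; first by rewrite subrr !mul0r !addr0 !mul1r.
move: z0; rewrite le_eqVlt => /predU1P[z0|z0].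
  have /andP[] : (t * x == 0) && ((1 - t) * y == 0).
    by rewrite -paddr_eq0 ?mulr_ge0// -z0.
  rewrite !mulf_eq0 (negbTE tn) subr_eq0 [1 == t]eq_sym (negbTE tn') /=.
  move=> /eqP -> /eqP ->; rewrite !mulr0 addr0 -mulrDl.
  by rewrite addrC subrK mul1r.
set z := t * x + (1 - t) * y in z0 *.
have h1 := ler_wpM2l t0 (powR_tangent b01 x0 z0).
have h2 := ler_wpM2l t1' (powR_tangent b01 y0 z0).
apply: le_trans (lerD h1 h2) _; rewrite le_eqVlt; apply/orP; left; apply/eqP.
by rewrite /z; ring.
Qed.

(** Both x and y + d are convex combinations of y and x + d, with complementary weights; the two
    concavity inequalities are added. *)
Lemma powR_increment_anti b x y d : 0 <= b <= 1 -> 0 <= y -> y <= x -> 0 <= d ->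
  (x + d) `^ b - x `^ b <= (y + d) `^ b - y `^ b.
Proof.
move=> b01 y0 yx d0; have [D0|D0] := leP (x + d - y) 0.
  have -> : x = y by apply/le_anti; rewrite yx andbT; lra.
  by [].
pose t := d / (x + d - y).
have t01 : 0 <= t <= 1.
  by rewrite divr_ge0 ?(ltW D0)//= ler_pdivrMr// mul1r; lra.
have xd0 : 0 <= x + d by lra.
have h1 := powR_concave b01 y0 xd0 t01.
have h2 := powR_concave b01 xd0 y0 t01.
have e1 : t * y + (1 - t) * (x + d) = x by rewrite /t; field; rewrite gt_eqF.
have e2 : t * (x + d) + (1 - t) * y = y + d by rewrite /t; field; rewrite gt_eqF.
rewrite e1 in h1; rewrite e2 in h2; lra.
Qed.

Lemma powR_increment_scale b l y d : 0 <= b <= 1 -> 0 <= y -> 0 <= d -> 1 <= l ->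
  (y + l * d) `^ b - y `^ b <= l * ((y + d) `^ b - y `^ b).
Proof.
move=> b01 y0 d0 l1; have l0 : 0 < l by apply: lt_le_trans l1.
have t01 : 0 <= l^-1 <= 1 by rewrite invr_ge0 ltW//= invf_le1.
have yd : 0 <= y + l * d by rewrite addr_ge0// mulr_ge0// ltW.
have := powR_concave b01 yd y0 t01.
have -> : l^-1 * (y + l * d) + (1 - l^-1) * y = y + d by field; rewrite gt_eqF.
rewrite -(ler_pM2l l0) => h.
have e : l * (l^-1 * (y + l * d) `^ b + (1 - l^-1) * y `^ b) =
   (y + l * d) `^ b + (l - 1) * y `^ b by field; rewrite gt_eqF.
rewrite e in h; lra.
Qed.

Lemma powR_sub_le b x y : 0 <= b <= 1 -> 0 <= y -> y <= x -> 0 < x ->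
  x `^ b - y `^ b <= x `^ (b - 1) * (x - y).
Proof.
move=> /andP[b0 b1] y0 yx x0.
rewrite powRB ?(gt_eqF x0) ?implybT// powRr1 ?(ltW x0)//.
have H : x `^ b * (y / x) <= y `^ b.
  move: y0; rewrite le_eqVlt => /predU1P[<-|y0]; first by rewrite mul0r mulr0 powR_ge0.
  have yx1 : 0 < y / x <= 1 by rewrite divr_gt0//= ler_pdivrMr// mul1r.
  have := ger1_powR yx1 b1.
  rewrite -(ler_pM2l (powR_gt0 b x0)) => /le_trans; apply.
  by rewrite -powRM ?(ltW x0) ?divr_ge0 ?(ltW y0) ?(ltW x0)// mulrC divfK ?gt_eqF.
have -> : x `^ b / x * (x - y) = x `^ b - x `^ b * (y / x) by field; rewrite gt_eqF.
by rewrite lerD2l lerN2.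
Qed.

Lemma powR_sub_ge b x y : 0 <= b <= 1 -> 0 <= y -> 0 < x ->
  b * x `^ (b - 1) * (x - y) <= x `^ b - y `^ b.
Proof. by move=> b01 y0 x0; have := powR_tangent b01 y0 x0; lra. Qed.

Lemma powR_bernoulli_ge1 r a : 0 <= r -> 1 <= a -> 1 + a * (r - 1) <= r `^ a.
Proof.
move=> r0 a1; have a0 : 0 < a by apply: lt_le_trans a1.
have b01 : 0 <= a^-1 <= 1 by rewrite invr_ge0 ltW//= invf_le1.
have := powR_bernoulli (powR_ge0 r a) b01.
rewrite -powRrM mulfV ?gt_eqF// powRr1// -(ler_pM2l a0) mulrDr mulrA mulfV ?gt_eqF//.
lra.
Qed.

(** The factor 1 + a covers both regimes: [powR_sub_le] gives 1 for a <= 1, and Bernoulli gives a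
    for a >= 1. *)
Lemma powR_sub_le_gt0 a x y : 0 < a -> 0 <= y -> y <= x -> 0 < x ->
  x `^ a - y `^ a <= (1 + a) * x `^ (a - 1) * (x - y).
Proof.
move=> a0 y0 yx x0; have p0 := powR_ge0 x (a - 1).
have xy0 : 0 <= x - y by rewrite subr_ge0.
have m0 : 0 <= x `^ (a - 1) * (x - y) by exact: mulr_ge0.
have [a1|/ltW a1] := leP a 1.
  have := powR_sub_le (introT andP (conj (ltW a0) a1)) y0 yx x0.
  move=> /le_trans; apply; rewrite -mulrA.
  by rewrite ler_peMl// lerDl ltW.
have := powR_bernoulli_ge1 (divr_ge0 y0 (ltW x0)) a1.
rewrite -(ler_pM2l (powR_gt0 a x0)) -powRM ?(ltW x0) ?divr_ge0 ?(ltW x0)//.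
rewrite [x * _]mulrC divfK ?gt_eqF//.
have -> : x `^ a * (1 + a * (y / x - 1)) = x `^ a - a * (x `^ (a - 1) * (x - y)).
  rewrite powRB ?(gt_eqF x0) ?implybT// powRr1 ?(ltW x0)//.
  by field; rewrite gt_eqF.
rewrite -mulrA mulrDl mul1r; lra.
Qed.

Lemma powR_half_ge x r : 0 <= x -> 0 <= r <= 1 -> x `^ r / 2 <= (x / 2) `^ r.
Proof.
move=> x0 /andP[r0 r1]; rewrite powRM ?invr_ge0// ler_wpM2l ?powR_ge0//.
by apply: ger1_powR => //; rewrite invr_gt0 ltr0n/= invf_le1// ler1n.
Qed.

End PowerInequalities.

(** * Time regularity up to the endpoints *)

Section TimeRegularity.
Context {R : realType}.
Local Notation mu := (@lebesgue_measure R).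
Implicit Types (p q : R -> R) (T s t k x y e M : R) (phi psi : R -> R).

Lemma continuous_L2_dot T (u : R -> R -> R) (chi : R -> R) : continuous_L2 T u ->
  L2 chi -> {within `[0, T], continuous (fun t => L2dot (u t) chi)}.
Proof.
move=> [u2 cu] c2; apply/subspace_continuousP => t /= tT.
have t0T : 0 <= t <= T by move: tT; rewrite in_itv.
apply/cvgrPdist_le => e e0.
have n1 : 0 < L2norm chi + 1 by rewrite ltr_wpDl// L2norm_ge0.
have /cvgrPdist_le/(_ (e / (L2norm chi + 1))) := cu t t0T.
rewrite divr_gt0// => /(_ isT); rewrite !near_withinE; apply: filterS => s H sT.
have s0T : 0 <= s <= T by move: sT; rewrite /= in_itv.
have {}H := H sT; rewrite sub0r normrN (ger0_norm (L2norm_ge0 _)) in H.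
rewrite distrC -L2dotBl//; [|exact: u2..].
apply: le_trans (L2_CauchySchwarz _ c2) _; first by apply: L2B; exact: u2.
have := ler_wpM2r (L2norm_ge0 chi) H; move=> /le_trans; apply.
rewrite mulrAC ler_pdivrMr// ler_wpM2l ?(ltW e0)//.
by rewrite lerDl.
Qed.

(** Test functions in time vanish near 0 and [T], so weak estimates hold only inside the interval;
    this lemma and [within_le_left] carry them to the endpoints by continuity. *)
Lemma within_le_right p q T c s : s < T -> 0 <= s ->
  {within `[0, T], continuous p} -> continuous q ->
  (forall t, s <= t -> t < T -> `|p t - c| <= q t) -> `|p T - c| <= q T.
Proof.
move=> sT s0 cp cq H; have T0 : 0 < T by exact: le_lt_trans sT.
have [_ _ pT] := (continuous_within_itvP _ T0).1 cp.
have pc : `|p x - c| @[x --> T^'-] --> `|p T - c|.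
  by apply: cvg_norm; apply: cvgB => //; exact: cvg_cst.
have qT : q x @[x --> T^'-] --> q T by apply: cvg_at_left_filter; exact: cq.
apply: (ler_cvg_to pc qT).
near=> t; apply: H; near: t; last exact: nbhs_left_lt.
exact: nbhs_left_ge.
Unshelve. all: by end_near. Qed.

Lemma within_le_left p q T c t : 0 < t -> t <= T ->
  {within `[0, T], continuous p} -> q x @[x --> 0^'+] --> q 0 ->
  (forall s, 0 < s -> s <= t -> `|c - p s| <= q s) -> `|c - p 0| <= q 0.
Proof.
move=> t0 tT cp cq H; have T0 : 0 < T by exact: lt_le_trans tT.
have [_ p0 _] := (continuous_within_itvP _ T0).1 cp.
have pc : `|c - p x| @[x --> 0^'+] --> `|c - p 0|.
  by apply: cvg_norm; apply: cvgB => //; exact: cvg_cst.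
apply: (ler_cvg_to pc cq).
near=> s; apply: H; near: s; first exact: nbhs_right_gt.
exact: nbhs_right_le.
Unshelve. all: by end_near. Qed.

(** In effect the integral of M r^(a - 1), without integrating: for t <= 2 s the tangent inequality
    suffices, larger ratios are chained by halving t while the differences of powers telescope, and
    s = 0 follows by continuity. *)
Lemma hoelder_of_local_lipschitz p T a M : 0 < a < 1 -> 0 < T -> 0 <= M ->
  {within `[0, T], continuous p} ->
  (forall s t, 0 < s -> s <= t -> t < T -> `|p t - p s| <= M / s `^ (1 - a) * (t - s)) ->
  forall s t, 0 <= s -> s <= t -> t <= T ->
    `|p t - p s| <= M * (2 / a) * (t `^ a - s `^ a).
Proof.
move=> /andP[a0 a1] T0 M0 cp H.
have a01 : 0 <= a <= 1 by rewrite !ltW.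
have H1 s t : 0 < s -> s <= t -> t <= T ->
    `|p t - p s| <= M / s `^ (1 - a) * (t - s).
  move=> s0; rewrite le_eqVlt => /predU1P[<-|st]; first by rewrite !subrr normr0 mulr0.
  rewrite le_eqVlt => /predU1P[tT|tT]; last exact: (H s t s0 (ltW st) tT).
  have sT : s < T by rewrite -tT.
  rewrite tT; apply: (@within_le_right p (fun t => M / s `^ (1 - a) * (t - s)) T _ s) => //.
  - exact: ltW.
  - move=> x; apply: cvgM; first exact: cvg_cst.
    by apply: cvgB; [exact: cvg_id|exact: cvg_cst].
  - by move=> r sr rT; exact: H.
(* Origin of 2 / a: t^a - s^a >= a t^(a - 1) (t - s), and t^(1 - a) <= 2 s^(1 - a) when t <= 2 s. *)
have H2 s t : 0 < s -> s <= t -> t <= 2 * s -> t <= T ->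
    `|p t - p s| <= M * (2 / a) * (t `^ a - s `^ a).
  move=> s0 st t2 tT; apply: le_trans (H1 s t s0 st tT) _.
  have t0 : 0 < t by exact: lt_le_trans st.
  have := powR_sub_ge a01 (ltW s0) t0; rewrite -(opprB 1 a) powRN.
  have sp := powR_gt0 (1 - a) s0; have tp := powR_gt0 (1 - a) t0.
  set D := t `^ a - s `^ a => h.
  have ts0 : 0 <= t - s by rewrite subr_ge0.
  have D0 : 0 <= D by rewrite subr_ge0 ge0_ler_powR ?nnegrE ?(ltW s0) ?(ltW t0)// ltW.
  have st2 : t `^ (1 - a) <= 2 * s `^ (1 - a).
    have r01 : 0 <= 1 - a <= 1 by apply/andP; split; clear -a0 a1; lra.
    have /andP[r0 _] := r01.
    have := powR_half_ge (ltW t0) r01; rewrite ler_pdivrMr// mulrC => /le_trans; apply.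
    rewrite ler_pM2l// ge0_ler_powR// ?nnegrE ?divr_ge0 ?(ltW t0) ?(ltW s0)//.
    by rewrite ler_pdivrMr// mulrC.
  rewrite -!mulrA ler_wpM2l// mulrC ler_pdivrMr//.
  rewrite mulrAC ler_pdivrMr// in h.
  apply: (@le_trans _ _ (D * (2 * s `^ (1 - a)) / a)).
    by rewrite ler_pdivlMr// mulrC (le_trans h)// ler_wpM2l.
  by rewrite le_eqVlt; apply/orP; left; apply/eqP; ring.
have H3 n s t : 0 < s -> s <= t -> t <= 2 ^+ n * s -> t <= T ->
    `|p t - p s| <= M * (2 / a) * (t `^ a - s `^ a).
  elim: n s t => [|n IH] s t s0 st.
    by rewrite mul1r => ts; apply: H2 => //; apply: (le_trans ts); rewrite ler_peMl ?ler1n// ltW.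
  move=> tn tT; have [t2|t2] := leP t (2 * s); first exact: H2.
  have h1 : s <= t / 2 by rewrite ler_pdivlMr// mulrC ltW.
  have h2 : t / 2 <= 2 ^+ n * s by rewrite ler_pdivrMr// mulrC mulrA -exprS.
  have h3 : t / 2 <= t by clear -s0 st; lra.
  have h4 : 0 < t / 2 by exact: lt_le_trans h1.
  have A1 := IH _ _ s0 h1 h2 (le_trans h3 tT).
  have A2 : `|p t - p (t / 2)| <= M * (2 / a) * (t `^ a - (t / 2) `^ a).
    by apply: H2 => //; rewrite mulrC divfK.
  have -> : p t - p s = (p t - p (t / 2)) + (p (t / 2) - p s) by ring.
  apply: le_trans (ler_normD _ _) _; apply: le_trans (lerD A2 A1) _.
  by rewrite -mulrDr addrA subrK.
have H4 s t : 0 < s -> s <= t -> t <= T ->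
    `|p t - p s| <= M * (2 / a) * (t `^ a - s `^ a).
  move=> s0 st tT; pose n := Num.trunc (t / s).
  apply: (H3 n.+1) => //; rewrite -ler_pdivrMr//.
  apply: (@le_trans _ _ n.+1%:R); first by apply: ltW; exact: truncnS_gt.
  by rewrite -natrX ler_nat ltnW// ltn_expl.
move=> s t; rewrite le_eqVlt => /predU1P[<-|s0]; last exact: H4.
rewrite le_eqVlt => /predU1P[<- _|t0 tT]; first by rewrite !subrr normr0 mulr0.
apply: (@within_le_left p (fun s => M * (2 / a) * (t `^ a - s `^ a)) T _ t) => //.
  apply: cvgM; first exact: cvg_cst.
  apply: cvgB; first exact: cvg_cst.
  by rewrite powR0 ?gt_eqF//; exact: powR_cvg0.
by move=> r r0 rt; exact: H4.
Qed.

End TimeRegularity.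

(** * Regularity of the space derivative in time *)

Section SpaceDerivativeRegularity.
Context {R : realType}.
Local Notation mu := (@lebesgue_measure R).
Implicit Types (T s t k x y e M C a r : R) (phi psi chi v : R -> R).

Lemma weight_bound r x y C z : 0 <= r -> 0 < x -> x <= y -> 0 <= z ->
  y `^ r * z <= C -> z <= C / x `^ r.
Proof.
move=> r0 x0 xy z0 H; rewrite ler_pdivlMr ?powR_gt0// mulrC; apply: le_trans H.
by rewrite ler_wpM2r// ge0_ler_powR ?nnegrE ?(ltW x0)// (le_trans (ltW x0)).
Qed.

(** The time derivative is moved from the test function in t to [u], and only then the x-derivative
    of [ut] is used: [utx] is linked to increments of (u, phi'), hence of u_x, through [u] alone.
    The factor 2 pays for evaluating the weight as far back as s / 2. *)
Lemma weak_dx_increment T a C (u ut utx : R -> R -> R) phi s t :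
  0 < a < 1 -> 0 <= C -> continuous_L2 T u -> weak_dt T u ut ->
  (forall t, 0 < t <= T -> H1_deriv (ut t) (utx t)) ->
  (forall t, 0 < t <= T -> t `^ (1 - a) * L2norm (utx t) <= C) ->
  test_function -oo%E +oo%E phi -> 0 < s -> s <= t -> t < T ->
  `|L2dot (u t) (derive1 phi) - L2dot (u s) (derive1 phi)| <=
    2 * C * L2norm phi / s `^ (1 - a) * (t - s).
Proof.
move=> /andP[a0 a1] C0 cu [_ [Fut _] Hut] Hx Hb tphi s0 st tT.
have p2 := test_L2 tphi; have p2' := test_L2 (test_derive1 tphi).
have N0 := L2norm_ge0 phi.
have sp : 0 < s `^ (1 - a) by rewrite powR_gt0.
have r01 : 0 <= 1 - a <= 1 by apply/andP; split; clear -a0 a1; lra.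
have /andP[r0 _] := r01.
apply: (@weak_increment _ (fun t => L2dot (u t) (derive1 phi)) T s t _ (Num.min (s / 2) (T - t))) => //.
- by rewrite divr_ge0 ?(ltW sp)// !mulr_ge0.
- by rewrite lt_min divr_gt0 ?subr_gt0.
- exact: continuous_L2_dot.
move=> psi d /andP[d0]; rewrite lt_min => /andP[ds dT] tpsi psi1 psi0.
rewrite (Hut psi _ tpsi p2') normrN.
have sd0 : s / 2 <= s - d by clear -ds; lra.
have s20 : 0 < s / 2 by rewrite divr_gt0.
have sd : 0 < s - d by exact: lt_le_trans sd0.
have E : t - s + 2 * d = (t + d) - (s - d) by ring.
rewrite E; apply: (@Rintegral_bound _ _ T (s - d) (t + d) _ sd _ _ _ _ _).2.
- by clear -st d0; lra.
- by clear -dT; lra.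
- apply: measurable_funM; last exact: L2dot_family_measurable Fut p2'.
  by apply: measurable_funTS; exact: test_measurable tpsi.
- move=> x; rewrite in_itv/= => /andP[sx xt].
  have xT : 0 < x <= T by apply/andP; split; clear -sx sd xt dT; lra.
  rewrite normrM; apply: le_trans (ler_piMl _ (psi1 x)) _ => //.
  rewrite (H1_dot_derive1 (Hx x xT) tphi) normrN.
  have [_ x2 _] := Hx x xT.
  apply: le_trans (L2_CauchySchwarz x2 p2) _.
  rewrite mulrAC ler_wpM2r//.
  have := weight_bound r0 s20 (le_trans sd0 sx) (L2norm_ge0 _) (Hb x xT).
  move=> /le_trans; apply.
  have -> : 2 * C / s `^ (1 - a) = C / (s `^ (1 - a) / 2) by field; rewrite gt_eqF.
  rewrite ler_wpM2l// lef_pV2 ?posrE ?powR_gt0 ?divr_gt0//.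
  exact: powR_half_ge (ltW s0) r01.
- by move=> x /psi0 ->; rewrite mul0r.
Qed.

(** The same transfer made twice in time. The singular weight is taken at half of s - k, and 2^(2 -
    a) <= 4. *)
Lemma weak_dx_increment2 T a C (u ut utt uttx : R -> R -> R) phi s t k :
  0 < a < 1 -> 0 <= C -> continuous_L2 T u -> weak_dt T u ut -> weak_dt T ut utt ->
  (forall t, 0 < t <= T -> H1_deriv (utt t) (uttx t)) ->
  (forall t, 0 < t <= T -> t `^ (2 - a) * L2norm (uttx t) <= C) ->
  test_function -oo%E +oo%E phi -> 0 < s - k -> 0 < k -> s <= t -> t < T ->
  `|L2dot (u s) (derive1 phi) - L2dot (u (s - k)) (derive1 phi)
    - L2dot (u t) (derive1 phi) + L2dot (u (t - k)) (derive1 phi)| <=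
    4 * C * L2norm phi / (s - k) `^ (2 - a) * (2 * (k * (t - s))).
Proof.
move=> /andP[a0 a1] C0 cu [_ _ Hut] [_ [Futt _] Hutt] Hx Hb tphi sk k0 st tT.
have p2 := test_L2 tphi; have p2' := test_L2 (test_derive1 tphi).
have N0 := L2norm_ge0 phi.
have sp : 0 < (s - k) `^ (2 - a) by rewrite powR_gt0.
have r0 : 0 <= 2 - a by clear -a1; lra.
apply: (@weak_increment2 _ (fun t => L2dot (u t) (derive1 phi)) T s t k _
  (Num.min ((s - k) / 2) (T - t))) => //.
- by rewrite divr_ge0 ?(ltW sp)// !mulr_ge0.
- by rewrite lt_min divr_gt0//= subr_gt0.
- exact: continuous_L2_dot.
move=> psi d m /andP[d0]; rewrite lt_min => /andP[ds dT] tpsi m0 mk mts psim psi0.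
rewrite (Hut (derive1 psi) _ (test_derive1 tpsi) p2') normrN.
rewrite (Hutt psi _ tpsi p2') normrN.
have sd0 : (s - k) / 2 <= s - k - d by clear -ds; lra.
have s20 : 0 < (s - k) / 2 by rewrite divr_gt0.
have sd : 0 < s - k - d by exact: lt_le_trans sd0.
have E : t - s + k + 2 * d = (t + d) - (s - k - d) by ring.
rewrite E; apply: (@Rintegral_bound _ _ T (s - k - d) (t + d) _ sd _ _ _ _ _).2.
- by clear -st d0 k0; lra.
- by clear -dT; lra.
- apply: measurable_funM; last exact: L2dot_family_measurable Futt p2'.
  by apply: measurable_funTS; exact: test_measurable tpsi.
- move=> x; rewrite in_itv/= => /andP[sx xt].
  have xT : 0 < x <= T by apply/andP; split; clear -sx sd xt dT; lra.
  rewrite normrM mulrC; apply: ler_pM => //.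
  rewrite (H1_dot_derive1 (Hx x xT) tphi) normrN.
  have [_ x2 _] := Hx x xT.
  apply: le_trans (L2_CauchySchwarz x2 p2) _.
  rewrite mulrAC ler_wpM2r//.
  have := weight_bound r0 s20 (le_trans sd0 sx) (L2norm_ge0 _) (Hb x xT).
  move=> /le_trans; apply.
  have -> : 4 * C / (s - k) `^ (2 - a) = C / ((s - k) `^ (2 - a) / 4).
    by field; rewrite gt_eqF.
  rewrite ler_wpM2l// lef_pV2 ?posrE ?powR_gt0 ?divr_gt0//.
  rewrite powRM ?invr_ge0 ?(ltW sk)// ler_wpM2l ?powR_ge0//.
  have -> : (4 : R)^-1 = 2^-1 `^ 2.
    by rewrite powR_mulrn ?invr_ge0//; field.
  apply: ger_powR; first by rewrite invr_gt0 ltr0n/= invf_le1// ler1n.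
  by clear -a0; lra.
- by move=> x /psi0 ->; rewrite mul0r.
Qed.

(** Interface between the hypotheses on u and the scalar consistency analysis, which needs only
    these two bounds. Being linear in the norm of [v], they are proved for test functions and
    extended by [L2_dual_bound]. *)
Theorem space_derivative_regularity T a C (u ut utt utx uttx ux : R -> R -> R) :
  0 < a < 1 -> 0 < T -> 0 <= C -> continuous_L2 T u -> weak_dt T u ut ->
  weak_dt T ut utt ->
  (forall t, 0 < t <= T -> H1_deriv (ut t) (utx t) /\ H1_deriv (utt t) (uttx t)) ->
  (forall t, 0 < t <= T -> t `^ (1 - a) * L2norm (utx t) <= C) ->
  (forall t, 0 < t <= T -> t `^ (2 - a) * L2norm (uttx t) <= C) ->
  (forall t, 0 <= t <= T -> H1_deriv (u t) (ux t)) ->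
  exists2 K, 0 <= K & forall v, L2 v ->
    (forall s t, 0 <= s -> s <= t -> t <= T ->
      `|L2dot (ux t) v - L2dot (ux s) v| <= K * L2norm v * (t `^ a - s `^ a)) /\
    (forall s t k, 0 < s - k -> 0 < k -> s <= t -> t <= T ->
      `|L2dot (ux s) v - L2dot (ux (s - k)) v - L2dot (ux t) v + L2dot (ux (t - k)) v| <=
      K * L2norm v / (s - k) `^ (2 - a) * (k * (t - s))).
Proof.
move=> a01 T0 C0 cu dtu dtut Hx Hb1 Hb2 Hux.
have /andP[a0 a1] := a01.
have Hx1 t : 0 < t <= T -> H1_deriv (ut t) (utx t) by move=> /Hx[].
have Hx2 t : 0 < t <= T -> H1_deriv (utt t) (uttx t) by move=> /Hx[].
have K1 : 0 <= 2 * C * (2 / a) by rewrite !mulr_ge0// invr_ge0 ltW.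
have K2 : 0 <= 8 * C by rewrite mulr_ge0.
exists (2 * C * (2 / a) + 8 * C); first exact: addr_ge0.
have ux2 t : 0 <= t <= T -> L2 (ux t) by move=> /Hux[].
move=> v v2; split.
  move=> s t s0 st tT.
  have sT : 0 <= s <= T by rewrite s0 (le_trans st).
  have tT' : 0 <= t <= T by rewrite (le_trans s0).
  have D0 : 0 <= t `^ a - s `^ a.
    by rewrite subr_ge0 ge0_ler_powR ?nnegrE ?(ltW a0) ?(le_trans s0).
  rewrite -L2dotBl//; [|exact: ux2..].
  apply: (@le_trans _ _ (2 * C * (2 / a) * (t `^ a - s `^ a) * L2norm v)); last first.
    rewrite [leRHS]mulrAC ler_wpM2r ?L2norm_ge0// ler_wpM2r//.
    by rewrite lerDl.
  apply: L2_dual_bound => //; first by apply: L2B; exact: ux2.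
    exact: mulr_ge0.
  move=> phi tphi; have p2 := test_L2 tphi.
  rewrite L2dotBl//; [|exact: ux2..].
  have := H1_dot_derive1 (Hux t tT') tphi; have := H1_dot_derive1 (Hux s sT) tphi.
  move=> /esym/eqP; rewrite eqr_oppLR => /eqP ->.
  move=> /esym/eqP; rewrite eqr_oppLR => /eqP ->.
  rewrite -opprD normrN.
  have := @hoelder_of_local_lipschitz _ (fun t => L2dot (u t) (derive1 phi)) T a
    (2 * C * L2norm phi) a01 T0.
  have -> : 2 * C * (2 / a) * (t `^ a - s `^ a) * L2norm phi =
    2 * C * L2norm phi * (2 / a) * (t `^ a - s `^ a) by ring.
  apply => //.
  - by rewrite !mulr_ge0// L2norm_ge0.
  - by apply: continuous_L2_dot => //; exact: test_L2 (test_derive1 tphi).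
  - by move=> *; exact: (weak_dx_increment a01 C0 cu dtu Hx1 Hb1 tphi).
move=> s t k sk k0 st tT.
have sk1 : 0 <= s - k <= T by apply/andP; split; clear -sk k0 st tT; lra.
have s1 : 0 <= s <= T by apply/andP; split; clear -sk k0 st tT; lra.
have t1 : 0 <= t <= T by apply/andP; split; clear -sk k0 st tT; lra.
have tk1 : 0 <= t - k <= T by apply/andP; split; clear -sk k0 st tT; lra.
have W0 : 0 < (s - k) `^ (2 - a) by rewrite powR_gt0.
have kts : 0 <= k * (t - s) by apply: mulr_ge0; [exact: ltW|rewrite subr_ge0].
have L2s := L2B (L2B (ux2 _ s1) (ux2 _ sk1)) (L2B (ux2 _ t1) (ux2 _ tk1)).
have dotE w : L2 w ->
    L2dot (ux s) w - L2dot (ux (s - k)) w - L2dot (ux t) w + L2dot (ux (t - k)) w =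
    L2dot (fun x => (ux s x - ux (s - k) x) - (ux t x - ux (t - k) x)) w.
  move=> w2; rewrite L2dotBl//; [|by apply: L2B; exact: ux2..].
  by rewrite !L2dotBl//; try exact: ux2; ring.
rewrite dotE//.
apply: (@le_trans _ _ (8 * C / (s - k) `^ (2 - a) * (k * (t - s)) * L2norm v)); last first.
  have -> : (2 * C * (2 / a) + 8 * C) * L2norm v / (s - k) `^ (2 - a) * (k * (t - s)) =
    (2 * C * (2 / a) + 8 * C) / (s - k) `^ (2 - a) * (k * (t - s)) * L2norm v by ring.
  rewrite ler_wpM2r ?L2norm_ge0// ler_wpM2r// ler_wpM2r ?invr_ge0 ?(ltW W0)//.
  by rewrite lerDr.
apply: L2_dual_bound => //.
  by rewrite mulr_ge0// divr_ge0// ltW.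
move=> phi tphi; have p2 := test_L2 tphi; rewrite -dotE//.
have ibp r : 0 <= r <= T -> L2dot (ux r) phi = - L2dot (u r) (derive1 phi).
  by move=> rT; rewrite (H1_dot_derive1 (Hux r rT) tphi) opprK.
rewrite !ibp//.
have E : - L2dot (u s) (derive1 phi) - - L2dot (u (s - k)) (derive1 phi) -
   - L2dot (u t) (derive1 phi) + - L2dot (u (t - k)) (derive1 phi) =
  - (L2dot (u s) (derive1 phi) - L2dot (u (s - k)) (derive1 phi)
    - L2dot (u t) (derive1 phi) + L2dot (u (t - k)) (derive1 phi)) by ring.
rewrite E normrN {E}.
have E r : 8 * C / (s - k) `^ (2 - a) * (k * (r - s)) * L2norm phi =
  4 * C * L2norm phi / (s - k) `^ (2 - a) * (2 * (k * (r - s))) by ring.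
rewrite E; move: st; rewrite le_eqVlt => /predU1P[<-|st].
  rewrite subrr !mulr0 (_ : _ + _ = 0) ?normr0//; ring.
move: tT; rewrite le_eqVlt => /predU1P[tT|tT]; last first.
  by apply: (weak_dx_increment2 a01 C0 cu dtu dtut Hx2 Hb2 tphi) => //; exact: ltW.
have cp := continuous_L2_dot cu (test_L2 (test_derive1 tphi)).
set p := fun r => L2dot (u r) (derive1 phi) in cp.
rewrite -/(p s) -/(p (s - k)) -/(p t) -/(p (t - k)) tT.
(* The case t = T is the left limit of the bounds for t < T; the point T - k is interior, where [p]
   is continuous. *)
have cpT := ((continuous_within_itvP _ T0).1 cp).
have [cin _ pT] := cpT.
have cTk : {for T - k, continuous p}.
  by apply: cin; rewrite in_itv/=; apply/andP; split; clear -sk st tT k0; lra.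
have pTk : p (x - k) @[x --> T^'-] --> p (T - k).
  apply: (@cvg_comp _ _ _ (fun x => x - k) p _ (nbhs (T - k))) => //.
  apply: cvg_at_left_filter.
  by apply: cvgB; [exact: cvg_id|exact: cvg_cst].
have lhs : `|p s - p (s - k) - p x + p (x - k)| @[x --> T^'-] -->
    `|p s - p (s - k) - p T + p (T - k)|.
  apply: cvg_norm; apply: cvgD => //; apply: cvgB => //; exact: cvg_cst.
have rhs : 4 * C * L2norm phi / (s - k) `^ (2 - a) * (2 * (k * (x - s))) @[x --> T^'-] -->
    4 * C * L2norm phi / (s - k) `^ (2 - a) * (2 * (k * (T - s))).
  apply: cvg_at_left_filter.
  apply: cvgM; first exact: cvg_cst.
  apply: cvgM; first exact: cvg_cst.
  apply: cvgM; first exact: cvg_cst.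
  by apply: cvgB; [exact: cvg_id|exact: cvg_cst].
apply: (ler_cvg_to lhs rhs); near=> x.
apply: (weak_dx_increment2 a01 C0 cu dtu dtut Hx2 Hb2 tphi) => //.
  by near: x; apply: nbhs_left_ge; rewrite -tT.
Unshelve. all: by end_near. Qed.

End SpaceDerivativeRegularity.

(** * Integrals with endpoint singularities *)

Section ImproperFTC.
Context {R : realType}.
Local Notation mu := (@lebesgue_measure R).
Implicit Types (f G : R -> R) (c d x y : R).

Lemma continuous_itvoo_measurable f c d : {in `]c, d[, continuous f} ->
  measurable_fun `]c, d[%classic f.
Proof.
move=> cf; apply: subspace_continuous_measurable_fun; first exact: measurable_itv.
apply/continuous_in_subspaceT => x /set_mem /= xi; exact: cf.
Qed.

(** Monotone convergence along the compact intervals [c + e n, d - e n]; the kernels integrated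
    below may blow up at an endpoint. *)
Lemma ge0_improper_FTC f G c d : c < d ->
  (forall x, c < x < d -> 0 <= f x) ->
  {in `]c, d[, continuous f} -> {within `[c, d], continuous G} ->
  (forall x, c < x < d -> is_derive x 1 G (f x)) ->
  mu.-integrable `]c, d[ (EFin \o f) /\
  (\int[mu]_(x in `]c, d[) (f x)%:E = (G d - G c)%:E)%E.
Proof.
move=> cd f0 cf cG dG.
have mf := continuous_itvoo_measurable cf.
have [cin Gc Gd] := (continuous_within_itvP _ cd).1 cG.
(* The denominator n + 3 keeps e n below half of d - c, so that all these intervals are
   nondegenerate. *)
pose e n : R := (d - c) / n.+3%:R.
have dc0 : 0 < d - c by rewrite subr_gt0.
have e0 n : 0 < e n by rewrite divr_gt0.
have e2 n : e n < (d - c) / 2 by rewrite ltr_pM2l// ltf_pV2 ?posrE// ltr_nat.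
have emono m n : (m <= n)%N -> e n <= e m.
  by move=> mn; rewrite ler_pM2l// lef_pV2 ?posrE// ler_nat !ltnS.
pose F n : set R := `[c + e n, d - e n]%classic.
have Foo n : F n `<=` `]c, d[%classic.
  move=> x; rewrite /F /= !in_itv/= => /andP[h1 h2].
  by have := e0 n; clear -h1 h2 => h; apply/andP; split; lra.
have eb : e n @[n --> \oo] --> 0.
  rewrite -(mulr0 (d - c)); apply: cvgM; first exact: cvg_cst.
  have := @cvg_harmonic R; rewrite -(cvg_shiftn 2) => h.
  by apply: cvg_trans h; apply: near_eq_cvg; apply: nearW => n /=; rewrite addn2.
have FU : \bigcup_n F n = `]c, d[%classic.
  apply/seteqP; split=> [x [n _ /Foo//]|x /=]; rewrite in_itv/= => /andP[cx xd].
  have m0 : 0 < Num.min (x - c) (d - x) by rewrite lt_min !subr_gt0 cx.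
  have /cvgrPdist_lt/(_ _ m0)[N _ /(_ N (leqnn _))] := eb.
  rewrite /= sub0r normrN gtr0_norm// lt_min => /andP[h1 h2].
  by exists N => //; rewrite /F /= in_itv/=; clear -h1 h2; apply/andP; split; lra.
have FI n : (\int[mu]_(x in F n) (f x)%:E = (G (d - e n))%:E - (G (c + e n))%:E)%E.
  have h0 := e0 n; have h1 := e2 n.
  have lt : c + e n < d - e n by clear -h0 h1; lra.
  have sub x : x \in `[c + e n, d - e n] -> x \in `]c, d[.
    by rewrite !in_itv/=; clear -h0 => /andP[u v]; apply/andP; split; lra.
  have sub' x : x \in `[c + e n, d - e n] -> c < x < d by move=> /sub; rewrite in_itv.
  have cFn : {for c + e n, continuous G} /\ {for d - e n, continuous G}.
    split; apply: cin; apply: sub; rewrite in_itv/= lexx ?ltW//.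
  apply: continuous_FTC2 => //.
  - apply/continuous_in_subspaceT => x /set_mem /= xi; apply: cf; exact: sub.
  - split.
    + by move=> x /subset_itv_oo_cc /sub' /dG [].
    + by apply: cvg_at_right_filter; exact: cFn.1.
    + by apply: cvg_at_left_filter; exact: cFn.2.
  - by move=> x /subset_itv_oo_cc /sub' /dG [_ <-]; rewrite derive1E.
have fF0 n x : F n x -> (0 <= (EFin \o f) x)%E.
  by move=> /Foo /=; rewrite in_itv/= => xi; rewrite lee_fin f0.
have ndF : nondecreasing_seq F.
  move=> m n mn; apply/subsetPset => x; rewrite /F /= !in_itv/=.
  have := emono _ _ mn; clear => h /andP[u v]; apply/andP; split; lra.
have mF n : measurable (F n) by exact: measurable_itv.
have mfF n : measurable_fun (F n) (EFin \o f).
  by apply/measurable_EFinP; apply: measurable_funS mf => //; exact: Foo.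
have := @ge0_nondecreasing_set_cvg_integral _ (measurableTypeR R) R F (EFin \o f) mu ndF mF mfF fF0.
rewrite FU.
have lim2 : (\int[mu]_(x in F n) (EFin \o f) x)%E @[n --> \oo] --> (G d - G c)%:E.
  rewrite (_ : (fun n => _) = (fun n => (G (d - e n) - G (c + e n))%:E)); last first.
    by apply/funext => n; rewrite FI EFinB.
  apply: cvg_EFin; first exact: nearW.
  apply: cvgB.
    apply: ((cvg_at_leftP _ _ _).1 Gd); split.
      by move=> n; rewrite ltrBlDr ltrDl.
    by rewrite -[X in _ --> X]subr0; apply: cvgB => //; exact: cvg_cst.
  apply: ((cvg_at_rightP _ _ _).1 Gc); split.
    by move=> n; rewrite ltrDl.
  by rewrite -[X in _ --> X]addr0; apply: cvgD => //; exact: cvg_cst.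
move=> /cvg_unique /(_ lim2) H.
have E : (\int[mu]_(x in `]c, d[) (f x)%:E = (G d - G c)%:E)%E by apply: H.
split => //; apply/integrableP; split; first exact/measurable_EFinP.
rewrite [X in (X < _)%E](_ : _ = (\int[mu]_(x in `]c, d[) (f x)%:E)%E).
  by rewrite E ltry.
apply: eq_integral => x /set_mem /=; rewrite in_itv/= => xi.
by rewrite ger0_norm// f0.
Qed.

End ImproperFTC.

(** * Positivity of the Gamma integral *)

Section Gamma.
Context {R : realType}.
Local Notation mu := (@lebesgue_measure R).
Implicit Types (b c d x y : R).

Lemma powR_continuous_at b x : 0 < x ->
  {for x, continuous (fun y : R => y `^ b)}.
Proof.
move=> x0; apply/differentiable_continuous/derivable1_diffP/derivable_powR.
by rewrite in_itv/= x0.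
Qed.

Lemma powR_continuous_within b c d : 0 < b -> 0 <= c ->
  {within `[c, d], continuous (fun x : R => x `^ b)}.
Proof.
move=> b0 c0; apply/subspace_continuousP => x /=; rewrite in_itv/= => /andP[cx xd].
have [x0|x0] := ltP 0 x.
  by apply: cvg_within_filter; exact: powR_continuous_at.
have -> : x = 0 by apply/le_anti; rewrite x0 (le_trans c0).
apply/cvgrPdist_le => e e0; rewrite /from_subspace /= powR0 ?gt_eqF//.
have := powR_cvg0 b0; move=> /cvgrPdist_le /(_ e e0).
rewrite near_withinE /at_right => H.
move: H; rewrite near_withinE; apply: filterS => y H; rewrite /= in_itv/= => /andP[cy _].
have := le_trans c0 cy; rewrite le_eqVlt => /predU1P[<-|/H//].
by rewrite powR0 ?gt_eqF// subrr normr0 ltW.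
Qed.

(** Since [Gamma] is the [fine] of an integral, an infinite value would be read as 0: finiteness has
    to be proved along with positivity. The majorant is x^(b - 1) on (0, 1) plus the exponential
    density, the minorant the constant exp(-2) / 2 on [1, 2]. *)
Lemma Gamma_gt0 b : 0 < b < 1 -> 0 < Gamma b.
Proof.
move=> /andP[b0 b1].
pose f x : R := x `^ (b - 1) * expR (- x).
have f0 x : 0 <= f x by rewrite mulr_ge0 ?powR_ge0 ?expR_ge0.
have cf : {in `]0, +oo[, continuous f}.
  move=> x; rewrite in_itv/= andbT => x0; apply: cvgM.
    exact: powR_continuous_at.
  apply: (@continuous_comp _ _ _ (fun x : R => - x) expR).
    exact: opp_continuous.
  exact: continuous_expR.
have mf : measurable_fun (`]0, +oo[%classic : set R) f.
  apply: subspace_continuous_measurable_fun; first exact: measurable_itv.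
  by apply/continuous_in_subspaceT => x /set_mem /= xi; exact: cf.
have ip1 : mu.-integrable `]0, 1[ (EFin \o (fun x => x `^ (b - 1))).
  apply: (@ge0_improper_FTC R _ (fun x => b^-1 * x `^ b) 0 1 _ _ _ _ _).1 => //.
  - by move=> x _; exact: powR_ge0.
  - move=> x; rewrite in_itv/= => /andP[x0 _].
    exact: powR_continuous_at.
  - move=> x; apply: cvgM; first exact: cvg_cst.
    exact: powR_continuous_within.
  - move=> x /andP[x0 _].
    have := is_deriveZ b^-1 (is_derive1_powR b x0).
    by rewrite /GRing.scale /= mulrA mulVf ?gt_eqF// mul1r.
have I : mu.-integrable `]0, +oo[ (EFin \o f).
  have h := @integrable_exponential_pdf R 1 ltr01.
  move: ip1; rewrite integrable_mkcond// restrict_EFin => ip1.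
  have H := integrable_addr measurableT ip1 h.
  have {}H : mu.-integrable `]0, +oo[ (EFin \o (fun x : R =>
      ((fun x : R => x `^ (b - 1)) \_ `]0, 1[) x + exponential_pdf 1 x)).
    by apply: integrableS H.
  apply: le_integrable H => //; first exact/measurable_EFinP.
  move=> x /=; rewrite in_itv/= andbT => x0; rewrite lee_fin.
  have p0 := exponential_pdf_ge0 (@ler01 R) x.
  have q0 : 0 <= ((fun x : R => x `^ (b - 1)) \_ `]0, 1[) x.
    by rewrite patchE; case: ifP => // _; exact: powR_ge0.
  rewrite !ger0_norm ?addr_ge0//.
  have [x1|x1] := ltP x 1.
    apply: (@le_trans _ _ (x `^ (b - 1))).
      by rewrite ler_piMr ?powR_ge0// -[leRHS]expR0 ler_expR oppr_le0 ltW.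
    by rewrite patchE mem_set ?lerDl//= in_itv/= x0.
  apply: (@le_trans _ _ (exponential_pdf 1 x)); last by rewrite lerDr.
  have -> : exponential_pdf 1 x = expR (- x).
    by rewrite exponential_pdfE ?(ltW x0)//= mul1r mulN1r.
  rewrite /f; apply: ler_piMl; first exact: expR_ge0.
  have := ler_powR x1; move=> /(_ (b - 1) 0); rewrite powRr0; apply.
  by rewrite subr_le0 ltW.
rewrite /Gamma -/f fine_gt0//; apply/andP; split; last first.
  have /integrableP[_] := I; apply: le_lt_trans.
  apply: le_trans (lee_abs _) (le_abse_integral _ _ _) => //.
  exact/measurable_EFinP.
apply: (@lt_le_trans _ _ (\int[mu]_(x in `[1%R, 2%R]) (2^-1 * expR (- 2))%:E)%E).
  rewrite integral_cst//= lebesgue_measure_itv/= lte_fin ltr1n -EFinB -EFinM lte_fin.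
  by rewrite !mulr_gt0 ?expR_gt0//; lra.
have sub : (`[1, 2]%classic : set R) `<=` `]0, +oo[%classic.
  by move=> x /=; rewrite !in_itv/= andbT => /andP[x1 _]; exact: lt_le_trans x1.
have fE0 x : (0 <= (f x)%:E)%E by rewrite lee_fin.
apply: (@le_trans _ _ (\int[mu]_(x in `[1%R, 2%R]) (f x)%:E)%E); last first.
  by apply: ge0_subset_integral => //; exact/measurable_EFinP.
apply: ge0_le_integral => //.
- by apply/measurable_EFinP; exact: measurable_funS mf.
- move=> x /=; rewrite in_itv/= => /andP[x1 x2]; rewrite lee_fin.
  have x0 : 0 < x by exact: lt_le_trans x1.
  apply: ler_pM; rewrite ?expR_ge0//.
    apply: (@le_trans _ _ (x `^ (- 1))).
      by rewrite powR_inv1 ?(ltW x0)// lef_pV2 ?posrE.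
    by apply: ler_powR => //; rewrite lerBrDr addNr ltW.
  by rewrite ler_expR lerN2.
Qed.

End Gamma.

(** * The Erdelyi-Kober kernel and its primitive *)

Section ErdelyiKoberKernel.
Context {R : realType}.
Local Notation mu := (@lebesgue_measure R).
Implicit Types (f g h phi : R -> R) (a b c d x y s t L T : R).

Lemma continuous_within_comp (A B : set R) f g :
  {within A, continuous f} -> {within B, continuous g} ->
  (forall x, A x -> B (f x)) -> {within A, continuous (g \o f)}.
Proof.
move=> /subspace_continuousP cf /subspace_continuousP cg AB.
apply/subspace_continuousP => x Ax P /= Pg.
have H1 : nbhs (f x) (fun y => B y -> P (g y)) := cg (f x) (AB _ Ax) P Pg.
have H2 : nbhs x (fun y => A y -> B (f y) -> P (g (f y))) := cf x Ax _ H1.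
suff : nbhs x (fun y => A y -> P (g (f y))) by [].
by apply: filterS H2 => y H Ay; apply: H => //; exact: AB.
Qed.

Lemma powR_le1 a x : 0 <= a -> 0 <= x -> x <= 1 -> x `^ a <= 1.
Proof.
move=> a0 x0 x1; have : x `^ a <= 1 `^ a by rewrite ge0_ler_powR ?nnegrE.
by rewrite powR1.
Qed.

Lemma powR_lt1 a x : 0 < a -> 0 <= x -> x < 1 -> x `^ a < 1.
Proof.
move=> a0 x0 x1; have : x `^ a < 1 `^ a by rewrite gt0_ltr_powR ?nnegrE.
by rewrite powR1.
Qed.

(** With a = alpha / beta and b = beta, - 1 / alpha times this is a primitive of [EK_kernel]; hence
    the coefficients [EK_coef] are proportional to the exact integrals of the kernel over the
    cells. *)
Definition EK_primitive a b y : R := (1 - y `^ a) `^ b.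

Lemma EK_primitive_continuous a b : 0 < a -> 0 < b ->
  {within `[0, 1], continuous (EK_primitive a b)}.
Proof.
move=> a0 b0; have c1 : {within `[0, 1], continuous (fun y : R => 1 - y `^ a)}.
  by move=> x; apply: cvgB; [exact: cvg_cst|exact: powR_continuous_within].
apply: (continuous_within_comp c1 (powR_continuous_within (d := 1) b0 (lexx 0))).
move=> x /=; rewrite !in_itv/= => /andP[x0 x1]; rewrite subr_ge0 gerBl powR_ge0 andbT.
by rewrite powR_le1// ltW.
Qed.

Lemma EK_primitive0 a b : 0 < a -> EK_primitive a b 0 = 1.
Proof. by move=> a0; rewrite /EK_primitive powR0 ?gt_eqF// subr0 powR1. Qed.

Lemma EK_primitive1 a b : 0 < b -> EK_primitive a b 1 = 0.
Proof. by move=> b0; rewrite /EK_primitive powR1 subrr powR0// gt_eqF. Qed.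

Lemma EK_primitive_anti a b x y : 0 < a -> 0 < b -> 0 <= x -> x <= y -> y <= 1 ->
  EK_primitive a b y <= EK_primitive a b x.
Proof.
move=> a0 b0 x0 xy y1; have y0 := le_trans x0 xy.
have ya : y `^ a <= 1 by rewrite powR_le1// ltW.
have xya : x `^ a <= y `^ a by rewrite ge0_ler_powR ?nnegrE// ltW.
by rewrite ge0_ler_powR ?nnegrE ?subr_ge0 ?(le_trans xya) ?(ltW b0)// lerD2l lerN2.
Qed.

Section Kernel.
Variables (alpha beta : R).
Hypotheses (alpha0 : 0 < alpha) (beta01 : 0 < beta < 1).
Let beta0 : 0 < beta. Proof. by case/andP: beta01. Qed.
Let a := alpha / beta.
Let a0 : 0 < a. Proof. by rewrite divr_gt0. Qed.
Local Notation K := (EK_kernel alpha beta).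
Local Notation G := (EK_primitive a beta).

Lemma EK_kernel_ge0 y : 0 <= K y.
Proof. by rewrite mulr_ge0 ?powR_ge0. Qed.

Lemma EK_kernel_integral c d : 0 <= c -> c < d -> d <= 1 ->
  mu.-integrable `[c, d] (EFin \o K) /\
  \int[mu]_(y in `[c, d]) K y = (G c - G d) / alpha.
Proof.
move=> c0 cd d1.
have Kin x : c < x < d -> 0 < x /\ 0 < 1 - x `^ a.
  move=> /andP[cx xd]; have x0 := le_lt_trans c0 cx; split => //.
  by rewrite subr_gt0 powR_lt1// ?(ltW x0)// (lt_le_trans xd).
have d1a x : c < x < d -> is_derive x 1 (fun y => 1 - y `^ a) (- (a * x `^ (a - 1))).
  move=> /Kin[x0 _].
  have := is_deriveB (is_derive_cst (1 : R) x 1) (is_derive1_powR a x0).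
  by rewrite sub0r.
have cK : {in `]c, d[, continuous K}.
  move=> x; rewrite in_itv => xi; have [x0 x1] := Kin x xi.
  apply: cvgM; first exact: powR_continuous_at.
  apply: (@continuous_comp _ _ _ (fun y => 1 - y `^ a) (fun z => z `^ (beta - 1))).
    by apply/differentiable_continuous/derivable1_diffP; case: (d1a x xi).
  exact: powR_continuous_at.
have [ii iE] : mu.-integrable `]c, d[ (EFin \o K) /\
    (\int[mu]_(y in `]c, d[) (K y)%:E = (- alpha^-1 * G d - - alpha^-1 * G c)%:E)%E.
  apply: (@ge0_improper_FTC _ _ (fun y => - alpha^-1 * G y)) => //.
  - by move=> x _; exact: EK_kernel_ge0.
  - have sub : (`[c, d]%classic : set R) `<=` `[0, 1]%classic.
      by move=> x /=; rewrite !in_itv/= => /andP[u v]; rewrite (le_trans c0 u) (le_trans v d1).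
    have := continuous_subspaceW sub (EK_primitive_continuous a0 beta0).
    by move=> cG x; apply: cvgM; [exact: cvg_cst|exact: cG].
  - move=> x xi; have [x0 x1] := Kin x xi.
    have H := @is_derive1_comp R (fun z => z `^ beta) (fun y => 1 - y `^ a) x _ _
      (is_derive1_powR beta x1) (d1a x xi).
    have := is_deriveZ (- alpha^-1) H.
    rewrite /GRing.scale /=.
    have -> : - alpha^-1 * (beta * (1 - x `^ a) `^ (beta - 1) * - (a * x `^ (a - 1))) = K x.
      rewrite /EK_kernel -/a /a; field; rewrite !gt_eqF//.
    exact.
have mK : measurable_fun (`]c, d[%classic : set R) K by exact: continuous_itvoo_measurable.
have mEK : measurable_fun (`]c, d[%classic : set R) (EFin \o K) by exact/measurable_EFinP.
split.
  apply/integrableP; split.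
    by apply/measurable_EFinP; exact: (@measurable_fun_itv_cc R c d false true K).
  move/integrableP: ii => [_]; rewrite -(@integral_itv_bndoo _ c d _ true false)//.
  exact: measurableT_comp.
have E : (\int[mu]_(y in `[c, d]) (K y)%:E = (- alpha^-1 * G d - - alpha^-1 * G c)%:E)%E.
  by rewrite -iE; exact: (@integral_itv_bndoo R c d (EFin \o K) true false mEK).
rewrite /Rintegral E /=; move: (G c) (G d) => x y.
by rewrite -mulrBr mulNr mulrC -mulNr opprB.
Qed.

End Kernel.

End ErdelyiKoberKernel.

(** * Quadrature of the Erdelyi-Kober integral of a Hoelder function *)

Section ErdelyiKoberQuadrature.
Context {R : realType}.
Local Notation mu := (@lebesgue_measure R).
Implicit Types (phi : R -> R) (c d x y s t L B T : R).

Lemma integrable_mull (D : set (measurableTypeR R)) (f : R -> R) c :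
  measurable D -> mu.-integrable D (EFin \o f) ->
  mu.-integrable D (EFin \o (fun x => c * f x)).
Proof. by move=> mD fi; apply: eq_integrable (integrableZl mD c fi). Qed.

Lemma integrable_mulr (D : set (measurableTypeR R)) (f : R -> R) c :
  measurable D -> mu.-integrable D (EFin \o f) ->
  mu.-integrable D (EFin \o (fun x => f x * c)).
Proof. by move=> mD fi; apply: eq_integrable (integrableZr mD c fi). Qed.

Lemma hoelder_continuous_within alpha phi L T : 0 < alpha -> 0 <= L ->
  (forall s t, 0 <= s -> s <= t -> t <= T ->
    `|phi t - phi s| <= L * (t `^ alpha - s `^ alpha)) ->
  {within `[0, T], continuous phi}.
Proof.
move=> a0 L0 H; apply/subspace_continuousP => x /=; rewrite in_itv/= => /andP[x0 xT].
apply/cvgrPdist_le => e e0.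
have L1 : 0 < L + 1 by rewrite ltr_wpDl.
have /subspace_continuousP/(_ x) := @powR_continuous_within R alpha 0 T a0 (lexx _).
rewrite /= in_itv/= x0 xT => /(_ isT)/cvgrPdist_le/(_ (e / (L + 1))).
rewrite divr_gt0// => /(_ isT); rewrite !near_withinE; apply: filterS => y H1 yi.
have {H1} := H1 yi; move: yi; rewrite /= in_itv/= => /andP[y0 yT].
rewrite ler_pdivlMr// => H1.
have H2 : `|phi x - phi y| <= L * `|x `^ alpha - y `^ alpha|.
  have [xy|/ltW yx] := leP x y.
    rewrite distrC; apply: le_trans (H _ _ x0 xy yT) _.
    by rewrite distrC ler_wpM2l// ler_norm.
  apply: le_trans (H _ _ y0 yx xT) _.
  by rewrite ler_wpM2l// ler_norm.
apply: le_trans H2 _; apply: le_trans H1.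
by rewrite mulrC ler_wpM2l// lerDl.
Qed.

Section Quadrature.
Variables (alpha beta : R).
Hypotheses (alpha01 : 0 < alpha < 1) (beta01 : 0 < beta < 1).
Let alpha0 : 0 < alpha. Proof. by case/andP: alpha01. Qed.
Let beta0 : 0 < beta. Proof. by case/andP: beta01. Qed.
Let a := alpha / beta.
Let a0 : 0 < a. Proof. by rewrite divr_gt0. Qed.
Local Notation K := (EK_kernel alpha beta).
Local Notation G := (EK_primitive a beta).
Variables (phi : R -> R) (L T : R).
Hypothesis L0 : 0 <= L.
Hypothesis Hphi : forall s t, 0 <= s -> s <= t -> t <= T ->
    `|phi t - phi s| <= L * (t `^ alpha - s `^ alpha).

Lemma EK_kernel_integral1 :
  mu.-integrable `[0, 1] (EFin \o K) /\ \int[mu]_(y in `[0, 1]) K y = alpha^-1.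
Proof.
have [] := EK_kernel_integral alpha0 beta01 (lexx 0) ltr01 (lexx 1).
by rewrite EK_primitive0// EK_primitive1// subr0 mul1r.
Qed.

Lemma EK_integrand_integrable t : 0 <= t -> t <= T ->
  mu.-integrable `[0, 1] (EFin \o (fun y => K y * phi (y * t))).
Proof.
move=> t0 tT; have T0 := le_trans t0 tT; have [iK _] := EK_kernel_integral1.
have cphi := hoelder_continuous_within alpha0 L0 Hphi.
have cs : {within `[0, 1], continuous (fun y : R => y * t)}.
  by apply: continuous_subspaceT => x; apply: cvgM; [exact: cvg_id|exact: cvg_cst].
have c1 : {within `[0, 1], continuous (fun y => phi (y * t))}.
  apply: (continuous_within_comp cs cphi) => y /=; rewrite !in_itv/= => /andP[y0 y1].
  by rewrite mulr_ge0//= (le_trans _ tT)// ler_piMl.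
have mphi : measurable_fun (`[0, 1]%classic : set R) (fun y => phi (y * t)).
  apply: subspace_continuous_measurable_fun => //; exact: measurable_itv.
pose M := `|phi 0| + L * T `^ alpha.
have HM y : 0 <= y -> y <= 1 -> `|phi (y * t)| <= M.
  move=> y0 y1; have yt0 : 0 <= y * t by rewrite mulr_ge0.
  have yt : y * t <= T by rewrite (le_trans _ tT)// ler_piMl.
  have := Hphi (lexx 0) yt0 yt; rewrite powR0 ?gt_eqF// subr0 => H.
  have -> : phi (y * t) = phi 0 + (phi (y * t) - phi 0) by ring.
  apply: le_trans (ler_normD _ _) _; rewrite lerD2l (le_trans H)// ler_wpM2l//.
  by rewrite ge0_ler_powR ?nnegrE// ltW.
have H : mu.-integrable `[0, 1] (EFin \o (fun y => M * K y)).
  exact: integrable_mull.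
apply: le_integrable H => //.
  apply/measurable_EFinP/measurable_funM => //.
  by move/integrableP: iK => [/measurable_EFinP].
move=> y /=; rewrite in_itv/= => /andP[y0 y1]; rewrite lee_fin !normrM.
rewrite [leRHS]mulrC; apply: ler_wpM2l => //.
by apply: le_trans (HM y y0 y1) (ler_norm _).
Qed.

Lemma EK_integral_increment s t : 0 <= s -> s <= t -> t <= T ->
  `|\int[mu]_(y in `[0, 1]) (K y * phi (y * t)) -
    \int[mu]_(y in `[0, 1]) (K y * phi (y * s))| <=
  L * (t `^ alpha - s `^ alpha) / alpha.
Proof.
move=> s0 st tT; have sT := le_trans st tT; have t0 := le_trans s0 st.
have it := EK_integrand_integrable t0 tT; have is_ := EK_integrand_integrable s0 sT.
have [iK IK] := EK_kernel_integral1.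
rewrite -RintegralB//; have iB := integrable_subr (measurable_itv _) it is_.
apply: le_trans (le_normr_Rintegral _ iB) _ => //.
have D0 : 0 <= t `^ alpha - s `^ alpha.
  by rewrite subr_ge0 ge0_ler_powR ?nnegrE// ltW.
rewrite -IK -RintegralZl//; apply: le_Rintegral => //.
- by move/integrable_abse : iB; exact.
- exact: integrable_mull.
move=> y /=; rewrite in_itv/= => /andP[y0 y1].
rewrite -mulrBr normrM ger0_norm ?EK_kernel_ge0// mulrC.
apply: ler_wpM2r; first exact: EK_kernel_ge0.
have ys : y * s <= y * t by rewrite ler_wpM2l.
have yt : y * t <= T by rewrite (le_trans _ tT)// ler_piMl.
apply: le_trans (Hphi (mulr_ge0 y0 s0) ys yt) _; rewrite ler_wpM2l//.
by rewrite !powRM// -mulrBr ler_piMl// powR_le1// ltW.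
Qed.

(** Right-endpoint rule with exact kernel weights: on a cell [c, d] the data move by at most L
    t^alpha (d^alpha - c^alpha), and d^alpha - c^alpha <= M^(- alpha) by subadditivity. This crude
    rate only serves to let the number of subcells tend to infinity. *)
Lemma EK_quadrature t M : 0 <= t -> t <= T -> (0 < M)%N ->
  `|\int[mu]_(y in `[0, 1]) (K y * phi (y * t)) -
    \sum_(j < M) ((G (j%:R / M%:R) - G (j.+1%:R / M%:R)) / alpha *
       phi (j.+1%:R / M%:R * t))| <=
  L * t `^ alpha / M%:R `^ alpha / alpha.
Proof.
move=> t0 tT M0; have it := EK_integrand_integrable t0 tT.
have [iK IK] := EK_kernel_integral1.
have MR : 0 < M%:R :> R by rewrite ltr0n.
have /andP[_ alpha1] := alpha01.
have jM (j : nat) : (j <= M)%N -> 0 <= (j%:R / M%:R : R) <= 1.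
  by move=> jM; rewrite divr_ge0//= ler_pdivrMr// mul1r ler_nat.
have split_int (h : R -> R) c d : 0 <= c -> c <= d -> d <= 1 ->
    mu.-integrable `[0, 1] (EFin \o h) ->
    \int[mu]_(y in `[0, d]) h y = \int[mu]_(y in `[0, c]) h y + \int[mu]_(y in `[c, d]) h y.
  move=> c0 cd d1 ih.
  have ihd : mu.-integrable `[0, d] (EFin \o h).
    by apply: integrableS ih => //; apply: subset_itvl; rewrite bnd_simp.
  have ihcd : mu.-integrable `]c, d] (EFin \o h).
    apply: integrableS ihd => // x /=; rewrite !in_itv/= => /andP[cx ->].
    by rewrite (le_trans c0 (ltW cx)).
  apply/eqP; rewrite addrC -subr_eq; apply/eqP.
  have := @Rintegral_itvB R h (BLeft 0) (BRight d) c ihd.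
  rewrite !bnd_simp => ->//.
  exact: Rintegral_itv_obnd_cbnd.
have M1 : M%:R / M%:R = 1 :> R by rewrite divff// gt_eqF.
(* The error over the first m cells is compared with the kernel mass of those cells; the total mass
   is 1 / alpha. *)
suff H m : (m <= M)%N ->
    `|\int[mu]_(y in `[0, m%:R / M%:R]) (K y * phi (y * t)) -
     \sum_(j < m) ((G (j%:R / M%:R) - G (j.+1%:R / M%:R)) / alpha *
       phi (j.+1%:R / M%:R * t))| <=
    L * t `^ alpha / M%:R `^ alpha * \int[mu]_(y in `[0, m%:R / M%:R]) K y.
  by have := H M (leqnn M); rewrite M1 IK.
elim: m => [_|m IH mM].
  by rewrite big_ord0 subr0 !mul0r set_itv1 !Rintegral_set1 mulr0 normr0.
have mM' := ltnW mM.
have /andP[c0 c1] := jM m mM'; have /andP[d0 d1] := jM m.+1 mM.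
set c := m%:R / M%:R in c0 c1 *; set d := m.+1%:R / M%:R in d0 d1 *.
have cd : c < d by rewrite ltr_pM2r ?invr_gt0// ltr_nat.
rewrite big_ord_recr /= -/c -/d (split_int _ _ _ c0 (ltW cd) d1 it).
rewrite (split_int _ _ _ c0 (ltW cd) d1 iK).
rewrite opprD addrACA; apply: le_trans (ler_normD _ _) _.
rewrite mulrDr lerD//; first exact: IH.
have [iKc IKc] := EK_kernel_integral alpha0 beta01 c0 cd d1.
rewrite -/a in IKc; rewrite -IKc -RintegralZr//.
have sub : (`[c, d]%classic : set R) `<=` `[0, 1]%classic.
  by move=> x /=; rewrite !in_itv/= => /andP[u v]; rewrite (le_trans c0 u) (le_trans v d1).
have itc : mu.-integrable `[c, d] (EFin \o (fun y => K y * phi (y * t))).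
  by apply: integrableS it.
have iKd : mu.-integrable `[c, d] (EFin \o (fun y => K y * phi (d * t))).
  exact: integrable_mulr.
rewrite -RintegralB//; have iB := integrable_subr (measurable_itv _) itc iKd.
apply: le_trans (le_normr_Rintegral _ iB) _ => //.
rewrite -RintegralZl//; apply: le_Rintegral => //.
- by move/integrable_abse : iB; exact.
- exact: integrable_mull.
move=> y /=; rewrite in_itv/= => /andP[cy yd].
rewrite -mulrBr normrM ger0_norm ?EK_kernel_ge0// mulrC.
apply: ler_wpM2r; first exact: EK_kernel_ge0.
have y0 := le_trans c0 cy.
have yt0 : 0 <= y * t by rewrite mulr_ge0.
have ydt : y * t <= d * t by rewrite ler_wpM2r.
have dt : d * t <= T by rewrite (le_trans _ tT)// ler_piMl.
rewrite distrC; apply: le_trans (Hphi yt0 ydt dt) _; rewrite -mulrA ler_wpM2l//.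
rewrite (powRM _ d0 t0) (powRM _ y0 t0) -mulrBl mulrC ler_wpM2l ?powR_ge0//.
apply: (@le_trans _ _ (d `^ alpha - c `^ alpha)).
  by rewrite lerD2l lerN2 ge0_ler_powR ?nnegrE// ltW.
have MV : M%:R^-1 `^ alpha = (M%:R `^ alpha)^-1 :> R.
  by rewrite -powR_inv1 ?ler0n// -powRrM mulN1r powRN.
rewrite /c /d !powRM ?invr_ge0// -mulrBl MV ler_piMl ?invr_ge0 ?powR_ge0//.
have b01 : 0 <= alpha <= 1 by rewrite !ltW.
have := powR_increment_anti b01 (lexx 0) (ler0n R m) ler01.
by rewrite add0r powR1 powR0 ?gt_eqF// subr0 natr1.
Qed.

End Quadrature.
End ErdelyiKoberQuadrature.

(** * Convexity, and comparison of the quadrature weights *)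

Section PowerConvexity.
Context {R : realType}.
Implicit Types (a b d t x y z h m : R).

Lemma powR_tangent_ge1 a x z : 1 <= a -> 0 <= x -> 0 < z ->
  z `^ a + a * z `^ (a - 1) * (x - z) <= x `^ a.
Proof.
move=> a1 x0 z0; have xz : 0 <= x / z by rewrite divr_ge0// ltW.
have := powR_bernoulli_ge1 xz a1.
rewrite -(ler_pM2l (powR_gt0 a z0)) -powRM ?(ltW z0)// [z * _]mulrC divfK ?gt_eqF//.
apply: le_trans; rewrite le_eqVlt; apply/orP; left; apply/eqP.
rewrite powRB ?(gt_eqF z0) ?implybT// powRr1 ?(ltW z0)//.
by field; rewrite gt_eqF.
Qed.

Lemma powR_convex a t x y : 1 <= a -> 0 <= x -> 0 <= y -> 0 <= t <= 1 ->
  (t * x + (1 - t) * y) `^ a <= t * x `^ a + (1 - t) * y `^ a.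
Proof.
move=> a1 x0 y0 /andP[t0 t1]; have t1' : 0 <= 1 - t by rewrite subr_ge0.
have a0 : 0 < a by exact: lt_le_trans a1.
have z0 : 0 <= t * x + (1 - t) * y by rewrite addr_ge0// mulr_ge0.
move: z0; rewrite le_eqVlt => /predU1P[<-|z0].
  by rewrite powR0 ?gt_eqF// addr_ge0// mulr_ge0// powR_ge0.
set z := t * x + (1 - t) * y in z0 *.
have h1 := ler_wpM2l t0 (powR_tangent_ge1 a1 x0 z0).
have h2 := ler_wpM2l t1' (powR_tangent_ge1 a1 y0 z0).
apply: le_trans (lerD h1 h2); rewrite le_eqVlt; apply/orP; left; apply/eqP.
by rewrite /z; ring.
Qed.

Lemma powR_increment_mono a x y d : 1 <= a -> 0 <= y -> y <= x -> 0 <= d ->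
  (y + d) `^ a - y `^ a <= (x + d) `^ a - x `^ a.
Proof.
move=> a1 y0 yx d0; have [D0|D0] := leP (x + d - y) 0.
  have -> : x = y by apply/le_anti; rewrite yx andbT; clear -D0 d0; lra.
  by [].
pose t := d / (x + d - y).
have t01 : 0 <= t <= 1.
  by rewrite divr_ge0 ?(ltW D0)//= ler_pdivrMr// mul1r; clear -yx; lra.
have xd0 : 0 <= x + d by clear -y0 yx d0; lra.
have h1 := powR_convex a1 y0 xd0 t01.
have h2 := powR_convex a1 xd0 y0 t01.
have e1 : t * y + (1 - t) * (x + d) = x by rewrite /t; field; rewrite gt_eqF.
have e2 : t * (x + d) + (1 - t) * y = y + d by rewrite /t; field; rewrite gt_eqF.
rewrite e1 in h1; rewrite e2 in h2; clear -h1 h2; lra.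
Qed.

Section Weights.
Variables (a b : R).
Hypotheses (a0 : 0 < a) (b01 : 0 < b < 1).
Let b0 : 0 < b. Proof. by case/andP: b01. Qed.
Let b01' : 0 <= b <= 1. Proof. by case/andP: b01 => *; rewrite !ltW. Qed.

(** In grid units, n^(a b) times [EK_primitive] at x / n: the time factor t_n^alpha is absorbed, and
    the weights of consecutive levels can be compared on the same cells. *)
Definition EK_tail n x : R := (n `^ a - x `^ a) `^ b.
Local Notation V := EK_tail.

Let pa x y : 0 <= x -> x <= y -> x `^ a <= y `^ a.
Proof. by move=> x0 xy; rewrite ge0_ler_powR ?nnegrE ?(ltW a0) ?(le_trans x0). Qed.

Lemma EK_tailxx n : V n n = 0.
Proof. by rewrite /V subrr powR0// gt_eqF. Qed.

Lemma EK_tail0 n : 0 <= n -> V n 0 = n `^ (a * b).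
Proof. by move=> n0; rewrite /V powR0 ?gt_eqF// subr0 powRrM. Qed.

Lemma EK_tail_anti n x y : 0 <= x -> x <= y -> y <= n -> V n y <= V n x.
Proof.
move=> x0 xy yn; have y0 := le_trans x0 xy.
by rewrite ge0_ler_powR ?nnegrE ?subr_ge0 ?(ltW b0) ?pa ?(le_trans xy)// lerD2l lerN2 pa.
Qed.

Lemma EK_tail_mono m n x : 0 <= x -> x <= m -> m <= n -> V m x <= V n x.
Proof.
move=> x0 xm mn; have m0 := le_trans x0 xm.
by rewrite ge0_ler_powR ?nnegrE ?subr_ge0 ?(ltW b0) ?pa ?(le_trans xm)// lerD2r pa.
Qed.

(** Both sides are increments of the concave function z^b of the same length y^a - x^a; at the
    larger level the increment starts farther to the right. *)
Lemma EK_weight_anti m n x y : 0 <= x -> x <= y -> y <= m -> m <= n ->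
  V n x - V n y <= V m x - V m y.
Proof.
move=> x0 xy ym mn; have y0 := le_trans x0 xy; have m0 := le_trans y0 ym.
have h1 : 0 <= m `^ a - y `^ a by rewrite subr_ge0 pa.
have h2 : m `^ a - y `^ a <= n `^ a - y `^ a by rewrite lerD2r pa.
have h3 : 0 <= y `^ a - x `^ a by rewrite subr_ge0 pa.
have := powR_increment_anti b01' h1 h2 h3.
by rewrite !addrA !subrK.
Qed.

(** By convexity of z^a the shifted increment starts farther to the right, which only lowers the
    increment of z^b; its length grows by at most the factor ((x + 1) / x)^a, which
    [powR_increment_scale] pulls out. *)
Lemma EK_weight_shift m h x y : 1 <= a -> 0 < h -> h <= x -> x <= y -> y <= m ->
  V (m + 1) (x + 1) - V (m + 1) (y + 1) <=
  ((h + 1) / h) `^ a * (V m x - V m y).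
Proof.
move=> a1 h0 hx xy ym; have x0 := lt_le_trans h0 hx; have y0 := lt_le_trans x0 xy.
have m0 := lt_le_trans y0 ym; set l := _ `^ a.
have Q0 : 0 <= m `^ a - y `^ a by rewrite subr_ge0 pa// ltW.
have QQ : m `^ a - y `^ a <= (m + 1) `^ a - (y + 1) `^ a.
  have := powR_increment_mono a1 (ltW y0) ym ler01; lra.
have D0 : 0 <= (y + 1) `^ a - (x + 1) `^ a.
  by rewrite subr_ge0 pa ?lerD2r// addr_ge0// ltW.
have D0' : 0 <= y `^ a - x `^ a by rewrite subr_ge0 pa// ltW.
have lx : ((x + 1) / x) `^ a <= l.
  apply: pa; first by rewrite divr_ge0 ?addr_ge0 ?(ltW x0).
  rewrite ler_pdivrMr// mulrAC ler_pdivlMr//; lra.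
have l1 : 1 <= l.
  have := @pa 1 ((h + 1) / h) ler01; rewrite powR1; apply.
  by rewrite ler_pdivlMr// mul1r lerDl.
have DD : (y + 1) `^ a - (x + 1) `^ a <= l * (y `^ a - x `^ a).
  apply: le_trans (ler_wpM2r D0' lx); rewrite mulrBr -!powRM ?(ltW x0) ?(ltW y0) ?divr_ge0 ?addr_ge0 ?(ltW x0)//.
  rewrite [(x + 1) / x * x]divfK ?gt_eqF// lerD2r pa ?addr_ge0 ?(ltW y0)//.
  rewrite mulrAC ler_pdivlMr//; lra.
have h1 := powR_increment_anti b01' Q0 QQ D0.
have h2 : (m `^ a - y `^ a + ((y + 1) `^ a - (x + 1) `^ a)) `^ b <=
    (m `^ a - y `^ a + l * (y `^ a - x `^ a)) `^ b.
  apply: ge0_ler_powR; rewrite ?nnegrE ?(ltW b0) ?lerD2l//.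
    by apply: addr_ge0.
  by apply: addr_ge0; rewrite // mulr_ge0// (le_trans ler01).
have h3 := powR_increment_scale b01' Q0 D0' l1.
have e1 : (m + 1) `^ a - (y + 1) `^ a + ((y + 1) `^ a - (x + 1) `^ a) =
  (m + 1) `^ a - (x + 1) `^ a by rewrite addrA subrK.
have e2 : m `^ a - y `^ a + (y `^ a - x `^ a) = m `^ a - x `^ a by rewrite addrA subrK.
rewrite e1 in h1; rewrite e2 in h3.
by rewrite /V; apply: le_trans h1 _; apply: le_trans h3; rewrite lerD2r.
Qed.

End Weights.
End PowerConvexity.

(** * Truncation error of the quadrature on the unit grid *)

Section Truncation.
Context {R : realType}.
Implicit Types (x y z c r e : R) (n m i j h : nat).

Lemma powR_neg_anti r x y : r <= 0 -> 0 < x -> x <= y -> y `^ r <= x `^ r.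
Proof.
move=> r0 x0 xy; have y0 := lt_le_trans x0 xy.
rewrite -[r]opprK !(powRN _ (- r)) lef_pV2 ?posrE ?powR_gt0//.
by rewrite ge0_ler_powR ?nnegrE ?oppr_ge0 ?(ltW x0) ?(ltW y0).
Qed.

Lemma weighted_sum_bound (I : finType) (w v : I -> R) c :
  (forall k, `|v k| <= c) -> `|\sum_k w k * v k| <= c * \sum_k `|w k|.
Proof.
move=> H; apply: le_trans (ler_norm_sum _ _ _) _; rewrite mulr_sumr.
by apply: ler_sum => i _; rewrite normrM mulrC ler_wpM2r.
Qed.

Lemma weighted_sum_diff_bound (I : finType) (w1 w2 v : I -> R) s1 s2 c :
  (forall k, `|v k| <= c) -> (forall k, w2 k <= w1 k) ->
  \sum_k w1 k = s1 -> \sum_k w2 k = s2 ->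
  `|\sum_k w2 k * v k - \sum_k w1 k * v k| <= c * (s1 - s2).
Proof.
move=> H ww <- <-; have := weighted_sum_bound (fun k => w2 k - w1 k) H.
under eq_bigr do rewrite mulrBl; rewrite sumrB.
by under [X in _ * X]eq_bigr do rewrite ler0_norm ?subr_le0// opprB; rewrite sumrB.
Qed.

Let arith_concave x y z : z <= 1 -> x <= y -> x - 0 - (y - z) + (z - 0) <= 2.
Proof. by move=> *; lra. Qed.

Let arith_norm x y r : 0 <= x -> 1 <= r -> y <= r * x ->
  `|y - x| <= (2 * (r - 1) + 1) * x - y.
Proof.
move=> x0 r1 yx; have rx : 0 <= (r - 1) * x by rewrite mulr_ge0// subr_ge0.
by have [yx0|yx0] := leP 0 (y - x); [rewrite ger0_norm//|rewrite ltr0_norm//]; lra.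
Qed.

(** Termwise, |w2 - w1| <= (2 r - 1) w1 - w2 whenever w2 <= r w1. This majorant is linear in the
    weights, so its sum involves only total masses, and these telescope over the cells. *)
Lemma weighted_sum_shift_bound (I : finType) (w1 w2 v1 v2 : I -> R) s1 s2 c e r :
  0 <= e -> 1 <= r ->
  (forall k, `|v2 k - v1 k| <= c) -> (forall k, `|v1 k| <= e) ->
  (forall k, 0 <= w1 k) -> (forall k, 0 <= w2 k) -> (forall k, w2 k <= r * w1 k) ->
  \sum_k w1 k = s1 -> \sum_k w2 k = s2 ->
  `|\sum_k w2 k * v2 k - \sum_k w1 k * v1 k| <=
    c * s2 + e * ((2 * (r - 1) + 1) * s1 - s2).
Proof.
move=> e0 r1 vv v1e w10 w20 ww <- <-; rewrite -sumrB.
have -> : \sum_k (w2 k * v2 k - w1 k * v1 k) =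
    \sum_k w2 k * (v2 k - v1 k) + \sum_k (w2 k - w1 k) * v1 k.
  by rewrite -big_split/=; apply: eq_bigr => k _; ring.
apply: le_trans (ler_normD _ _) _; apply: lerD.
  have := weighted_sum_bound w2 vv.
  by under [X in _ * X]eq_bigr do rewrite ger0_norm ?w20//.
apply: le_trans (weighted_sum_bound _ v1e) _; rewrite ler_wpM2l// mulr_sumr -sumrB.
by apply: ler_sum => k _; exact: arith_norm.
Qed.

Let arith_mono x y z t : z - x <= t - y -> y - x <= t - z.
Proof. by move=> *; lra. Qed.

Let arith_convex x y z r c e : 0 <= c -> 0 <= e -> 1 <= r ->
  x <= z -> y <= z -> x <= y ->
  c * (- 0) + e * (2 * (r - 1) * (- 0) + (0 - 0)) -
    (c * (- y) + e * (2 * (r - 1) * (- x) + (y - x))) <=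
  c * z + e * (2 * (r - 1) * z).
Proof.
move=> c0 e0 r1 xz yz xy.
have h1 : 0 <= c * (z - y) by rewrite mulr_ge0// subr_ge0.
have h2 : 0 <= e * ((r - 1) * (z - x)) by rewrite !mulr_ge0// subr_ge0.
have h3 : 0 <= e * (y - x) by rewrite mulr_ge0// subr_ge0.
by clear -h1 h2 h3; lra.
Qed.

Let arith1 c x z : 0 <= c -> 0 <= x -> 0 <= z -> z <= (16 + 4 * c + 18 * x) * z * 1.
Proof.
move=> c0 x0 z0.
have h1 : 0 <= c * z by rewrite mulr_ge0.
have h2 : 0 <= x * z by rewrite mulr_ge0.
by rewrite mulr1; lra.
Qed.

Let arith2 x y z t : x + z - (y + t) = x - y + (z - t).
Proof. by ring. Qed.

Let arith3 x y z t : z <= x -> z - y - (x - t) <= t - y.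
Proof. by move=> *; lra. Qed.

Let arith4 c x z e L : 0 <= c -> 0 <= x -> 0 <= z -> 0 <= L -> e <= L * (3 * z) ->
  L * (c * z) + 2 * e <= (16 + 4 * c + 18 * x) * L * z.
Proof.
move=> c0 x0 z0 l0 ez.
have h1 : 0 <= L * (c * z) by rewrite !mulr_ge0.
have h2 : 0 <= L * (x * z) by rewrite !mulr_ge0.
have h3 : 0 <= L * z by rewrite !mulr_ge0.
by clear -h1 h2 h3 ez; lra.
Qed.

Let arith5 c x z e L v p q r : 0 <= c -> 0 <= x -> 0 <= z -> 0 <= L -> 0 <= e ->
  e <= L * (3 * z) -> v <= c -> p * q <= 9 * z -> (r - 1) * q <= 3 * x ->
  L * (c * z) + (e * v + L * p * q + e * (2 * (r - 1) * q)) <=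
    (16 + 4 * c + 18 * x) * L * z.
Proof.
move=> c0 x0 z0 l0 e0 ez vc pq rq.
have h1 := ler_wpM2l e0 vc.
have h2 := ler_wpM2l l0 pq.
have h3 := ler_wpM2l e0 rq.
have h4 := ler_wpM2r c0 ez.
have h5 := ler_wpM2r x0 ez.
have h6 : 0 <= L * (c * z) by rewrite !mulr_ge0.
have h7 : 0 <= L * z by rewrite !mulr_ge0.
by clear -h1 h2 h3 h4 h5 h6 h7; lra.
Qed.

Let half_bounds n : (1 < n)%N ->
  [/\ (0 < n./2)%N, (n./2 <= n.-1)%N, ((n./2).*2 <= n)%N & (n <= 3 * n./2)%N].
Proof.
move=> n1; have := odd_double_half n; rewrite -muln2; move: (n./2) n1 => h.
by case: odd => /= n1 e; split; lia.
Qed.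

Variables (a b : R).
Hypotheses (a0 : 0 < a) (b01 : 0 < b < 1) (ab1 : a * b < 1).
Let b0 : 0 < b. Proof. by case/andP: b01. Qed.
Local Notation V := (EK_tail a b).
Local Notation al := (a * b).
Let al0 : 0 < al. Proof. exact: mulr_gt0. Qed.
Let al01 : 0 <= al <= 1. Proof. by rewrite !ltW. Qed.
Let c : R := 1 - 2^-1 `^ a.
Let c0 : 0 < c.
Proof. by rewrite subr_gt0 powR_lt1 ?invr_ge0// invf_lt1// ltr1n. Qed.
(** Away from the endpoint x = n, the base of [EK_tail] has size at least c n^a; changing it by (1 +
    a) n^(a - 1) changes its power b by at most (c n^a)^(b - 1) (1 + a) n^(a - 1), which is this
    constant times n^(a b - 1). *)
Definition tail_gap_constant := c `^ (b - 1) * (1 + a).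
Local Notation C1 := tail_gap_constant.
Let C1_ge0 : 0 <= C1.
Proof. by rewrite mulr_ge0 ?powR_ge0// addr_ge0// ltW. Qed.

Lemma EK_tail_gap n x y : (0 < n)%N -> 0 <= y -> y <= x ->
  c * n%:R `^ a <= x -> x - y <= (1 + a) * n%:R `^ (a - 1) ->
  x `^ b - y `^ b <= C1 * n%:R `^ (al - 1).
Proof.
move=> n0 y0 yx xl xy; have n0' : 0 < n%:R :> R by rewrite ltr0n.
have cn : 0 < c * n%:R `^ a by rewrite mulr_gt0// powR_gt0.
have x0 := lt_le_trans cn xl.
have b01' : 0 <= b <= 1 by case/andP: b01 => *; rewrite !ltW.
apply: le_trans (powR_sub_le b01' y0 yx x0) _.
have -> : C1 * n%:R `^ (al - 1) =
    (c * n%:R `^ a) `^ (b - 1) * ((1 + a) * n%:R `^ (a - 1)).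
  rewrite powRM ?powR_ge0 ?(ltW c0)// -powRrM.
  have e1 : al - 1 = a * (b - 1) + (a - 1) by ring.
  have e2 : n%:R `^ (al - 1) = n%:R `^ (a * (b - 1)) * n%:R `^ (a - 1) :> R.
    by rewrite e1; apply: powRD; rewrite (gt_eqF n0') implybT.
  by rewrite e2 /tail_gap_constant; ring.
apply: ler_pM; rewrite ?powR_ge0 ?subr_ge0//.
by apply: powR_neg_anti => //; rewrite subr_le0; case/andP: b01 => _ /ltW.
Qed.

Lemma half_level_gap n h : (h.*2 <= n)%N -> c * n%:R `^ a <= n%:R `^ a - h%:R `^ a.
Proof.
move=> hn; rewrite /c mulrBl mul1r lerD2l lerN2 -powRM ?invr_ge0//.
rewrite ge0_ler_powR ?nnegrE ?(ltW a0) ?mulr_ge0 ?invr_ge0//.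
by rewrite mulrC ler_pdivlMr// -natrM ler_nat muln2.
Qed.

Variables (f : R -> R) (L : R) (N M : nat).
Hypothesis L0 : 0 <= L.
Hypothesis M0 : (0 < M)%N.
Hypothesis f1 : forall x y, 0 <= x -> x <= y -> y <= N%:R ->
  `|f y - f x| <= L * (y `^ al - x `^ al).
Hypothesis f2 : forall y z, 0 < y - 1 -> y <= z -> z <= N%:R ->
  `|f y - f (y - 1) - f z + f (z - 1)| <= L * (z - y) * (y - 1) `^ (al - 2).

Let p i j : R := i%:R + j%:R / M%:R.
Let w n i j := V n%:R (p i j) - V n%:R (p i j.+1).
Let eps i j := f (p i j.+1) - f (i%:R + 1).
Let D n i := \sum_(j < M) w n i j * eps i j.
Definition truncation n := \sum_(i < n) D n i.

Let p_ge i j : i%:R <= p i j.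
Proof. by rewrite lerDl divr_ge0. Qed.

Let p_le i j : (j <= M)%N -> p i j <= i%:R + 1.
Proof. by move=> jM; rewrite lerD2l ler_pdivrMr ?ltr0n// mul1r ler_nat. Qed.

Let p_mono i j : p i j <= p i j.+1.
Proof. by rewrite lerD2l ler_wpM2r ?invr_ge0// ler_nat. Qed.

Let p_le_nat n i (j : 'I_M) : (i < n)%N -> p i j.+1 <= n%:R.
Proof. by move=> i_n; apply: le_trans (p_le _ (ltn_ord j)) _; rewrite natr1 ler_nat. Qed.

Let w_ge0 n i (j : 'I_M) : (i < n)%N -> 0 <= w n i j.
Proof.
move=> i_n; rewrite subr_ge0 EK_tail_anti ?p_mono ?p_le_nat//.
by apply: le_trans (p_ge _ _).
Qed.

Let sum_w n i : \sum_(j < M) w n i j = V n%:R i%:R - V n%:R i.+1%:R.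
Proof.
rewrite -(big_mkord xpredT (fun j => w n i j)).
pose F j := - V n%:R (p i j).
have -> : \sum_(0 <= j < M) w n i j = F M - F 0%N.
  by rewrite -telescope_sumr//; apply: eq_bigr => j _; rewrite /F opprK addrC.
have e0 : p i 0 = i%:R by rewrite /p mul0r addr0.
have e1 : p i M = i.+1%:R by rewrite /p divff ?natr1// pnatr_eq0 -lt0n.
by rewrite /F e0 e1 opprK addrC.
Qed.

Let eps_bound i (j : 'I_M) : (i < N)%N -> `|eps i j| <= L * (i.+1%:R `^ al - i%:R `^ al).
Proof.
move=> iN; rewrite distrC natr1; apply: le_trans (f1 _ _ _) _; last first.
- rewrite ler_wpM2l// lerD2l lerN2 ge0_ler_powR ?nnegrE ?(ltW al0)//.
    by apply: le_trans (p_ge _ _).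
- by rewrite ler_nat.
- by rewrite -natr1 p_le.
- by apply: le_trans (p_ge _ _).
Qed.

Let eps_bound1 i (j : 'I_M) : (i < N)%N -> `|eps i j| <= L.
Proof.
move=> iN; apply: le_trans (eps_bound _ iN) _; rewrite -[leRHS]mulr1 ler_wpM2l//.
have := powR_increment_anti al01 (lexx 0) (ler0n R i) ler01.
by rewrite add0r powR1 powR0 ?gt_eqF// subr0 natr1.
Qed.

Let eps_bound2 i h (j : 'I_M) : (0 < h)%N -> (h <= i)%N -> (i < N)%N ->
  `|eps i j| <= L * h%:R `^ (al - 1).
Proof.
move=> h0 hi iN; have i0 : 0 < i%:R :> R by rewrite ltr0n (leq_trans h0).
apply: le_trans (eps_bound _ iN) _; rewrite ler_wpM2l//.
have t := powR_tangent al01 (ler0n R i.+1) i0.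
have e : i%:R `^ (al - 1) <= h%:R `^ (al - 1).
  by rewrite powR_neg_anti ?ltr0n ?ler_nat// subr_le0 ltW.
apply: le_trans e; rewrite lerBlDl; apply: le_trans t _; rewrite lerD2l -natr1.
by rewrite [i%:R + 1]addrC addrK mulr1 ler_piMl ?powR_ge0// ltW.
Qed.

Let eps_shift i h (j : 'I_M) : (0 < h)%N -> (h <= i)%N -> (i.+1 < N)%N ->
  `|eps i.+1 j - eps i j| <= L * h%:R `^ (al - 2).
Proof.
move=> h0 hi iN; have i0 : 0 < i%:R :> R by rewrite ltr0n (leq_trans h0).
have e1 : p i.+1 j.+1 = p i j.+1 + 1 by rewrite /p -natr1; ring.
have H := f2 (y := p i.+1 j.+1) (z := i.+1%:R + 1).
rewrite /eps.
have -> : f (p i.+1 j.+1) - f (i.+1%:R + 1) - (f (p i j.+1) - f (i%:R + 1)) =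
  f (p i.+1 j.+1) - f (p i.+1 j.+1 - 1) - f (i.+1%:R + 1) + f (i.+1%:R + 1 - 1).
  by rewrite e1 !addrK -!natr1; ring.
have p1 : 0 < p i.+1 j.+1 - 1 by rewrite e1 addrK (lt_le_trans i0)// p_ge.
apply: le_trans (H p1 (p_le _ (ltn_ord j)) _) _; first by rewrite natr1 ler_nat.
rewrite -mulrA ler_wpM2l// -[leRHS]mul1r.
apply: ler_pM; rewrite ?powR_ge0 ?subr_ge0 ?p_le//.
  by rewrite lerBlDr [leRHS]addrC lerD2r p_ge.
rewrite e1 addrK powR_neg_anti ?ltr0n//; last first.
  by apply: le_trans (p_ge _ _); rewrite ler_nat.
by rewrite subr_le0 (le_trans (ltW ab1))// ler1n.
Qed.

Let D_bound n i e : (i < n)%N -> (forall j : 'I_M, `|eps i j| <= e) ->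
  `|D n i| <= e * (V n%:R i%:R - V n%:R i.+1%:R).
Proof.
move=> i_n H; have := weighted_sum_bound (fun j : 'I_M => w n i j) H.
by under [X in _ * X]eq_bigr do rewrite ger0_norm ?w_ge0//; rewrite sum_w.
Qed.

Let D_diff m i e : (i < m)%N -> (forall j : 'I_M, `|eps i j| <= e) ->
  `|D m.+1 i - D m i| <=
    e * ((V m%:R i%:R - V m%:R i.+1%:R) - (V m.+1%:R i%:R - V m.+1%:R i.+1%:R)).
Proof.
move=> im H; have wm (j : 'I_M) : w m.+1 i j <= w m i j.
  apply: EK_weight_anti => //; rewrite ?p_mono ?p_le_nat ?ler_nat//.
  by apply: le_trans (p_ge _ _).
exact: (weighted_sum_diff_bound H wm (sum_w m i) (sum_w m.+1 i)).
Qed.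

(** The weights of a cell decrease from level m to m + 1, so their differences have one sign and the
    sum of absolute values telescopes. *)
Let sum_D_diff m h k e : (h <= k)%N -> (k <= m)%N -> 
  (forall i (j : 'I_M), (h <= i < k)%N -> `|eps i j| <= e) ->
  `|\sum_(h <= i < k) (D m.+1 i - D m i)| <=
    e * ((V m%:R h%:R - V m%:R k%:R) - (V m.+1%:R h%:R - V m.+1%:R k%:R)).
Proof.
move=> hk km H; apply: le_trans (ler_norm_sum _ _ _) _.
pose F i := e * (V m.+1%:R i%:R - V m%:R i%:R).
have -> : e * ((V m%:R h%:R - V m%:R k%:R) - (V m.+1%:R h%:R - V m.+1%:R k%:R)) =
  F k - F h.
  rewrite /F; move: (V m%:R h%:R) (V m%:R k%:R) (V m.+1%:R h%:R) (V m.+1%:R k%:R).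
  by move=> *; ring.
rewrite -(telescope_sumr F hk) big_nat [leRHS]big_nat; apply: ler_sum => i /andP[hi ik].
apply: le_trans (D_diff (e := e) (leq_trans ik km) _) _; first by move=> j; rewrite H// hi.
rewrite /F; move: (V m%:R i%:R) (V m%:R i.+1%:R) (V m.+1%:R i%:R) (V m.+1%:R i.+1%:R).
by move=> *; rewrite le_eqVlt; apply/orP; left; apply/eqP; ring.
Qed.

(** For a <= 1 the one new cell [m, m + 1] has weight at most 1, because (m + 1)^a - m^a <= 1. For a
    > 1 this weight grows with m, and the levels have to be compared differently. *)
Let near_concave m h e : a <= 1 -> (h <= m)%N -> 0 <= e ->
  (forall i (j : 'I_M), (h <= i <= m)%N -> `|eps i j| <= e) ->
  `|\sum_(h <= i < m.+1) D m.+1 i - \sum_(h <= i < m) D m i| <= 2 * e.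
Proof.
move=> a1 hm e0 H; rewrite big_nat_recr//= addrAC -sumrB.
have V1 : V m.+1%:R m%:R <= 1.
  apply: powR_le1; rewrite ?(ltW b0)// ?subr_ge0 ?pa.
    by rewrite ge0_ler_powR ?nnegrE ?(ltW a0)// ler_nat.
  have a01 : 0 <= a <= 1 by rewrite ltW.
  have := powR_increment_anti a01 (lexx 0) (ler0n R m) ler01.
  by rewrite add0r powR1 powR0 ?gt_eqF// subr0 natr1.
have h1 := sum_D_diff (e := e) hm (leqnn m).
have h2 := D_bound (e := e) (ltnSn m).
apply: le_trans (ler_normD _ _) _.
apply: le_trans (lerD (h1 _) (h2 _)) _.
- by move=> i j /andP[hi im]; rewrite H// hi ltnW.
- by move=> j; rewrite H// hm leqnn.
rewrite !EK_tailxx// -mulrDr mulrC ler_wpM2r//.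
have := @EK_tail_mono R a b a0 b01 m%:R m.+1%:R h%:R (ler0n _ _).
rewrite !ler_nat leqnSn hm => /(_ isT isT).
exact: arith_concave.
Qed.

Let ratio h : R := ((h%:R + 1) / h%:R) `^ a.

(** Cell i + 1 at level m + 1 is paired with cell i at level m; thus the heavy cell next to the
    endpoint has a partner, and the unpaired cell is [h], far from the singularity. The second
    difference of f controls the change of [eps], and [EK_weight_shift] that of the weights. *)
Let near_convex m h e : 1 <= a -> (0 < h)%N -> (h <= m)%N -> (m.+1 <= N)%N -> 0 <= e ->
  (forall i (j : 'I_M), (h <= i <= m)%N -> `|eps i j| <= e) ->
  `|\sum_(h <= i < m.+1) D m.+1 i - \sum_(h <= i < m) D m i| <=
    e * (V m.+1%:R h%:R - V m.+1%:R h.+1%:R) +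
    L * h%:R `^ (al - 2) * m.+1%:R `^ al + e * (2 * (ratio h - 1) * m.+1%:R `^ al).
Proof.
move=> a1 h0 hm mN e0 H.
have -> : \sum_(h <= i < m.+1) D m.+1 i - \sum_(h <= i < m) D m i =
    D m.+1 h + \sum_(h <= i < m) (D m.+1 i.+1 - D m i).
  by rewrite sumrB addrA big_nat_recl.
rewrite -[leRHS]addrA.
have r1 : 1 <= ratio h.
  have h0' : 0 < h%:R :> R by rewrite ltr0n.
  have := @ge0_ler_powR R a (ltW a0) 1 ((h%:R + 1) / h%:R).
  rewrite powR1; apply; rewrite ?nnegrE ?divr_ge0 ?addr_ge0//.
  by rewrite ler_pdivlMr// mul1r lerDl.
have dh := D_bound (e := e) (n := m.+1) (i := h) hm.
apply: le_trans (ler_normD _ _) (lerD (dh _) _).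
  by move=> j; rewrite H// leqnn.
(* A potential whose increments are exactly the bounds of [weighted_sum_shift_bound], so that the
   sum over i telescopes. *)
pose F i := L * h%:R `^ (al - 2) * (- V m.+1%:R i.+1%:R) +
  e * (2 * (ratio h - 1) * (- V m%:R i%:R) + (V m.+1%:R i.+1%:R - V m%:R i%:R)).
have step i : (h <= i < m)%N -> `|D m.+1 i.+1 - D m i| <= F i.+1 - F i.
  move=> /andP[hi im].
  have ww (j : 'I_M) : w m.+1 i.+1 j <= ratio h * w m i j.
    have e1 j' : p i.+1 j' = p i j' + 1 by rewrite /p -natr1; ring.
    rewrite /w !e1 -natr1; apply: EK_weight_shift; rewrite ?ltr0n ?p_mono ?p_le_nat//.
    by apply: le_trans (p_ge _ _); rewrite ler_nat.
  have H' (j : 'I_M) : `|eps i j| <= e by rewrite H// hi ltnW.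
  have := @weighted_sum_shift_bound 'I_M (fun j : 'I_M => w m i j) (fun j : 'I_M => w m.+1 i.+1 j)
    (fun j : 'I_M => eps i j) (fun j : 'I_M => eps i.+1 j) _ _ _ _ _ e0 r1 (fun j : 'I_M => eps_shift j h0 hi (leq_ltn_trans im mN)) H'
    (fun j : 'I_M => w_ge0 (n := m) (i := i) j im)
    (fun j : 'I_M => w_ge0 (n := m.+1) (i := i.+1) j im) ww (sum_w m i) (sum_w m.+1 i.+1).
  move=> /le_trans; apply; rewrite /F.
  move: (V m%:R i%:R) (V m%:R i.+1%:R) (V m.+1%:R i.+1%:R) (V m.+1%:R i.+2%:R).
  move: (ratio h) (h%:R `^ (al - 2)) => *.
  by rewrite le_eqVlt; apply/orP; left; apply/eqP; ring.
apply: le_trans (ler_norm_sum _ _ _) _.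
have t : \sum_(h <= i < m) `|D m.+1 i.+1 - D m i| <= F m - F h.
  rewrite -(telescope_sumr F (hm)) big_nat [leRHS]big_nat.
  by apply: ler_sum => i; exact: step.
apply: le_trans t _.
have hmR : h%:R <= m%:R :> R by rewrite ler_nat.
have hmR' : h.+1%:R <= m.+1%:R :> R by rewrite ler_nat.
have t1 : V m%:R h%:R <= m.+1%:R `^ al.
  have := EK_tail_anti a0 b01 (lexx 0) (ler0n R h) hmR.
  rewrite EK_tail0// => /le_trans; apply.
  by rewrite ge0_ler_powR ?nnegrE ?(ltW al0)// ler_nat.
have t2 : V m.+1%:R h.+1%:R <= m.+1%:R `^ al.
  by have := EK_tail_anti a0 b01 (lexx 0) (ler0n R h.+1) hmR'; rewrite EK_tail0.
have t3 : V m%:R h%:R <= V m.+1%:R h.+1%:R.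
  apply: ge0_ler_powR; rewrite ?nnegrE ?(ltW b0)// ?subr_ge0.
  - by rewrite ge0_ler_powR ?nnegrE ?(ltW a0)// ler_nat.
  - by rewrite ge0_ler_powR ?nnegrE ?(ltW a0)// ler_nat.
  have := powR_increment_mono a1 (ler0n R h) hmR ler01; rewrite !natr1.
  exact: arith_mono.
rewrite /F !EK_tailxx//.
have x0 : 0 <= L * h%:R `^ (al - 2) by rewrite mulr_ge0// powR_ge0.
exact: arith_convex.
Qed.


(** Dictated by the case a >= 1: C1 comes from the cells below n / 2, and 3 C1 + 9 + 18 (1 + a) 2^(a
    - 1) from the others, with 9 rounded up to 16. The powers of 3 come from n <= 3 floor(n / 2). *)
Definition truncation_constant : R :=
  16 + 4 * C1 + 18 * ((1 + a) * 2 `^ (a - 1)).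

Let Z_le1 n : (0 < n)%N -> n%:R `^ (al - 1) <= 1 :> R.
Proof.
move=> n0; have := @powR_neg_anti (al - 1) 1 n%:R.
by rewrite powR1; apply; rewrite ?ler1n// subr_le0 ltW.
Qed.

Let Z_half n r : (1 < n)%N -> r <= 0 -> (n./2)%:R `^ r <= 3 `^ (- r) * n%:R `^ r.
Proof.
move=> n1 r0; have [h0 _ _ hn] := half_bounds n1.
have -> : 3 `^ (- r) * n%:R `^ r = (n%:R / 3) `^ r.
  rewrite powRM ?invr_ge0// mulrC; congr (_ * _).
  by rewrite -[3^-1](powR_inv1 (ler0n _ 3)) -powRrM mulN1r.
apply: powR_neg_anti => //.
  by rewrite divr_gt0// ltr0n (leq_trans _ n1).
by rewrite ler_pdivrMr// -natrM ler_nat mulnC.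
Qed.

(** Two different gains: below n / 2 the oscillation of f on a cell is only O(L), but the weights
    change by O(n^(a b - 1)) in total; above n / 2 the weights may change by O(1), but the
    oscillation is O(n^(a b - 1)). *)
Lemma truncation_increment n : (0 < n <= N)%N ->
  `|truncation n - truncation n.-1| <= truncation_constant * L * n%:R `^ (al - 1).
Proof.
move=> /andP[n0 nN]; set Z := _ `^ (al - 1).
have Z0 : 0 <= Z by exact: powR_ge0.
have A0 : 0 <= (1 + a) * 2 `^ (a - 1).
  by rewrite mulr_ge0 ?powR_ge0// addr_ge0// ltW.
(* The case n = 1 is apart: [n./2] is 0 there, and the decay of the oscillation is expressed by
   powers of a positive h. *)
have [n1|n1] := leqP n 1.
  have n1' : n = 1%N by apply/eqP; rewrite eqn_leq n1.
  have Z1 : Z = 1 by rewrite /Z n1' powR1.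
  rewrite Z1 n1' /truncation big_ord_recl !big_ord0 subr0 addr0.
  have H (j : 'I_M) : `|eps 0 j| <= L by apply: eps_bound1; rewrite (leq_trans n0).
  apply: le_trans (D_bound (e := L) (ltn0Sn 0) H) _.
  rewrite EK_tailxx// EK_tail0// powR1 subr0 mulr1.
  exact: arith1.
case: n => // m in n0 nN Z Z0 n1 *.
have [h0 hm h2 h3] := half_bounds n1; set h := m.+1./2 in h0 hm h2 h3.
rewrite /= in hm.
have n0R : 0 < m.+1%:R :> R by rewrite ltr0n.
have hnR : h%:R <= m.+1%:R :> R by rewrite ler_nat leqW.
have hmR : h%:R <= m%:R :> R by rewrite ler_nat.
have mnR : m%:R <= m.+1%:R :> R by rewrite ler_nat.
have pw x y : 0 <= x -> x <= y -> x `^ a <= y `^ a.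
  by move=> x0 xy; rewrite ge0_ler_powR ?nnegrE ?(ltW a0) ?(le_trans x0).
have -> : truncation m.+1 - truncation m =
    \sum_(0 <= i < h) (D m.+1 i - D m i) +
    (\sum_(h <= i < m.+1) D m.+1 i - \sum_(h <= i < m) D m i).
  rewrite sumrB /truncation -!(big_mkord xpredT (fun i => D _ i)).
  have hm' : (h <= m.+1)%N by exact: leqW.
  rewrite (big_cat_nat (leq0n h) hm')/= (big_cat_nat (p := m) (leq0n h) hm)/=.
  exact: arith2.
have far : `|\sum_(0 <= i < h) (D m.+1 i - D m i)| <= L * (C1 * Z).
  have HL i (j : 'I_M) : (0 <= i < h)%N -> `|eps i j| <= L.
    by move=> /= ih; apply: eps_bound1; exact: leq_trans ih (leq_trans hm (ltnW nN)).
  apply: le_trans (sum_D_diff (e := L) (leq0n h) hm HL) _; rewrite ler_wpM2l//.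
  have g : (m.+1%:R `^ a - h%:R `^ a) `^ b - (m%:R `^ a - h%:R `^ a) `^ b <= C1 * Z.
    apply: EK_tail_gap => //; rewrite ?subr_ge0 ?pw ?lerD2r ?half_level_gap//.
      by apply: pw.
    have -> : m.+1%:R `^ a - h%:R `^ a - (m%:R `^ a - h%:R `^ a) =
        m.+1%:R `^ a - m%:R `^ a by rewrite opprB addrA subrK.
    apply: le_trans (powR_sub_le_gt0 a0 (ler0n _ m) mnR n0R) _.
    by rewrite -natr1 [_ + 1]addrC addrK mulr1.
  apply: le_trans g; apply: arith3.
  exact: EK_tail_mono.
pose e := L * h%:R `^ (al - 1).
have e0 : 0 <= e by rewrite mulr_ge0 ?powR_ge0.
have eZ : e <= L * (3 * Z).
  rewrite ler_wpM2l//; have al1' : al - 1 <= 0 by rewrite subr_le0 ltW.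
  apply: le_trans (Z_half n1 al1') _; rewrite ler_wpM2r// opprB.
  have := @ler_powR R 3; rewrite ler1n => /(_ isT (1 - al) 1); rewrite powRr1//.
  by apply; rewrite gerBl ltW.
have He i (j : 'I_M) : (h <= i <= m)%N -> `|eps i j| <= e.
  by move=> /andP[hi im]; apply: eps_bound2 => //; exact: leq_ltn_trans nN.
apply: le_trans (ler_normD _ _) _; apply: le_trans (lerD far (lexx _)) _.
have [a1|/ltW a1] := leP a 1.
  apply: le_trans (lerD (lexx _) (near_concave a1 hm e0 He)) _.
  exact: arith4.
apply: le_trans (lerD (lexx _) (near_convex a1 h0 hm nN e0 He)) _.
have g1 : V m.+1%:R h%:R - V m.+1%:R h.+1%:R <= C1.
  have hR : h%:R <= h.+1%:R :> R by rewrite ler_nat.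
  have hR' : h.+1%:R <= m.+1%:R :> R by rewrite ler_nat.
  apply: (@le_trans _ _ (C1 * Z)); last by rewrite ler_piMr// Z_le1.
  apply: EK_tail_gap => //; rewrite ?subr_ge0 ?pw ?lerD2l ?lerN2 ?half_level_gap//.
    by apply: pw.
  have -> : m.+1%:R `^ a - h%:R `^ a - (m.+1%:R `^ a - h.+1%:R `^ a) =
      h.+1%:R `^ a - h%:R `^ a by ring.
  have hp : 0 < h.+1%:R :> R by rewrite ltr0n.
  apply: le_trans (powR_sub_le_gt0 a0 (ler0n _ h) hR hp) _.
  rewrite -natr1 [_ + 1 - _]addrAC subrr add0r mulr1 ler_wpM2l ?addr_ge0 ?(ltW a0)//.
  by rewrite natr1 ge0_ler_powR ?nnegrE ?subr_ge0.
have nn : m.+1%:R `^ al = m.+1%:R * Z.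
  rewrite /Z powRB ?(gt_eqF n0R) ?implybT// powRr1 ?(ltW n0R)//.
  by rewrite [RHS]mulrC divfK ?gt_eqF.
have g2 : h%:R `^ (al - 2) * m.+1%:R `^ al <= 9 * Z.
  have al2 : al - 2 <= 0 by rewrite subr_le0 (le_trans (ltW ab1))// ler1n.
  have q1 : h%:R `^ (al - 2) <= 9 * m.+1%:R `^ (al - 2).
    apply: le_trans (Z_half n1 al2) _; rewrite ler_wpM2r ?powR_ge0// opprB.
    have := @ler_powR R 3; rewrite ler1n => /(_ isT (2 - al) 2%:R).
    rewrite gerBl (ltW al0) powR_mulrn// => /(_ isT) /le_trans; apply.
    by rewrite -natrX ler_nat.
  have q2 : m.+1%:R `^ (al - 2) * m.+1%:R = Z.
    have -> : Z = m.+1%:R `^ (al - 2 + 1) by rewrite /Z; congr (_ `^ _); ring.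
    by rewrite [RHS]powRD ?(gt_eqF n0R) ?implybT// powRr1 ?(ltW n0R).
  rewrite nn; apply: (@le_trans _ _ (9 * m.+1%:R `^ (al - 2) * (m.+1%:R * Z))).
    by rewrite ler_wpM2r// mulr_ge0.
  by rewrite mulrA -[9 * _ * _]mulrA q2 -mulrA ler_wpM2l// ler_piMl// Z_le1.
have g3 : (ratio h - 1) * m.+1%:R `^ al <= 3 * ((1 + a) * 2 `^ (a - 1)).
  have hp : 0 < h%:R :> R by rewrite ltr0n.
  have q0 : 1 <= (h%:R + 1) / h%:R :> R by rewrite ler_pdivlMr// mul1r lerDl.
  have q0' : 0 < (h%:R + 1) / h%:R :> R by exact: lt_le_trans q0.
  have := powR_sub_le_gt0 a0 ler01 q0 q0'; rewrite powR1 -/(ratio h).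
  have -> : (h%:R + 1) / h%:R - 1 = h%:R^-1 :> R by field; rewrite gt_eqF.
  move=> /(ler_wpM2r (powR_ge0 m.+1%:R al)) /le_trans; apply.
  have q1 : ((h%:R + 1) / h%:R) `^ (a - 1) <= 2 `^ (a - 1).
    rewrite ge0_ler_powR ?nnegrE ?subr_ge0 ?(ltW q0')//.
    by rewrite ler_pdivrMr// mulr_natl mulr2n lerD2l ler1n.
  have q2 : h%:R^-1 * m.+1%:R `^ al <= 3.
    rewrite mulrC ler_pdivrMr// nn; apply: (@le_trans _ _ m.+1%:R).
      by rewrite ler_piMr// Z_le1.
    by rewrite -natrM ler_nat.
  rewrite -[leLHS]mulrA [leRHS]mulrC.
  have a10 : 0 <= 1 + a by rewrite addr_ge0// ltW.
  have z1 : 0 <= (1 + a) * ((h%:R + 1) / h%:R) `^ (a - 1).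
    by rewrite mulr_ge0// powR_ge0.
  have z2 : 0 <= h%:R^-1 * m.+1%:R `^ al by rewrite mulr_ge0 ?powR_ge0// invr_ge0.
  exact: (ler_pM z1 z2 (ler_wpM2l a10 q1) q2).
exact: arith5 eZ g1 g2 g3.
Qed.

End Truncation.

(** * Discrete Erdelyi-Kober sums: increments, defect, coercivity *)

Section DiscreteSums.
Context {R : realType}.
Local Notation mu := (@lebesgue_measure R).
Implicit Types (x y z c e L T k : R) (n m i j N M : nat) (ph : nat -> R).

Lemma powR_succ r x : 0 < x -> x `^ r = x `^ (r - 1) * x.
Proof.
move=> x0; rewrite -{3}[x](powRr1 (ltW x0)) -powRD ?subrK//.
by rewrite (gt_eqF x0) implybT.
Qed.

Lemma abel_summation (g ph : nat -> R) m :
  \sum_(i < m.+1) (g i - g i.+1) * ph i.+1 =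
  g 0%N * ph 1%N - g m.+1 * ph m.+1 + \sum_(i < m) g i.+1 * (ph i.+2 - ph i.+1).
Proof.
elim: m => [|m IH]; first by rewrite big_ord_recl !big_ord0/=; ring.
by rewrite big_ord_recr IH [in RHS]big_ord_recr/=; ring.
Qed.

Lemma sum_ord_mul (F : nat -> R) n M :
  \sum_(j < n * M) F j = \sum_(i < n) \sum_(j < M) F (i * M + j)%N.
Proof.
elim: n => [|n IH]; first by rewrite mul0n !big_ord0.
rewrite big_ord_recr/= -IH.
rewrite -(big_mkord xpredT F) -(big_mkord xpredT F).
rewrite (big_cat_nat (n := (n * M)%N)) ?leq0n ?leq_mul//=; congr (_ + _).
rewrite -{1}[(n * M)%N]add0n big_addn mulSn addnK big_mkord.
by apply: eq_bigr => j _; rewrite addnC.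
Qed.

Lemma sum_interlace (g h : nat -> R) m : g 1%N <= 1 -> 0 <= h m.+1 ->
  (forall i, (i < m)%N -> g i.+2 <= h i.+1) ->
  \sum_(i < m.+1) (g i.+1 - h i.+1) <= 1.
Proof.
move=> g1 h0 gh; rewrite sumrB big_ord_recl [X in _ - X]big_ord_recr/=.
have b3 : \sum_(i < m) g (bump 0 i).+1 <= \sum_(i < m) h i.+1.
  by apply: ler_sum => i _; exact: gh.
move: g1 h0 b3; move: (g 1%N) (h m.+1) (\sum_(i < m) g _) (\sum_(i < m) h i.+1).
by move=> *; lra.
Qed.

Let coercivity_first u w v z p : 0 <= u * (p * v) ->
  p / 2 * (u * z * v) + u / 2 * ((1 + z) * w) <=
  u * ((1 + z) * (2^-1 * w + p * (2^-1 * v))) :> R.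
Proof. by move=> *; lra. Qed.

Let interlace_nat i m : (i < m)%N -> (i.+1 * m.+2 <= i.+2 * m.+1)%N.
Proof. by nia. Qed.

Let weighted_difference_ge0 x y z c e p : x * z = p -> 0 <= x * y - c * p -> 0 <= e ->
  0 <= x * (y * e - c * (z * e)).
Proof.
move=> <- h1 h2.
by rewrite (_ : _ * _ = (x * y - c * (x * z)) * e) ?mulr_ge0//; ring.
Qed.

Variables (alpha beta : R).
Hypotheses (alpha01 : 0 < alpha < 1) (beta01 : 0 < beta < 1).
Let alpha0 : 0 < alpha. Proof. by case/andP: alpha01. Qed.
Let beta0 : 0 < beta. Proof. by case/andP: beta01. Qed.
Let al01 : 0 <= alpha <= 1. Proof. by case/andP: alpha01 => *; rewrite !ltW. Qed.
Let a := alpha / beta.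
Let a0 : 0 < a. Proof. by rewrite divr_gt0. Qed.
Let ab : a * beta = alpha. Proof. by rewrite /a divfK// gt_eqF. Qed.
Local Notation K := (EK_kernel alpha beta).
Local Notation G := (EK_primitive a beta).
Local Notation V := (EK_tail a beta).

Definition EK_constant : R := (beta * Gamma beta)^-1.
Local Notation kap := EK_constant.

Lemma EK_constant_gt0 : 0 < kap.
Proof. by rewrite invr_gt0 mulr_gt0// Gamma_gt0. Qed.
Let kap0 : 0 <= kap. Proof. exact: ltW EK_constant_gt0. Qed.

Definition EK_sum n ph := \sum_(i < n) EK_coef alpha beta n i.+1 * ph i.+1.

Lemma EK_coefE n i :
  EK_coef alpha beta n i.+1 = kap * (G (i%:R / n%:R) - G (i.+1%:R / n%:R)).
Proof. by []. Qed.

Lemma EK_coef_ge0 n i : (i < n)%N -> 0 <= EK_coef alpha beta n i.+1.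
Proof.
move=> i_n; have n0 : 0 < n%:R :> R by rewrite ltr0n (leq_ltn_trans _ i_n).
rewrite EK_coefE mulr_ge0// subr_ge0 EK_primitive_anti ?divr_ge0//.
  by rewrite ler_wpM2r ?invr_ge0// ler_nat.
by rewrite ler_pdivrMr// mul1r ler_nat.
Qed.

Lemma EK_tail_scale n x : (0 < n)%N -> 0 <= x -> x <= n%:R ->
  n%:R `^ alpha * G (x / n%:R) = V n%:R x.
Proof.
move=> n0 x0 xn; have n0' : 0 < n%:R :> R by rewrite ltr0n.
rewrite /EK_primitive /EK_tail -{1}ab powRrM -powRM ?powR_ge0//; last first.
  by rewrite subr_ge0 powR_le1 ?(ltW a0) ?divr_ge0// ler_pdivrMr// mul1r.
congr (_ `^ _); rewrite mulrBr mulr1 -powRM ?divr_ge0//.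
by rewrite mulrC divfK// gt_eqF.
Qed.

Lemma EK_coef_tail n i : (i < n)%N ->
  n%:R `^ alpha * EK_coef alpha beta n i.+1 = kap * (V n%:R i%:R - V n%:R i.+1%:R).
Proof.
move=> i_n; have n0 : (0 < n)%N by exact: leq_ltn_trans i_n.
have iR : i%:R <= n%:R :> R by rewrite ler_nat ltnW.
have iR' : i.+1%:R <= n%:R :> R by rewrite ler_nat.
rewrite -(EK_tail_scale n0 (ler0n R i) iR) -(EK_tail_scale n0 (ler0n R i.+1) iR').
by rewrite -mulrBr mulrCA.
Qed.

Lemma EK_sumD n ph1 ph2 :
  EK_sum n (fun i => ph1 i + ph2 i) = EK_sum n ph1 + EK_sum n ph2.
Proof. by rewrite -big_split; apply: eq_bigr => i _; rewrite mulrDr. Qed.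

Lemma EK_sumZ n c ph : EK_sum n (fun i => c * ph i) = c * EK_sum n ph.
Proof. by rewrite mulr_sumr; apply: eq_bigr => i _; rewrite mulrCA. Qed.

Lemma EK_sum_cst n c : (0 < n)%N -> EK_sum n (fun=> c) = kap * c.
Proof.
move=> n0; have n0' : n%:R != 0 :> R by rewrite pnatr_eq0 -lt0n.
rewrite /EK_sum -mulr_suml; congr (_ * _).
pose F i := - G (i%:R / n%:R).
have -> : \sum_(i < n) EK_coef alpha beta n i.+1 = kap * \sum_(0 <= i < n) (F i.+1 - F i).
  rewrite big_mkord mulr_sumr; apply: eq_bigr => i _; rewrite EK_coefE /F.
  by rewrite opprK [- _ + _]addrC.
rewrite telescope_sumr// /F mul0r EK_primitive0// divff// EK_primitive1//.
by rewrite oppr0 add0r opprK mulr1.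
Qed.

Lemma EK_sum_bound n ph e : 0 <= e -> (forall i, (i < n)%N -> `|ph i.+1| <= e) ->
  `|EK_sum n ph| <= kap * e.
Proof.
move=> e0 H; have [->|n0] := posnP n.
  by rewrite /EK_sum big_ord0 normr0 mulr_ge0.
rewrite -(EK_sum_cst e n0); apply: le_trans (ler_norm_sum _ _ _) _.
by apply: ler_sum => i _; rewrite normrM ger0_norm ?EK_coef_ge0// ler_wpM2l ?EK_coef_ge0// H.
Qed.

Lemma EK_sum_abel m ph : EK_sum m.+1 ph = kap * (ph 1%N +
  \sum_(i < m) G (i.+1%:R / m.+1%:R) * (ph i.+2 - ph i.+1)).
Proof.
pose g i := G (i%:R / m.+1%:R).
have -> : EK_sum m.+1 ph = kap * \sum_(i < m.+1) (g i - g i.+1) * ph i.+1.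
  by rewrite mulr_sumr; apply: eq_bigr => i _; rewrite EK_coefE mulrA.
rewrite (abel_summation g ph m) /g mul0r EK_primitive0// divff ?pnatr_eq0//.
by rewrite EK_primitive1// mul0r subr0 mul1r.
Qed.

Let G_anti x y : 0 <= x -> x <= y -> y <= 1 -> G y <= G x.
Proof. exact: EK_primitive_anti. Qed.

(** After Abel summation only increments of [ph] remain, with coefficients G((i + 1) / (m + 2)) -
    G((i + 1) / (m + 1)). These are nonnegative and, as the two grids interlace, their sum is at
    most 1: no factor m is lost. *)
Lemma EK_sum_increment m ph e : 0 <= e ->
  (forall i, (i <= m)%N -> `|ph i.+2 - ph i.+1| <= e) ->
  `|EK_sum m.+2 ph - EK_sum m.+1 ph| <= kap * e.
Proof.
move=> e0 H; pose g i := G (i%:R / m.+2%:R); pose g' i := G (i%:R / m.+1%:R).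
have E1 : EK_sum m.+1 ph = kap * (ph 1%N +
    \sum_(i < m.+1) g' i.+1 * (ph i.+2 - ph i.+1)).
  rewrite EK_sum_abel big_ord_recr/= /g' divff ?pnatr_eq0//.
  by rewrite EK_primitive1// mul0r addr0.
rewrite E1 EK_sum_abel -mulrBr normrM (ger0_norm kap0) ler_wpM2l//.
have -> : ph 1%N + \sum_(i < m.+1) g i.+1 * (ph i.+2 - ph i.+1) -
    (ph 1%N + \sum_(i < m.+1) g' i.+1 * (ph i.+2 - ph i.+1)) =
    \sum_(i < m.+1) (g i.+1 - g' i.+1) * (ph i.+2 - ph i.+1).
  rewrite opprD addrACA subrr add0r -sumrB.
  by apply: eq_bigr => i _; rewrite mulrBl.
have n1 : 0 < m.+1%:R :> R by rewrite ltr0n.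
have n2 : 0 < m.+2%:R :> R by rewrite ltr0n.
have gg i : (i <= m)%N -> 0 <= g i.+1 - g' i.+1.
  move=> im; rewrite subr_ge0 G_anti ?divr_ge0//.
    by rewrite ler_wpM2l// lef_pV2 ?posrE// ler_nat.
  by rewrite ler_pdivrMr// mul1r ler_nat.
have B : \sum_(i < m.+1) (g i.+1 - g' i.+1) <= 1.
  apply: sum_interlace.
  - have g1 : 1%:R / m.+2%:R <= 1 :> R by rewrite ler_pdivrMr// mul1r ler_nat.
    have g0 : 0 <= 1%:R / m.+2%:R :> R by rewrite divr_ge0.
    by have := G_anti (lexx 0) g0 g1; rewrite EK_primitive0.
  - by rewrite /g' /EK_primitive powR_ge0.
  move=> i im; rewrite /g /g'.
  have s1 : i.+1%:R / m.+1%:R <= i.+2%:R / m.+2%:R :> R.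
    rewrite ler_pdivrMr// mulrAC ler_pdivlMr// -!natrM ler_nat.
    exact: interlace_nat.
  have s2 : i.+2%:R / m.+2%:R <= 1 :> R.
    by rewrite ler_pdivrMr// mul1r ler_nat !ltnS ltnW.
  have s0 : 0 <= i.+1%:R / m.+1%:R :> R by rewrite divr_ge0.
  exact: G_anti s0 s1 s2.
have HB (j : 'I_m.+1) : `|ph j.+2 - ph j.+1| <= e := H j (ltn_ord j).
apply: le_trans (weighted_sum_bound (fun j : 'I_m.+1 => g j.+1 - g' j.+1) HB) _.
rewrite -[leRHS]mulr1 ler_wpM2l//; apply: le_trans B; apply: ler_sum => i _.
by rewrite (ger0_norm (gg i (ltn_ord i))).
Qed.

(** For constant data c, the exact difference between t_n^alpha S_n - t_(n-1)^alpha S_(n-1) and the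
    scheme's t_n^alpha ((1 + alpha / n) S_n - S_(n-1)), divided by [kap] c. The formula changes at n
    = 1 because S_0 is 0 and not [kap] c. *)
Definition EK_defect k n : R := (if n == 1%N then - (alpha * k `^ alpha)
  else k `^ alpha * (n%:R `^ alpha - n.-1%:R `^ alpha - alpha * n%:R `^ (alpha - 1))).

Let defect_bounds n (x := n.+2%:R : R) (y := n.+1%:R : R) 
    (r := x `^ alpha - y `^ alpha - alpha * x `^ (alpha - 1)) :
  [/\ 0 <= r, r <= alpha * (y `^ (alpha - 1) - x `^ (alpha - 1)) &
      r * y `^ alpha <= alpha * x `^ (alpha - 1)].
Proof.
have x0 : 0 < x by rewrite ltr0n.
have y0 : 0 < y by rewrite ltr0n.
have xy : x - y = 1 by rewrite /x /y -(natr1 n.+1) addrC addKr.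
have yx : y <= x by rewrite ler_nat.
have r0 : 0 <= r.
  by have := powR_sub_ge al01 (ltW y0) x0; rewrite xy mulr1 subr_ge0.
have r1 : r <= alpha * (y `^ (alpha - 1) - x `^ (alpha - 1)).
  rewrite mulrBr lerD2r lerBlDl.
  by have := powR_tangent al01 (ltW x0) y0; rewrite xy mulr1.
split => //.
have h1 : y `^ (alpha - 1) - x `^ (alpha - 1) <= x `^ (alpha - 1) / y.
  rewrite ler_pdivlMr// mulrBl -powR_succ//.
  have yxp : y `^ alpha <= x `^ alpha.
    by rewrite ge0_ler_powR ?nnegrE ?(ltW alpha0) ?(ltW x0) ?(ltW y0).
  apply: le_trans (lerB yxp (lexx _)) _.
  by rewrite (powR_succ _ x0) -mulrBr xy mulr1.
have h2 : y `^ alpha <= y.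
  by rewrite -[leRHS](powRr1 (ltW y0)) ler_powR ?ler1n//; case/andP: al01.
apply: le_trans (ler_pM r0 (powR_ge0 _ _) r1 h2) _.
rewrite -mulrA ler_wpM2l ?(ltW alpha0)//.
by rewrite -ler_pdivlMr.
Qed.

Lemma EK_defect_sum k N :
  \sum_(n < N) `|EK_defect k n.+1| <= 2 * alpha * k `^ alpha.
Proof.
have k0 := powR_ge0 k alpha.
case: N => [|N]; first by rewrite big_ord0 !mulr_ge0 ?(ltW alpha0).
(* The induction carries 2 - N^(alpha - 1): the first defect accounts for 1, and the later ones
   telescope, being at most alpha k^alpha ((n - 1)^(alpha - 1) - n^(alpha - 1)). *)
apply: (@le_trans _ _ (alpha * k `^ alpha * (2 - N.+1%:R `^ (alpha - 1)))); last first.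
  by rewrite mulrC mulrA ler_wpM2r// ler_wpM2r ?(ltW alpha0)// gerBl powR_ge0.
elim: N => [|N IH].
  rewrite big_ord_recl big_ord0 /EK_defect/= powR1 addr0 normrN ger0_norm ?mulr_ge0 ?(ltW alpha0)//.
  by rewrite le_eqVlt; apply/orP; left; apply/eqP; ring.
rewrite big_ord_recr/=; apply: le_trans (lerD IH (lexx _)) _.
have [r0 r1 _] := defect_bounds N.
rewrite /EK_defect/= ger0_norm ?mulr_ge0//.
have := ler_wpM2l k0 r1.
move: (N.+1%:R `^ (alpha - 1)) (N.+2%:R `^ (alpha - 1)) (k `^ alpha).
by move=> u v w; set rr := w * _; move=> h; lra.
Qed.

(** Once the value on constants is removed, the growth t_n^alpha of S_n - [kap] ph(0) is compensated
    by the decay of the defect, and S_(n+1) - S_n is O(k^alpha) by [EK_sum_increment]. *)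
Lemma EK_defect_bound k n ph L : 0 <= L -> 0 <= k ->
  (forall i, (0 < i <= n.+1)%N -> `|ph i - ph 0%N| <= L * (i%:R `^ alpha * k `^ alpha)) ->
  (forall i, (i <= n)%N -> `|ph i.+1 - ph i| <= L * k `^ alpha) ->
  `|((n.+1%:R * k) `^ alpha - (n%:R * k) `^ alpha) * EK_sum n ph -
    alpha / n.+1%:R * (n.+1%:R * k) `^ alpha * EK_sum n.+1 ph -
    EK_defect k n.+1 * (kap * ph 0%N)| <=
  2 * (kap * L * (k `^ alpha * k `^ alpha) * n.+1%:R `^ (alpha - 1)).
Proof.
move=> L0 k0 H0 H1; have ka0 := powR_ge0 k alpha.
have kLkk : 0 <= kap * L * (k `^ alpha * k `^ alpha) by rewrite !mulr_ge0.
case: n => [|n] in H0 H1 *.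
  rewrite mul0r powR0 ?gt_eqF// /EK_sum big_ord0 mulr0 sub0r powR1 mul1r divr1 mulr1.
  rewrite -/(EK_sum 1 ph) EK_sum_abel big_ord0 addr0 /EK_defect/=.
  have -> : - (alpha * k `^ alpha * (kap * ph 1%N)) - - (alpha * k `^ alpha) * (kap * ph 0%N) =
    - (alpha * k `^ alpha * kap * (ph 1%N - ph 0%N)) by ring.
  rewrite normrN normrM ger0_norm ?mulr_ge0 ?(ltW alpha0)//.
  have c1 : alpha * (k `^ alpha * kap) <= 2 * (k `^ alpha * kap).
    by rewrite ler_wpM2r ?mulr_ge0//; case/andP: al01 => _ /le_trans; apply; rewrite ler1n.
  rewrite -mulrA; apply: le_trans (ler_pM _ _ c1 (H1 0%N (leqnn _))) _.
  - by rewrite !mulr_ge0 ?(ltW alpha0).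
  - exact: normr_ge0.
  by rewrite le_eqVlt; apply/orP; left; apply/eqP; ring.
have [r0 r1 r2] := defect_bounds n.
set x := n.+2%:R in r0 r1 r2 *; set y := n.+1%:R in r0 r1 r2 *.
set r := _ - _ - _ in r0 r1 r2.
have x0 : 0 < x by rewrite ltr0n.
have S1 : `|EK_sum n.+2 ph - EK_sum n.+1 ph| <= kap * (L * k `^ alpha).
  apply: EK_sum_increment; first by rewrite mulr_ge0.
  by move=> i im; apply: H1; rewrite ltnS.
have S2 : `|EK_sum n.+1 ph - kap * ph 0%N| <= kap * (L * (y `^ alpha * k `^ alpha)).
  have -> : EK_sum n.+1 ph - kap * ph 0%N = EK_sum n.+1 (fun i => ph i + - ph 0%N).
    by rewrite EK_sumD EK_sum_cst// mulrN.
  apply: EK_sum_bound; first by rewrite !mulr_ge0 ?powR_ge0.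
  move=> i i_n; apply: le_trans (H0 _ _) _; first by rewrite /= ltnS ltnW.
  rewrite ler_wpM2l// ler_wpM2r// ge0_ler_powR ?nnegrE ?(ltW alpha0)//.
  by rewrite ler_nat.
rewrite !powRM ?(ltW x0)//.
have xx : alpha / x * (x `^ alpha * k `^ alpha) = alpha * x `^ (alpha - 1) * k `^ alpha.
  by rewrite (powR_succ _ x0); field; rewrite gt_eqF.
rewrite xx /EK_defect/= -/x -/y -/r.
have -> : (x `^ alpha * k `^ alpha - y `^ alpha * k `^ alpha) * EK_sum n.+1 ph -
    alpha * x `^ (alpha - 1) * k `^ alpha * EK_sum n.+2 ph -
    k `^ alpha * r * (kap * ph 0%N) =
  k `^ alpha * r * (EK_sum n.+1 ph - kap * ph 0%N) -
  alpha * x `^ (alpha - 1) * k `^ alpha * (EK_sum n.+2 ph - EK_sum n.+1 ph).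
  by rewrite /r; ring.
apply: le_trans (ler_normB _ _) _; rewrite mulr2n mulrDl mul1r.
have xp := powR_ge0 x (alpha - 1).
have ax : alpha * x `^ (alpha - 1) <= x `^ (alpha - 1).
  by rewrite ler_piMl//; case/andP: al01.
apply: lerD; rewrite normrM ger0_norm ?mulr_ge0 ?(ltW alpha0)//.
  have kr : 0 <= k `^ alpha * r by rewrite mulr_ge0.
  apply: le_trans (ler_wpM2l kr S2) _.
  have := ler_wpM2l kLkk (le_trans r2 ax); apply: le_trans.
  by rewrite le_eqVlt; apply/orP; left; apply/eqP; ring.
have axk : 0 <= alpha * x `^ (alpha - 1) * k `^ alpha by rewrite !mulr_ge0 ?(ltW alpha0).
apply: le_trans (ler_wpM2l axk S1) _.
have := ler_wpM2l kLkk ax; apply: le_trans.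
by rewrite le_eqVlt; apply/orP; left; apply/eqP; ring.
Qed.

(** [B] stands for a Gram matrix. The second term on the left is column mass still unspent: the new
    row consumes (N + 1)^alpha S_N / 2 and returns (N + 1)^alpha (1 + alpha / (N + 1)) S_(N+1) / 2,
    which covers the next such term. *)
Lemma EK_coercivity (B : nat -> nat -> R) N :
  (forall i j, B i j + B i j <= B i i + B j j) -> (forall i, 0 <= B i i) ->
  kap / 2 * \sum_(n < N) alpha * n.+1%:R `^ (alpha - 1) * B n.+1 n.+1 +
    N.+1%:R `^ alpha / 2 * EK_sum N (fun i => B i i) <=
  \sum_(n < N) n.+1%:R `^ alpha *
    ((1 + alpha / n.+1%:R) * EK_sum n.+1 (fun i => B i n.+1) - EK_sum n (fun i => B i n.+1)).
Proof.
move=> BB B0; elim: N => [|N IH].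
  by rewrite !big_ord0 /EK_sum big_ord0 !mulr0 addr0.
rewrite !big_ord_recr/=; apply: le_trans (lerD IH (lexx _)).
set x := N.+1%:R; have x0 : 0 < x by rewrite ltr0n.
have xa := powR_ge0 x alpha; have ax : 0 <= alpha / x by rewrite divr_ge0// ltW.
pose Lam f := (1 + alpha / x) * EK_sum N.+1 f - EK_sum N f.
(* The coefficients of the entries up to N are nonpositive, so enlarging these entries decreases
   [Lam]; the entry N + 1 has to stay the same. *)
have mono f h : (forall i, (i < N)%N -> f i.+1 <= h i.+1) -> f N.+1 = h N.+1 ->
    x `^ alpha * Lam h <= x `^ alpha * Lam f.
  move=> fh fhN; rewrite -subr_ge0 -mulrBr /Lam.
  have -> : (1 + alpha / x) * EK_sum N.+1 f - EK_sum N f -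
      ((1 + alpha / x) * EK_sum N.+1 h - EK_sum N h) =
      (EK_sum N h - EK_sum N f) - (1 + alpha / x) * (EK_sum N.+1 h - EK_sum N.+1 f) by ring.
  have -> : EK_sum N.+1 h - EK_sum N.+1 f =
      \sum_(i < N) EK_coef alpha beta N.+1 i.+1 * (h i.+1 - f i.+1).
    rewrite /EK_sum !big_ord_recr/= fhN opprD addrACA subrr addr0 -sumrB.
    by apply: eq_bigr => i _; rewrite mulrBr.
  have -> : EK_sum N h - EK_sum N f =
      \sum_(i < N) EK_coef alpha beta N i.+1 * (h i.+1 - f i.+1).
    by rewrite /EK_sum -sumrB; apply: eq_bigr => i _; rewrite mulrBr.
  rewrite mulr_sumr -sumrB mulr_sumr; apply: sumr_ge0 => i _.
  have iN := ltn_ord i; have N0 : (0 < N)%N by exact: leq_ltn_trans iN.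
  have N0R : 0 < N%:R :> R by rewrite ltr0n.
  have hf : 0 <= h i.+1 - f i.+1 by rewrite subr_ge0 fh.
  have w3 : x `^ alpha * EK_coef alpha beta N.+1 i.+1 = kap * (V x i%:R - V x i.+1%:R).
    exact: (EK_coef_tail (n := N.+1) (ltnW iN : (i < N.+1)%N)).
  have w1 : V x i%:R - V x i.+1%:R <= V N%:R i%:R - V N%:R i.+1%:R.
    have iNR : i.+1%:R <= N%:R :> R by rewrite ler_nat.
    by apply: EK_weight_anti => //; rewrite ler_nat.
  apply: (weighted_difference_ge0 w3) hf; rewrite subr_ge0.
  have w2 : kap * (V x i%:R - V x i.+1%:R) <= N%:R `^ alpha * EK_coef alpha beta N i.+1.
    apply: le_trans (ler_wpM2l kap0 w1) _; rewrite le_eqVlt; apply/orP; left; apply/eqP.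
    exact/esym/EK_coef_tail.
  have a1 : 0 <= 1 + alpha / x by rewrite addr_ge0.
  apply: le_trans (ler_wpM2l a1 w2) _; rewrite mulrA ler_wpM2r ?EK_coef_ge0//.
  have t := powR_sub_ge al01 (ler0n R N) x0.
  have xN : x - N%:R = 1 by rewrite /x -natr1 addrC addKr.
  rewrite xN mulr1 in t.
  have xe : x `^ alpha = x `^ (alpha - 1) * x by exact: powR_succ.
  have t' : N%:R `^ alpha <= x `^ alpha * (1 - alpha / x).
    rewrite mulrBr mulr1 lerBrDr -lerBrDl; apply: le_trans t.
    by rewrite xe le_eqVlt; apply/orP; left; apply/eqP; field; rewrite gt_eqF.
  apply: le_trans (ler_wpM2l a1 t') _.
  rewrite mulrCA -[leRHS]mulr1 ler_wpM2l//.
  have -> : (1 + alpha / x) * (1 - alpha / x) = 1 - (alpha / x) ^+ 2 by ring.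
  by rewrite gerBl sqr_ge0.
(* Each off-diagonal entry is replaced by the half sum of the two diagonal ones, which reduces the
   form to diagonal entries. *)
pose h i := 2^-1 * B i i + 2^-1 * B N.+1 N.+1.
have hf : forall i, (i < N)%N -> B i.+1 N.+1 <= h i.+1.
  by move=> i _; have := BB i.+1 N.+1; rewrite /h; move: (B _ _) (B _ _) (B _ _) => *; lra.
have hN : B N.+1 N.+1 = h N.+1 by rewrite /h; field.
have m1 := mono (fun i => B i N.+1) h hf hN.
rewrite -[leRHS]/(_ + x `^ alpha * Lam (fun i => B i N.+1)).
apply: le_trans (lerD (lexx _) m1).
have Sh n : (0 < n)%N -> EK_sum n h = 2^-1 * EK_sum n (fun i => B i i) + kap * (2^-1 * B N.+1 N.+1).
  by move=> n0; rewrite /h EK_sumD EK_sumZ EK_sum_cst.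
have row : kap / 2 * (alpha * x `^ (alpha - 1) * B N.+1 N.+1) +
    x `^ alpha / 2 * ((1 + alpha / x) * EK_sum N.+1 (fun i => B i i) - EK_sum N (fun i => B i i))
    <= x `^ alpha * Lam h.
  have axx : alpha * x `^ (alpha - 1) = x `^ alpha * (alpha / x).
    by rewrite (powR_succ alpha x0); field; rewrite gt_eqF.
  (* For N = 0 the subtracted sum is empty, which leaves a nonnegative surplus; otherwise the row
     estimate is an identity. *)
  have [N0|N0] := posnP N.
    have E0 f : EK_sum N f = 0 by rewrite N0 /EK_sum big_ord0.
    have kb : 0 <= x `^ alpha * (kap * B N.+1 N.+1) by rewrite !mulr_ge0.
    rewrite /Lam Sh// axx !E0 !subr0; move: kb.
    move: (x `^ alpha) (EK_sum N.+1 _) (B N.+1 N.+1) (alpha / x) => u w v z.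
    exact: coercivity_first.
  rewrite /Lam !Sh// axx le_eqVlt; apply/orP; left; apply/eqP.
  by move: (EK_sum N.+1 _) (EK_sum N _) (x `^ alpha) (alpha / x) (B N.+1 N.+1) => *; field.
apply: le_trans (lerD (lexx _) row).
have col : N.+2%:R `^ alpha <= x `^ alpha * (1 + alpha / x).
  have t := powR_tangent al01 (ler0n R N.+2) x0.
  have xN : N.+2%:R - x = 1 by rewrite /x -(natr1 N.+1) addrC addKr.
  apply: le_trans t _; rewrite xN mulr1 mulrDr mulr1 lerD2l (powR_succ alpha x0).
  by rewrite le_eqVlt; apply/orP; left; apply/eqP; field; rewrite gt_eqF.
have SB : 0 <= EK_sum N.+1 (fun i => B i i).
  by apply: sumr_ge0 => i _; rewrite mulr_ge0 ?EK_coef_ge0.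
have := ler_wpM2r SB col; rewrite mulrDr.
move: (EK_sum N.+1 _) (EK_sum N _) (x `^ alpha) (N.+2%:R `^ alpha) (alpha / x).
move: (\sum_(i < N) _) (alpha * x `^ _ * _) => s1 s2 s3 s4 s5 s6 s7 h1.
by lra.
Qed.

End DiscreteSums.

(** * The residual of the exact solution in the scheme *)

Section DiscreteResidual.
Context {R : realType}.
Local Notation mu := (@lebesgue_measure R).
Implicit Types (x y z c e s L T k : R) (n m i N M : nat) (phi : R -> R).

Lemma small_negative_power alpha c e : 0 < alpha -> 0 <= c -> 0 < e ->
  exists2 M : nat, (0 < M)%N & c / M%:R `^ alpha <= e.
Proof.
move=> a0 c0 e0; have ce : 0 <= c / e by rewrite divr_ge0// ltW.
have := Num.Theory.archi_boundP (powR_ge0 (c / e) alpha^-1).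
set M := Num.Def.archi_bound _ => cM.
have M0 : 0 < M%:R :> R by exact: le_lt_trans (powR_ge0 _ _) cM.
exists M; first by rewrite -(ltr0n R).
rewrite ler_pdivrMr ?powR_gt0// mulrC -ler_pdivrMr//.
have -> : c / e = ((c / e) `^ alpha^-1) `^ alpha.
  by rewrite -powRrM mulVf ?gt_eqF// powRr1.
by rewrite ge0_ler_powR ?nnegrE ?powR_ge0 ?(ltW a0) ?(ltW M0)// ltW.
Qed.

Lemma weighted_sum_recenter (J : finType) (w v : J -> R) c z s : \sum_j w j = s ->
  s * (c * z) + c * (\sum_j w j * (v j - z)) = \sum_j w j * (c * v j).
Proof.
move=> <-; rewrite mulr_suml mulr_sumr -big_split/=.
by apply: eq_bigr => j _; ring.
Qed.

Variables (alpha beta : R).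
Hypotheses (alpha01 : 0 < alpha < 1) (beta01 : 0 < beta < 1).
Let alpha0 : 0 < alpha. Proof. by case/andP: alpha01. Qed.
Let alpha1 : alpha < 1. Proof. by case/andP: alpha01. Qed.
Let beta0 : 0 < beta. Proof. by case/andP: beta01. Qed.
Let al01 : 0 <= alpha <= 1. Proof. by case/andP: alpha01 => *; rewrite !ltW. Qed.
Let a := alpha / beta.
Let a0 : 0 < a. Proof. by rewrite divr_gt0. Qed.
Let ab : a * beta = alpha. Proof. by rewrite /a divfK// gt_eqF. Qed.
Local Notation K := (EK_kernel alpha beta).
Local Notation G := (EK_primitive a beta).
Local Notation V := (EK_tail a beta).
Local Notation kap := (EK_constant beta).
Let kap0 : 0 < kap. Proof. exact: EK_constant_gt0. Qed.

Lemma EK_tail_telescope n i M : (0 < M)%N ->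
  \sum_(j < M) (V n%:R (i%:R + j%:R / M%:R) - V n%:R (i%:R + j.+1%:R / M%:R)) =
  V n%:R i%:R - V n%:R i.+1%:R.
Proof.
move=> M0; pose F j := - V n%:R (i%:R + j%:R / M%:R).
have -> : \sum_(j < M) (V n%:R (i%:R + j%:R / M%:R) - V n%:R (i%:R + j.+1%:R / M%:R)) =
    F M - F 0%N.
  by rewrite -(telescope_sumr F (leq0n M)) big_mkord; apply: eq_bigr => j _; rewrite /F opprK addrC.
have e0 : i%:R + 0%:R / M%:R = i%:R :> R by rewrite mul0r addr0.
have e1 : i%:R + M%:R / M%:R = i.+1%:R :> R.
  by rewrite divff ?natr1// pnatr_eq0 -lt0n.
by rewrite /F e0 e1 opprK addrC.
Qed.

Variables (phi : R -> R) (L T : R).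
Hypotheses (L0 : 0 <= L) (T0 : 0 < T).
Hypothesis phi1 : forall s t, 0 <= s -> s <= t -> t <= T ->
  `|phi t - phi s| <= L * (t `^ alpha - s `^ alpha).
Hypothesis phi2 : forall s t k, 0 < s - k -> 0 < k -> s <= t -> t <= T ->
  `|phi s - phi (s - k) - phi t + phi (t - k)| <=
  L / (s - k) `^ (2 - alpha) * (k * (t - s)).

Let I t := \int[mu]_(y in `[0, 1]) (K y * phi (y * t)).
Let q t := alpha * kap * I t.
(** Passage to grid units: after division by k^alpha both regularity bounds hold with the same [L],
    whatever [k]. *)
Let f k x := phi (x * k) / k `^ alpha.

Let EK_split k n M : 0 < k -> (0 < M)%N ->
  (n%:R * k) `^ alpha * EK_sum alpha beta n (fun i => phi (i%:R * k)) +
    kap * (k `^ alpha * k `^ alpha) * truncation a beta (f k) M n =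
  kap * k `^ alpha * \sum_(i < n) \sum_(j < M)
    (V n%:R (i%:R + j%:R / M%:R) - V n%:R (i%:R + j.+1%:R / M%:R)) *
      phi ((i%:R + j.+1%:R / M%:R) * k).
Proof.
move=> k0 M0; have ka0 : k `^ alpha != 0 by rewrite gt_eqF// powR_gt0.
have fE x : phi (x * k) = k `^ alpha * f k x by rewrite /f mulrCA divff ?mulr1.
have -> : (n%:R * k) `^ alpha * EK_sum alpha beta n (fun i => phi (i%:R * k)) =
    kap * k `^ alpha * \sum_(i < n) (V n%:R i%:R - V n%:R i.+1%:R) * phi (i.+1%:R * k).
  rewrite powRM ?(ltW k0)// [_ * k `^ alpha]mulrC -!mulrA mulr_sumr mulrCA.
  congr (_ * _); rewrite !mulr_sumr; apply: eq_bigr => i _.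
  rewrite mulrA (EK_coef_tail alpha01 beta01 (ltn_ord i)).
  exact: esym (mulrA _ _ _).
have -> : kap * (k `^ alpha * k `^ alpha) * truncation a beta (f k) M n =
    kap * k `^ alpha * (k `^ alpha * truncation a beta (f k) M n).
  by move: (truncation _ _ _ _ _) => z; ring.
rewrite -mulrDr; congr (_ * _).
rewrite /truncation mulr_sumr -big_split/=; apply: eq_bigr => i _.
have fz : phi (i.+1%:R * k) = k `^ alpha * f k (i%:R + 1) by rewrite natr1 fE.
have -> : \sum_(j < M) (V n%:R (i%:R + j%:R / M%:R) - V n%:R (i%:R + j.+1%:R / M%:R)) *
      phi ((i%:R + j.+1%:R / M%:R) * k) =
    \sum_(j < M) (V n%:R (i%:R + j%:R / M%:R) - V n%:R (i%:R + j.+1%:R / M%:R)) *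
      (k `^ alpha * f k (i%:R + j.+1%:R / M%:R)).
  by apply: eq_bigr => j _; congr (_ * _); exact: fE.
rewrite fz; exact: weighted_sum_recenter (EK_tail_telescope n i M0).
Qed.

(** By [EK_split] the inner parenthesis is the quadrature rule with n M subcells, so [EK_quadrature]
    applies. The bound is uniform in n and vanishes as M grows, which lets [truncation] stand in for
    the true quadrature error. *)
Lemma EK_truncation k n M : 0 < k -> n%:R * k <= T -> (0 < M)%N ->
  `|(n%:R * k) `^ alpha * q (n%:R * k) -
    ((n%:R * k) `^ alpha * EK_sum alpha beta n (fun i => phi (i%:R * k)) +
     kap * (k `^ alpha * k `^ alpha) * truncation a beta (f k) M n)| <=
  kap * L * (T `^ alpha * T `^ alpha) / M%:R `^ alpha.
Proof.
move=> k0 nT M0; have Ma : 0 < M%:R `^ alpha :> R by rewrite powR_gt0// ltr0n.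
have rhs0 : 0 <= kap * L * (T `^ alpha * T `^ alpha) / M%:R `^ alpha.
  by rewrite divr_ge0 ?(ltW Ma)// !mulr_ge0 ?powR_ge0 ?(ltW kap0).
have [->|n0] := posnP n.
  rewrite mul0r powR0 ?gt_eqF// !mul0r /truncation big_ord0 mulr0 !(addr0, subr0) normr0.
  exact: rhs0.
have n0R : 0 < n%:R :> R by rewrite ltr0n.
have M0R : 0 < M%:R :> R by rewrite ltr0n.
have t0 : 0 <= n%:R * k by rewrite mulr_ge0// ltW.
have nM : (0 < n * M)%N by rewrite muln_gt0 n0.
rewrite EK_split//.
have Q := EK_quadrature alpha01 beta01 L0 phi1 t0 nT nM.
set S := \sum_(j < n * M) _ in Q.
have -> : kap * k `^ alpha * \sum_(i < n) \sum_(j < M)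
    (V n%:R (i%:R + j%:R / M%:R) - V n%:R (i%:R + j.+1%:R / M%:R)) *
      phi ((i%:R + j.+1%:R / M%:R) * k) = (n%:R * k) `^ alpha * (alpha * kap * S).
  pose F j := (V n%:R (j%:R / M%:R) - V n%:R (j.+1%:R / M%:R)) * phi (j.+1%:R / M%:R * k).
  have -> : (n%:R * k) `^ alpha * (alpha * kap * S) = kap * k `^ alpha * \sum_(j < n * M) F j.
    rewrite powRM ?(ltW k0)//.
    have -> : n%:R `^ alpha * k `^ alpha * (alpha * kap * S) =
        kap * k `^ alpha * (n%:R `^ alpha * alpha * S) by move: S {Q} => z; ring.
    congr (_ * _); rewrite /S mulr_sumr; apply: eq_bigr => j _.
    have jn (x : nat) : x%:R / (n * M)%:R = (x%:R / M%:R) / n%:R :> R.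
      by rewrite natrM; field; rewrite !gt_eqF.
    have jle (x : nat) : (x <= n * M)%N -> x%:R / M%:R <= n%:R :> R.
      by move=> xn; rewrite ler_pdivrMr// -natrM ler_nat.
    have g1 := EK_tail_scale alpha01 beta01 n0 (divr_ge0 (ler0n R j) (ltW M0R)) (jle j (ltnW (ltn_ord j))).
    have g2 := EK_tail_scale alpha01 beta01 n0 (divr_ge0 (ler0n R j.+1) (ltW M0R)) (jle j.+1 (ltn_ord j)).
    rewrite /F -g1 -g2 !jn.
    have -> : j.+1%:R / M%:R / n%:R * (n%:R * k) = j.+1%:R / M%:R * k.
      by field; rewrite !gt_eqF.
    move: (phi _) (G _) (G _) (n%:R `^ alpha) => x1 x2 x3 x4.
    by field; rewrite gt_eqF.
  congr (_ * _); rewrite sum_ord_mul; apply: eq_bigr => i _; apply: eq_bigr => j _.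
  have e1 (x : nat) : (i * M + x)%:R / M%:R = i%:R + x%:R / M%:R :> R.
    by rewrite natrD natrM mulrDl mulfK// gt_eqF.
  by rewrite /F -addnS !e1.
rewrite -mulrBr -mulrBr !normrM (ger0_norm (powR_ge0 _ _)) (ger0_norm (ltW alpha0)) (ger0_norm (ltW kap0)).
have ak : 0 <= alpha * kap by rewrite mulr_ge0 ?(ltW alpha0) ?(ltW kap0).
apply: le_trans (ler_wpM2l (powR_ge0 _ _) (ler_wpM2l ak Q)) _.
have tT : (n%:R * k) `^ alpha <= T `^ alpha by rewrite ge0_ler_powR ?nnegrE ?(ltW alpha0) ?(ltW T0).
have MM : M%:R `^ alpha <= (n * M)%:R `^ alpha :> R.
  by rewrite ge0_ler_powR ?nnegrE ?(ltW alpha0)// ler_nat leq_pmull.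
have nMa : 0 < (n * M)%:R `^ alpha :> R by rewrite powR_gt0// ltr0n.
have -> : (n%:R * k) `^ alpha * (alpha * kap *
    (L * (n%:R * k) `^ alpha / (n * M)%:R `^ alpha / alpha)) =
    kap * L * ((n%:R * k) `^ alpha * (n%:R * k) `^ alpha) / (n * M)%:R `^ alpha.
  by field; rewrite !gt_eqF.
have kL : 0 <= kap * L by rewrite mulr_ge0// ltW.
apply: ler_pM.
- by rewrite !mulr_ge0 ?powR_ge0 ?(ltW kap0).
- by rewrite invr_ge0 ltW.
- by rewrite ler_wpM2l// ler_pM ?powR_ge0.
- by rewrite lef_pV2 ?posrE.
Qed.

Definition residual_constant : R := truncation_constant a beta + 2.

Lemma EK_residual k n : 0 < k -> n.+1%:R * k <= T ->
  `|(n.+1%:R * k) `^ alpha * q (n.+1%:R * k) - (n%:R * k) `^ alpha * q (n%:R * k) -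
    (n.+1%:R * k) `^ alpha *
      ((1 + alpha / n.+1%:R) * EK_sum alpha beta n.+1 (fun i => phi (i%:R * k)) -
       EK_sum alpha beta n (fun i => phi (i%:R * k))) -
    EK_defect alpha k n.+1 * (kap * phi 0)| <=
  kap * L * residual_constant * (k `^ alpha * k `^ alpha) * n.+1%:R `^ (alpha - 1).
Proof.
move=> k0 nT; have k0' := ltW k0; set kk := k `^ alpha * k `^ alpha.
have ka0 : 0 < k `^ alpha by rewrite powR_gt0.
have kk0 : 0 <= kk by rewrite mulr_ge0 ?powR_ge0.
have nT' : n%:R * k <= T by apply: le_trans nT; rewrite ler_wpM2r// ler_nat.
set S1 := EK_sum _ _ n.+1 _; set S0 := EK_sum _ _ n _.
set t1 := (n.+1%:R * k) `^ alpha; set t0 := (n%:R * k) `^ alpha.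
set Z := n.+1%:R `^ (alpha - 1).
have D : `|(t1 - t0) * S0 - alpha / n.+1%:R * t1 * S1 - EK_defect alpha k n.+1 * (kap * phi 0)| <=
    2 * (kap * L * kk * Z).
  have := EK_defect_bound alpha01 beta01 (k := k) (n := n) (ph := fun i => phi (i%:R * k)) L0 k0'.
  rewrite mul0r; apply.
  - move=> i /andP[i0 i_n].
    have := phi1 (lexx 0) (mulr_ge0 (ler0n R i) k0'); rewrite powR0 ?gt_eqF// subr0 powRM//.
    by apply; apply: le_trans nT; rewrite ler_wpM2r// ler_nat.
  - move=> i i_n.
    have ik : i%:R * k <= i.+1%:R * k by rewrite ler_wpM2r// ler_nat.
    have iT : i.+1%:R * k <= T by apply: le_trans nT; rewrite ler_wpM2r// ler_nat.
    apply: le_trans (phi1 (mulr_ge0 (ler0n R i) k0') ik iT) _; rewrite ler_wpM2l//.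
    rewrite !powRM// -mulrBl ler_piMl ?powR_ge0//.
    have := powR_increment_anti al01 (lexx 0) (ler0n R i) ler01.
    by rewrite add0r powR1 powR0 ?gt_eqF// subr0 natr1.
have f1 x y : 0 <= x -> x <= y -> y <= n.+1%:R ->
    `|f k y - f k x| <= L * (y `^ (a * beta) - x `^ (a * beta)).
  move=> x0 xy yn; rewrite ab /f -mulrBl normrM [ `|_^-1| ]ger0_norm ?invr_ge0 ?powR_ge0//.
  have y0 := le_trans x0 xy.
  rewrite ler_pdivrMr//.
  have := phi1 (mulr_ge0 x0 k0') (ler_wpM2r k0' xy) (le_trans (ler_wpM2r k0' yn) nT).
  by rewrite !powRM// -mulrBl mulrA.
have f2 y z : 0 < y - 1 -> y <= z -> z <= n.+1%:R ->
    `|f k y - f k (y - 1) - f k z + f k (z - 1)| <= L * (z - y) * (y - 1) `^ (a * beta - 2).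
  move=> y1 yz zn; rewrite ab /f -!mulrBl -mulrDl normrM [ `|_^-1| ]ger0_norm ?invr_ge0 ?powR_ge0//.
  rewrite ler_pdivrMr//.
  have yk : 0 < y * k - k by rewrite -{2}[k]mul1r -mulrBl mulr_gt0.
  have ek x : x * k - k = (x - 1) * k by rewrite mulrBl mul1r.
  have H := phi2 yk k0 (ler_wpM2r k0' yz) (le_trans (ler_wpM2r k0' zn) nT).
  rewrite !ek in H; apply: le_trans H _.
  rewrite powRM ?(ltW y1)// le_eqVlt; apply/orP; left; apply/eqP.
  have kp : k `^ (2 - alpha) = k * k / k `^ alpha.
    rewrite powRB ?(gt_eqF k0) ?implybT//; congr (_ / _).
    by rewrite powR_mulrn// expr2.
  have yp : (y - 1) `^ (alpha - 2) = ((y - 1) `^ (2 - alpha))^-1.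
    by rewrite -powRN opprB.
  have y2 : (y - 1) `^ (2 - alpha) != 0 by rewrite gt_eqF// powR_gt0.
  rewrite kp yp; move: y2 ka0; move: ((y - 1) `^ (2 - alpha)) (k `^ alpha) => A B A0 B0.
  by field; rewrite A0 !gt_eqF.
have ab1 : a * beta < 1 by rewrite ab.
(* The claim does not involve M, which is now chosen so that the two uses of [EK_truncation] cost at
   most e / 2 each. *)
apply/ler_addgt0Pr => e e0.
have c0 : 0 <= kap * L * (T `^ alpha * T `^ alpha) by rewrite !mulr_ge0 ?powR_ge0 ?(ltW kap0).
have [M M0 Me] := small_negative_power alpha0 c0 (divr_gt0 e0 (ltr0n R 2)).
have E1 := EK_truncation k0 nT M0; have E0 := EK_truncation k0 nT' M0.
have Tr := truncation_increment a0 beta01 ab1 L0 M0 f1 f2 (n := n.+1) (leqnn _).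
rewrite /= ab in Tr.
rewrite -/S1 -/t1 -/kk in E1; rewrite -/S0 -/t0 -/kk in E0; rewrite -/Z in Tr.
have {}Tr := ler_wpM2l (mulr_ge0 (ltW kap0) kk0) Tr.
rewrite /residual_constant.
move: E1 E0 Me D Tr.
move: (q _) (q _) (truncation _ _ _ _ n.+1) (truncation _ _ _ _ n) => q0 q1 r1 r0.
move: (_ / M%:R `^ alpha) (EK_defect _ _ _) (truncation_constant _ _) => er df tc E1 E0 Me D Tr.
have nrm : `|kap * kk * (r1 - r0)| <= kap * kk * `|r1 - r0|.
  by rewrite normrM ger0_norm// mulr_ge0// ltW.
have -> : t1 * q1 - t0 * q0 - t1 * ((1 + alpha / n.+1%:R) * S1 - S0) - df * (kap * phi 0) =
   (t1 * q1 - (t1 * S1 + kap * kk * r1)) - (t0 * q0 - (t0 * S0 + kap * kk * r0)) +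
   kap * kk * (r1 - r0) +
   ((t1 - t0) * S0 - alpha / n.+1%:R * t1 * S1 - df * (kap * phi 0)) by ring.
apply: le_trans (ler_normD _ _) _; apply: le_trans (lerD (ler_normD _ _) D) _.
apply: le_trans (lerD (lerD (ler_normB _ _) (le_trans nrm Tr)) (lexx _)) _.
apply: le_trans (lerD (lerD (lerD (le_trans E1 Me) (le_trans E0 Me)) (lexx _)) (lexx _)) _.
by rewrite le_eqVlt; apply/orP; left; apply/eqP; field.
Qed.

End DiscreteResidual.

(** * Fubini for the Erdelyi-Kober integral, and weighted test functions *)

Section TimeIntegralDuality.
Context {R : realType}.
Local Notation mu := (@lebesgue_measure R).
Implicit Types (T t y r : R) (v : R -> R -> R) (f g chi phi : R -> R).

Lemma L2_abs f : L2 f -> L2 (fun x => `|f x|).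
Proof.
move=> f2; apply: L2I; first exact: measurableT_comp (L2_measurable f2).
by apply: eq_integrable (L2_sqr_integrable f2) => // x _ /=; rewrite real_normK ?num_real.
Qed.

Lemma L2norm_abs f : L2 f -> L2norm (fun x => `|f x|) = L2norm f.
Proof.
move=> f2; apply/eqP; rewrite -(@eqrXn2 _ 2)// ?L2norm_ge0//.
rewrite -(L2dot_sqr f2) -(L2dot_sqr (L2_abs f2)); apply/eqP.
by apply: eq_Rintegral => x _; rewrite -normrM -expr2 ger0_norm ?sqr_ge0.
Qed.

Lemma L2_mul_abs_integral f g : L2 f -> L2 g ->
  (\int[mu]_x `|(f x * g x)%:E| <= (L2norm f * L2norm g)%:E)%E.
Proof.
move=> f2 g2; have i1 := L2_mul_integrable (L2_abs f2) (L2_abs g2).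
have -> : (\int[mu]_x `|(f x * g x)%:E| =
    (L2dot (fun x => `|f x|) (fun x => `|g x|))%:E)%E.
  rewrite /L2dot /Rintegral fineK; last exact: integrable_fin_num i1.
  by apply: eq_integral => x _; rewrite /= normrM.
rewrite lee_fin -(L2norm_abs f2) -(L2norm_abs g2); apply: le_trans (ler_norm _) _.
exact: L2_CauchySchwarz (L2_abs f2) (L2_abs g2).
Qed.

Lemma EK_kernel_measurable alpha beta :
  measurable_fun [set: R] (EK_kernel alpha beta).
Proof.
apply: measurable_funM; first exact: measurable_powR.
apply: (@measurableT_comp _ _ _ _ _ _ (fun x : R => x `^ (beta - 1))).
  exact: measurable_powR.
by apply: measurable_funB; [exact: measurable_cst|exact: measurable_powR].
Qed.

Lemma EK_integrand_measurable alpha beta T v t chi :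
  L2_family T v -> 0 < t <= T -> L2 chi ->
  measurable_fun ((`]0, 1]%classic : set (measurableTypeR R)) `*` [set: measurableTypeR R])
    (fun z : measurableTypeR R * measurableTypeR R =>
       EK_kernel alpha beta z.1 * v (z.1 * t) z.2 * chi z.2).
Proof.
move=> [mv _] /andP[t0 tT] c2; have mc := L2_measurable c2.
apply: measurable_funM; last first.
  by apply: measurable_funTS; apply: (@measurableT_comp _ _ _ _ _ _ chi).
apply: measurable_funM.
  apply: measurable_funTS; apply: (@measurableT_comp _ _ _ _ _ _ (EK_kernel alpha beta)) => //.
  exact: EK_kernel_measurable.
apply: (@measurable_comp _ _ _ _ _ _ ((`]0, T]%classic : set (measurableTypeR R)) `*` [set: measurableTypeR R])
  (fun z : measurableTypeR R * measurableTypeR R => v z.1 z.2) _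
  (fun z : measurableTypeR R * measurableTypeR R => (z.1 * t, z.2))) => //.
- by apply: measurableX => //; exact: measurable_itv.
- move=> _ [[y x] /= [yI _] <-] /=; split => //; move: yI; rewrite !in_itv/= => /andP[y0 y1].
  by rewrite mulr_gt0//= (le_trans _ tT)// ler_piMl// ltW.
- apply: measurable_funTS; apply: measurable_fun_pair => /=.
    by apply: measurable_funM => //; exact: measurable_cst.
  exact: measurable_snd.
Qed.

Lemma integrable_restrict (D : set (measurableTypeR R)) (f : measurableTypeR R -> \bar R) :
  measurable D -> mu.-integrable [set: measurableTypeR R] f -> mu.-integrable D f.
Proof. by move=> mD; exact: integrableS. Qed.

(** Fubini on (0, 1] times R: y = 0 is left out because nothing is known of [v] at time 0. By
    Cauchy-Schwarz in x, the integrability assumed for the kernel times the norm of v(y t) gives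
    integrability on the product. *)
Lemma EK_int_dot alpha beta T v t chi phi :
  L2_family T v -> 0 < t <= T -> L2 chi ->
  mu.-integrable `[0, 1] (fun y => (EK_kernel alpha beta y * L2norm (v (y * t)))%:E) ->
  L2 (EK_int alpha beta v t) ->
  (forall s, 0 < s <= T -> phi s = L2dot (v s) chi) ->
  L2dot (EK_int alpha beta v t) chi = alpha / (beta * Gamma beta) *
    \int[mu]_(y in `[0, 1]) (EK_kernel alpha beta y * phi (y * t)).
Proof.
move=> fv tT c2 iK I2 Hphi; have [t0 tT'] := andP tT.
set K := EK_kernel alpha beta in iK *; set kap := alpha / _.
have vL y : y \in `]0, 1] -> 0 < y * t <= T.
  rewrite in_itv/= => /andP[y0 y1].
  by rewrite mulr_gt0//= (le_trans _ tT')// ler_piMl// ltW.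
have K0 y : 0 <= K y by rewrite mulr_ge0 ?powR_ge0.
pose D : set (measurableTypeR R * measurableTypeR R) := `]0, 1]%classic `*` [set: R].
have mD : measurable D by apply: measurableX => //; exact: measurable_itv.
pose F (z : measurableTypeR R * measurableTypeR R) := K z.1 * v (z.1 * t) z.2 * chi z.2.
have mF : measurable_fun D F by exact: EK_integrand_measurable fv tT c2.
pose G := (EFin \o F) \_ D.
have mG : measurable_fun setT G.
  by apply/(measurable_restrictT _ _).1 => //; exact/measurable_EFinP.
have Gin (y x : R) : y \in `]0, 1] -> G (y, x) = (F (y, x))%:E.
  by move=> yI; rewrite /G patchE mem_set.
have Gout (y x : R) : y \notin `]0, 1] -> G (y, x) = 0%E.
  move=> yI; rewrite /G patchE memNset//= => -[/= yI' _].
  by move/negP: yI; apply.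
pose H := (fun y : R => (K y * L2norm (v (y * t)) * L2norm chi)%:E) \_ `[0, 1].
have iH : mu.-integrable setT H.
  rewrite -integrable_mkcond//.
  exact: (integrable_mulr (f := fun y => K y * L2norm (v (y * t))) (L2norm chi)
    (measurable_itv `[0, 1]) iK).
have GH (y : R) : (\int[mu]_x `|G (y, x)| <= H y)%E.
  have [yI|yI] := boolP (y \in `]0, 1]).
    have yI' : y \in `[0, 1].
      by move: yI; rewrite !in_itv/= => /andP[/ltW -> ->].
    rewrite /H patchE mem_set//.
    have v2 := fv.2 _ (vL y yI).
    have -> : (\int[mu]_x `|G (y, x)| = \int[mu]_x `|(K y * v (y * t) x * chi x)%:E|)%E.
      by apply: eq_integral => x _; rewrite Gin.
    have := L2_mul_abs_integral (L2Z (K y) v2) c2.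
    by rewrite L2normZ// (ger0_norm (K0 y)).
  rewrite (_ : (\int[mu]_x _)%E = 0%E).
    by rewrite /H patchE; case: ifP => // _; rewrite lee_fin; exact: (mulr_ge0 (mulr_ge0 (K0 y) (L2norm_ge0 _)) (L2norm_ge0 _)).
  by rewrite integral0_eq// => x _; rewrite Gout// abse0.
have iG : (mu \x mu)%E.-integrable setT (G : measurableTypeR R * measurableTypeR R -> \bar R).
  apply/(@integrable12ltyP _ _ (measurableTypeR R) (measurableTypeR R) R mu mu G mG).
  apply: (@le_lt_trans _ _ (\int[mu]_y `|H y|)%E).
    apply: ge0_le_integral => //.
    - by move=> y _; exact: integral_ge0.
    - have mAG : measurable_fun [set: measurableTypeR R * measurableTypeR R] (abse \o G).
        by apply: (@measurableT_comp _ _ _ _ _ _ abse).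
      exact: (@measurable_fun_fubini_tonelli_F _ _ (measurableTypeR R) (measurableTypeR R) R mu
        (abse \o G) mAG (fun=> abse_ge0 _)).
    - by apply: measurableT_comp => //; exact: measurable_int iH.
    - by move=> y _; apply: le_trans (GH y) _; exact: lee_abs.
  by have /integrableP[_] := iH.
clearbody G.
have Fub := @Fubini _ _ (measurableTypeR R) (measurableTypeR R) R mu mu G iG.
have iA := @integrable_fubini_F _ _ (measurableTypeR R) (measurableTypeR R) R mu mu G iG.
rewrite /fubini_F in iA.
have iB : mu.-integrable [set: measurableTypeR R] (fun x => \int[mu]_y G (y, x))%E.
  have mB := @measurable_fubini_G _ _ (measurableTypeR R) (measurableTypeR R) R mu mu G iG.
  have mAG : measurable_fun [set: measurableTypeR R * measurableTypeR R] (abse \o G).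
    by apply: (@measurableT_comp _ _ _ _ _ _ abse).
  have mN := @measurable_fun_fubini_tonelli_G _ _ (measurableTypeR R) (measurableTypeR R) R mu
    (abse \o G) mAG (fun=> abse_ge0 _).
  apply/integrableP; split; first exact: mB.
  have fin := (@integrable21ltyP _ _ (measurableTypeR R) (measurableTypeR R) R mu mu G mG).1 iG.
  have mBa : measurable_fun [set: measurableTypeR R] (fun x => `|\int[mu]_y G (y, x)|)%E.
    exact: (@measurableT_comp _ _ _ _ _ _ abse _ (fubini_G mu G)).
  have leB (x : measurableTypeR R) : [set: measurableTypeR R] x ->
      (`|\int[mu]_y G (y, x)| <= \int[mu]_y `|G (y, x)|)%E.
    move=> _; apply: le_abse_integral => //.
    exact: (measurable_fun_pair1 x mG).
  apply: (le_lt_trans _ fin).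
  exact: (@ge0_le_integral _ (measurableTypeR R) R mu setT measurableT
    (fun x => `|\int[mu]_y G (y, x)|)%E (fun x => \int[mu]_y `|G (y, x)|)%E
    (fun x _ => abse_ge0 _) mBa mN leB).
have Ain (y : R) : y \in `]0, 1] -> (\int[mu]_x G (y, x) = (K y * phi (y * t))%:E)%E.
  move=> yI; have v2 := fv.2 _ (vL y yI).
  rewrite (Hphi _ (vL y yI)) -L2dotZl// /L2dot /Rintegral fineK; last first.
    exact: integrable_fin_num (L2_mul_integrable (L2Z (K y) v2) c2).
  by apply: eq_integral => x _; rewrite Gin.
have Aout (y : R) : y \notin `]0, 1] -> (\int[mu]_x G (y, x) = 0)%E.
  by move=> yI; rewrite integral0_eq// => x _; rewrite Gout.
have R1 : \int[mu]_(y in `[0, 1]) (K y * phi (y * t)) = fine (\int[mu]_y \int[mu]_x G (y, x))%E.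
  rewrite -Rintegral_itv_obnd_cbnd.
    rewrite /Rintegral; congr fine; rewrite integral_mkcond; apply: eq_integral => y _.
    rewrite patchE; case: ifPn => [/set_mem/= yI|yI]; first by rewrite Ain.
    by rewrite Aout//; apply/negP => yI'; move/negP: yI; apply; exact: mem_set.
  have := integrable_restrict (measurable_itv `]0, 1]) iA.
  by apply: eq_integrable => // y /set_mem/= yI; rewrite Ain.
have R2 : L2dot (EK_int alpha beta v t) chi = fine (\int[mu]_x (kap%:E * \int[mu]_y G (y, x)))%E.
  have mL : measurable_fun [set: measurableTypeR R]
      (EFin \o (fun x => EK_int alpha beta v t x * chi x)).
    exact: (measurable_int _ (L2_mul_integrable I2 c2)).
  have mRHS : measurable_fun [set: measurableTypeR R] (fun x => kap%:E * \int[mu]_y G (y, x))%E.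
    by apply: measurable_funeM; exact: measurable_int iB.
  rewrite /L2dot /Rintegral; congr fine.
  first [apply: (ae_eq_integral measurableT mL mRHS) |
    apply: (ae_eq_integral _ measurableT mL mRHS) |
    apply: (ae_eq_integral _ _ measurableT mL mRHS)].
  have := @ae_integrable2 _ _ (measurableTypeR R) (measurableTypeR R) R mu mu G iG.
  apply: filterS => x iGx _ /=.
  (* Pulling chi(x) out of the y-integral requires the section without this factor to be integrable.
     This holds for almost every x with chi(x) nonzero, by division; where chi(x) = 0 both sides
     vanish. *)
  have [c0|c0] := eqVneq (chi x) 0.
    rewrite c0 mulr0 integral0_eq ?mule0// => y _.
    have [yI|yI] := boolP (y \in `]0, 1]); last by rewrite Gout.
    by rewrite Gin// /F c0 mulr0.
  have iKv : mu.-integrable `]0, 1] (EFin \o (fun y => K y * v (y * t) x)).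
    have i1 : mu.-integrable `]0, 1] (EFin \o (fun y => K y * v (y * t) x * chi x)).
      have := integrable_restrict (measurable_itv `]0, 1]) iGx.
      by apply: eq_integrable => // y /set_mem/= yI; rewrite Gin.
    have := integrable_mulr (chi x)^-1 (measurable_itv `]0, 1]) i1.
    by apply: eq_integrable => // y _ /=; rewrite mulfK.
  have e1 : (\int[mu]_y G (y, x) = (chi x * \int[mu]_(y in `[0, 1]) (K y * v (y * t) x))%:E)%E.
    rewrite -Rintegral_itv_obnd_cbnd// -RintegralZl// /Rintegral fineK; last first.
      apply: integrable_fin_num => //.
      exact: integrable_mull iKv.
    rewrite [RHS]integral_mkcond; apply: eq_integral => y _.
    rewrite patchE; case: ifPn => [/set_mem/= yI|yI]; first by rewrite Gin// /F mulrC.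
    by rewrite Gout//; apply/negP => yI'; move/negP: yI; apply; exact: mem_set.
  by rewrite e1 -EFinM /EK_int -/K -/kap; congr EFin; ring.
pose B (x : measurableTypeR R) := (\int[mu]_y G (y, x))%E.
have iB' : mu.-integrable [set: measurableTypeR R] B by exact: iB.
have e1 : (\int[mu]_x (kap%:E * B x) = kap%:E * \int[mu]_x B x)%E.
  by rewrite integralZl.
have e2 : (\int[mu]_x B x \is a fin_num)%E by exact: integrable_fin_num iB'.
rewrite R1 Fub -/(fine kap%:E) -(fineM _ e2)// -e1; exact: R2.
Qed.

Lemma test_powR_derive T r psi t : test_function 0%:E T%:E psi ->
  is_derive t 1 (fun x : R => x `^ r * psi x)
    (t `^ r * derive1 psi t + psi t * (r * t `^ (r - 1))).
Proof.
move=> tp; have [sp [c [d [c0 _ H]]]] := tp; rewrite lte_fin in c0.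
have [tc|tc] := ltP t c.
  have p0 x : x < c -> psi x = 0 by move=> xc; apply: H; rewrite in_itv/= leNgt xc.
  have z0 : is_derive t 1 (fun=> 0 : R) (0 : R) by exact: is_derive_cst.
  have dp0 : derive1 psi t = 0.
    rewrite derive1E; apply: derive_val; apply: near_eq_is_derive z0.
    by near=> x; rewrite p0//; near: x; exact: lt_nbhsl.
  rewrite dp0 p0// mulr0 mul0r addr0; apply: near_eq_is_derive z0.
  by near=> x; rewrite p0 ?mulr0//; near: x; exact: lt_nbhsl.
apply: is_deriveM; first exact: is_derive1_powR (lt_le_trans c0 tc).
exact: smooth_is_derive.
Unshelve. all: by end_near. Qed.

(** The power may be singular at 0, but [psi] vanishes on a neighbourhood of 0 and to the left of
    it, so the product stays smooth. *)
Lemma test_powR T r psi : test_function 0%:E T%:E psi ->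
  test_function 0%:E T%:E (fun x : R => x `^ r * psi x).
Proof.
move=> tp; have [_ [c [d [c0 dT H]]]] := tp; split; last first.
  by exists c, d; split => // x /H ->; rewrite mulr0.
apply/smoothP => n; elim: n r psi tp {c d c0 dT H} => //= n IH r psi tp.
exists (fun t => t `^ r * derive1 psi t + psi t * (r * t `^ (r - 1))).
  by move=> t; exact: test_powR_derive tp.
apply: diffnD; first exact: IH (test_derive1 tp).
have -> : (fun t => psi t * (r * t `^ (r - 1))) = (fun t => r * (t `^ (r - 1) * psi t)).
  by apply/funext => t; ring.
by apply: diffnM; [exact: diffn_cst|exact: IH].
Qed.

End TimeIntegralDuality.

(** * The weak equation integrated in time *)

Section IntegratedEquation.
Context {R : realType}.
Local Notation mu := (@lebesgue_measure R).
Implicit Types (phi chi chix psi : R -> R) (s t c e L T : R).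

Variables (alpha beta T : R) (u0 : R -> R) (u ut ux : R -> R -> R).
Hypotheses (alpha01 : 0 < alpha < 1) (beta01 : 0 < beta < 1) (T0 : 0 < T).
Hypothesis sol : weak_solution alpha beta T u0 u ut ux.
Variables (chi chix phi : R -> R) (L B : R).
Hypothesis Hchi : H1_deriv chi chix.
Hypothesis L0 : 0 <= L.
Hypothesis Hphi : forall s t, 0 <= s -> s <= t -> t <= T ->
  `|phi t - phi s| <= L * (t `^ alpha - s `^ alpha).
Hypothesis phiE : forall s, 0 < s <= T -> phi s = L2dot (ux s) chix.
Hypothesis ut_bound : forall t, 0 < t <= T -> t `^ (1 - alpha) * L2norm (ut t) <= B.
Let alpha0 : 0 < alpha. Proof. by case/andP: alpha01. Qed.
Let beta0 : 0 < beta. Proof. by case/andP: beta01. Qed.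
Local Notation K := (EK_kernel alpha beta).
Local Notation kap := (EK_constant beta).
Let kap0 : 0 < kap. Proof. exact: EK_constant_gt0. Qed.

Let chi2 : L2 chi. Proof. by case: Hchi. Qed.
Let chix2 : L2 chix. Proof. by case: Hchi. Qed.

(** For t > 0 this is (I u_x(t), chi_x) by [EK_int_dot]; writing it through [phi] gives it a value
    at t = 0 and Hoelder continuity up to there. *)
Definition EK_dual t := alpha * kap * \int[mu]_(y in `[0, 1]) (K y * phi (y * t)).
Local Notation q := EK_dual.
Let p t := L2dot (u t) chi.
Let w t := p t + t `^ alpha * q t.

Let q_hoelder s t : 0 <= s -> s <= t -> t <= T ->
  `|q t - q s| <= kap * L * (t `^ alpha - s `^ alpha).
Proof.
move=> s0 st tT; rewrite /q -mulrBr normrM ger0_norm ?mulr_ge0 ?(ltW alpha0) ?(ltW kap0)//.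
have ak : 0 <= alpha * kap by rewrite mulr_ge0 ?(ltW alpha0) ?(ltW kap0).
apply: le_trans (ler_wpM2l ak (EK_integral_increment alpha01 beta01 L0 Hphi s0 st tT)) _.
by rewrite le_eqVlt; apply/orP; left; apply/eqP; field; rewrite gt_eqF.
Qed.

Let q_continuous : {within `[0, T], continuous q}.
Proof.
apply: (hoelder_continuous_within alpha0 _ q_hoelder).
by rewrite mulr_ge0// ltW.
Qed.

Let p_continuous : {within `[0, T], continuous p}.
Proof. exact: continuous_L2_dot (ws_continuous sol) chi2. Qed.

Let tq_continuous : {within `[0, T], continuous (fun t => t `^ alpha * q t)}.
Proof.
by move=> t; apply: cvgM; [exact: powR_continuous_within|exact: q_continuous].
Qed.

Let w_continuous : {within `[0, T], continuous w}.
Proof. by move=> t; apply: cvgD; [exact: p_continuous|exact: tq_continuous]. Qed.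

Let integrable_test_mul psi g : continuous psi -> {within `[0, T], continuous g} ->
  mu.-integrable `[0, T] (EFin \o (fun t => psi t * g t)).
Proof.
move=> cpsi cg; apply: continuous_compact_integrable; first exact: segment_compact.
have cw : {within `[0, T], continuous psi} by exact: continuous_subspaceT.
by move=> t; apply: cvgM; [exact: cw|exact: cg].
Qed.

(** The weak derivative of w = (u, chi) + t^alpha q vanishes: the right-hand side of the equation is
    minus alpha t^(alpha - 1) q + t^alpha q', which is the derivative of t^alpha q. *)
Let weak_identity psi c e : 0 < c -> c <= e -> e <= T -> test_function 0%:E T%:E psi ->
  (forall x, `|psi x| <= 1) -> (forall x, x \notin `[c, e] -> psi x = 0) ->
  \int[mu]_(x in `[0, T]) (derive1 psi x * w x) = 0.
Proof.
move=> c0 ce eT tpsi psi1 psi0.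
have [Dux [fux iux [dI [I1 dI1 HI] Dux_eq]] Heq] := ws_equation sol.
have [fI _] := I1; have [fdI _] := dI1.
have [_ ut1 Hut] := ws_dt sol; have [fut _] := ut1.
have psi00 : psi 0 = 0 by apply: psi0; rewrite in_itv/= leNgt c0.
have cpsi' : continuous (derive1 psi) := test_continuous (test_derive1 tpsi).
(* The weights go into the test function, so that the weak derivative of [EK_int] can be tested with
   t^alpha psi. *)
pose P1 t := t `^ alpha * psi t; pose P2 t := t `^ (alpha - 1) * psi t.
have tP1 : test_function 0%:E T%:E P1 by exact: test_powR.
have tP2 : test_function 0%:E T%:E P2 by exact: test_powR.
have dP1 t : derive1 P1 t = t `^ alpha * derive1 psi t + psi t * (alpha * t `^ (alpha - 1)).
  by rewrite derive1E; apply: derive_val; exact: test_powR_derive tpsi.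
pose F t := L2dot (ut t) chi; pose Q t := L2dot (EK_int alpha beta ux t) chix.
pose dQ t := L2dot (dI t) chix.
have QE t : 0 < t <= T -> Q t = q t.
  move=> tT; rewrite /Q (EK_int_dot fux tT chix2 (iux t tT) (fI.2 t tT) phiE).
  by rewrite -/K /EK_dual /EK_constant.
have FE t : 0 < t <= T -> F t = - (alpha * t `^ (alpha - 1) * q t + t `^ alpha * dQ t).
  move=> tT; have [t0 _] := andP tT; rewrite /F (Heq t chi chix tT Hchi).
  have I2 := fI.2 t tT; have dI2 := fdI.2 t tT.
  have -> : Dux t = (fun x => beta * EK_int alpha beta ux t x + beta / alpha * t * dI t x).
    by apply/funext => x; exact: Dux_eq.
  rewrite L2dotDl; [|exact: L2Z|exact: L2Z|by []].
  rewrite L2dotZl// L2dotZl// -/(Q t) -/(dQ t) QE//.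
  rewrite [in RHS](powR_succ alpha t0); move: (t `^ (alpha - 1)) (q t) (dQ t) => x1 x2 x3.
  by field; rewrite !gt_eqF.
pose A1 t := derive1 psi t * p t.
pose A2 t := derive1 psi t * (t `^ alpha * q t).
pose A3 t := alpha * P2 t * q t.
pose A4 t := P1 t * dQ t.
pose A5 t := psi t * F t.
have i1 : mu.-integrable `[0, T] (EFin \o A1) by exact: integrable_test_mul.
have i2 : mu.-integrable `[0, T] (EFin \o A2) by exact: integrable_test_mul.
have i3 : mu.-integrable `[0, T] (EFin \o A3).
  apply: integrable_test_mul => // t; apply: cvgM; first exact: cvg_cst.
  exact: (test_continuous tP2).
have i5 : mu.-integrable `[0, T] (EFin \o A5).
  have Bc0 : 0 <= B / c `^ (1 - alpha) * L2norm chi.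
    have cT : 0 < c <= T by rewrite c0 (le_trans ce).
    rewrite mulr_ge0 ?L2norm_ge0// divr_ge0 ?powR_ge0//.
    by apply: le_trans (ut_bound cT); rewrite mulr_ge0 ?powR_ge0 ?L2norm_ge0.
  apply: (proj1 (@Rintegral_bound R A5 T c e (B / c `^ (1 - alpha) * L2norm chi) c0 ce eT _ _ _)).
  - apply: measurable_funM; first by apply: measurable_funTS; exact: test_measurable tpsi.
    exact: L2dot_family_measurable fut chi2.
  - move=> t; rewrite in_itv/= => /andP[ct te].
    have t0 := lt_le_trans c0 ct; have tT : 0 < t <= T by rewrite t0 (le_trans te).
    rewrite normrM -[leRHS]mul1r; apply: ler_pM => //.
    apply: le_trans (L2_CauchySchwarz (fut.2 t tT) chi2) _.
    rewrite ler_wpM2r ?L2norm_ge0//.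
    rewrite ler_pdivlMr ?powR_gt0// mulrC; apply: le_trans (ut_bound tT).
    rewrite ler_wpM2r ?L2norm_ge0//.
    by rewrite ge0_ler_powR ?nnegrE ?subr_ge0 ?(ltW t0) ?(ltW c0)// ltW//; case/andP: alpha01.
  - by move=> t /psi0 pt; rewrite /A5 pt mul0r.
have A5E t : t \in `[0, T] -> A5 t = - A3 t - A4 t.
  rewrite in_itv/= => /andP[]; rewrite le_eqVlt => /predU1P[<- _|t0 tT].
    by rewrite /A5 /A3 /A4 /P1 /P2 psi00 !(mulr0, mul0r, oppr0, addr0).
  rewrite /A5 FE ?t0// /A3 /A4 /P1 /P2.
  by move: (psi t) (q t) (dQ t) (t `^ alpha) (t `^ (alpha - 1)) => *; ring.
(* The equation gives integrability of [A4] from that of [A3] and [A5], the latter being controlled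
   by the bound on u_t. *)
have A4E t : t \in `[0, T] -> A4 t = - A3 t - A5 t.
  by move=> /A5E ->; move: (A3 t) (A4 t) => *; ring.
have i3' : mu.-integrable `[0, T] (EFin \o (fun t => - A3 t)).
  have := integrable_mull (-1) (measurable_itv `[0, T]) i3.
  by apply: eq_integrable => // t _ /=; rewrite mulN1r.
have i4 : mu.-integrable `[0, T] (EFin \o A4).
  have := integrable_subr (measurable_itv `[0, T]) i3' i5.
  by apply: eq_integrable => // t /set_mem tT /=; rewrite A4E.
have E1 : \int[mu]_(x in `[0, T]) A1 x = - \int[mu]_(x in `[0, T]) A5 x.
  exact: Hut tpsi chi2.
have E2 : \int[mu]_(x in `[0, T]) A2 x + \int[mu]_(x in `[0, T]) A3 x =
    - \int[mu]_(x in `[0, T]) A4 x.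
  rewrite -[RHS](HI P1 chix tP1 chix2) -RintegralD//; apply: eq_Rintegral => t /set_mem/=.
  rewrite in_itv/= => /andP[]; rewrite le_eqVlt => /predU1P[<- _|t0 tT].
    rewrite dP1 /A2 /A3 /P2 psi00 powR0 ?gt_eqF// !mul0r !mulr0 mul0r.
    by rewrite !addr0 mul0r.
  rewrite -/(Q t) QE ?t0// dP1 /A2 /A3 /P2.
  by move: (psi t) (derive1 psi t) (q t) (t `^ alpha) (t `^ (alpha - 1)) => *; ring.
have E3 : \int[mu]_(x in `[0, T]) A5 x =
    - (\int[mu]_(x in `[0, T]) A3 x) - \int[mu]_(x in `[0, T]) A4 x.
  have -> : - (\int[mu]_(x in `[0, T]) A3 x) = \int[mu]_(x in `[0, T]) (- A3 x).
    rewrite -mulN1r -RintegralZl//; apply: eq_Rintegral => t _; by rewrite mulN1r.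
  by rewrite -RintegralB//; apply: eq_Rintegral => t /set_mem/= tT; exact: A5E.
have -> : \int[mu]_(x in `[0, T]) (derive1 psi x * w x) =
    \int[mu]_(x in `[0, T]) A1 x + \int[mu]_(x in `[0, T]) A2 x.
  by rewrite -RintegralD//; apply: eq_Rintegral => t _; rewrite /w /A1 /A2 mulrDr.
move: E1 E2 E3; move: (\int[mu]_(x in _) A1 x) (\int[mu]_(x in _) A2 x).
move: (\int[mu]_(x in _) A3 x) (\int[mu]_(x in _) A4 x) (\int[mu]_(x in _) A5 x).
move=> r r0 r1 r2 r3 -> e2 ->.
have -> : r3 = - r0 - r by rewrite -e2 addrK.
by ring.
Qed.

Let w_constant s t : 0 < s -> s <= t -> t < T -> w t = w s.
Proof.
move=> s0 st tT; apply/eqP; rewrite -subr_eq0 -normr_le0 -(mul0r (t - s)).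
have d1 : 0 < Num.min s (T - t) by rewrite lt_min s0 subr_gt0.
apply: (weak_increment s0 st tT (lexx 0) d1 w_continuous) => psi d.
rewrite lt_min => /andP[d0 /andP[ds dT]] tpsi psi1 psi0.
rewrite mul0r (weak_identity (c := s - d) (e := t + d)) ?normr0 ?subr_gt0//.
  by apply: le_trans (_ : s <= _); rewrite ?gerBl ?(ltW d0)// (le_trans st)// lerDl ltW.
by rewrite -lerBrDl ltW.
Qed.

(** [w] is constant on (0, T), by [weak_increment] with M = 0, and up to both endpoints by
    continuity; at t = 0 the power t^alpha removes the second term. *)
Lemma weak_solution_integrated t : 0 <= t -> t <= T ->
  L2dot (u t) chi + t `^ alpha * EK_dual t = L2dot (u 0) chi.
Proof.
move=> t0 tT; have h0 : 0 < T / 2 by rewrite divr_gt0.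
have hT : T / 2 < T by rewrite ltr_pdivrMr// ltr_pMr// ltr1n.
have mid s : 0 < s -> s < T -> w s = w (T / 2).
  move=> s0 sT; have [sh|/ltW hs] := leP s (T / 2); first exact/esym/w_constant.
  exact: w_constant.
have w0 : w 0 = w (T / 2).
  apply/eqP; rewrite eq_sym -subr_eq0 -normr_le0.
  apply: (@within_le_left R w (fun=> 0) T _ (T / 2) h0 (ltW hT) w_continuous).
    exact: cvg_cst.
  by move=> s s0 sh; rewrite mid ?subrr ?normr0// (le_lt_trans sh).
have wT : w T = w (T / 2).
  apply/eqP; rewrite -subr_eq0 -normr_le0.
  apply: (@within_le_right R w (fun=> 0) T _ (T / 2) hT (ltW h0) w_continuous).
    exact: cst_continuous.
  by move=> s sh sT; rewrite mid ?subrr ?normr0// (lt_le_trans h0).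
have wt : w t = w 0.
  move: t0 tT; rewrite le_eqVlt => /predU1P[<-//|t0].
  rewrite le_eqVlt => /predU1P[->|tT]; first by rewrite wT w0.
  by rewrite mid// w0.
have -> : L2dot (u t) chi + t `^ alpha * EK_dual t = w t by [].
by rewrite wt /w powR0 ?gt_eqF// mul0r addr0.
Qed.

End IntegratedEquation.

(** * Energy argument and conclusion *)

Section Convergence.
Context {R : realType}.
Local Notation mu := (@lebesgue_measure R).
Implicit Types (x y z c e h A B : R) (n m i N : nat).

Lemma sum_powR_pred alpha N : 0 < alpha < 1 ->
  \sum_(n < N) n.+1%:R `^ (alpha - 1) <= N%:R `^ alpha / alpha :> R.
Proof.
move=> /andP[a0 a1]; rewrite ler_pdivlMr// mulrC.
elim: N => [|N IH]; first by rewrite big_ord0 mulr0 powR_ge0.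
rewrite big_ord_recr/= mulrDr; apply: le_trans (lerD IH (lexx _)) _.
have a01 : 0 <= alpha <= 1 by rewrite !ltW.
have := powR_sub_ge a01 (ler0n R N) (ltr0Sn R N).
have -> : N.+1%:R - N%:R = 1 :> R by rewrite -natr1 addrC addKr.
by rewrite mulr1 lerBrDl.
Qed.

(** At an index where the bound fails, strong induction puts all earlier values below z(n), so M =
    z(n) is admissible. As h <= z(n), this gives z(n)^2 <= (A + B) h z(n), against the failure. *)
Lemma quadratic_bootstrap (z : nat -> R) A B h N : 0 <= A -> 0 <= B -> 0 <= h ->
  (forall n, 0 <= z n) ->
  (forall n M, (n <= N)%N -> (forall m, (m <= n)%N -> z m <= M) ->
    z n ^+ 2 <= A * h ^+ 2 + B * h * M) ->
  forall n, (n <= N)%N -> z n <= (A + B + 1) * h.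
Proof.
move=> A0 B0 h0 z0 H n.
have [m] := ubnP n; elim: m n => // m IH n nm nN.
have [//|zn] := leP (z n) ((A + B + 1) * h).
have zm i : (i <= n)%N -> z i <= z n.
  rewrite leq_eqVlt => /predU1P[->//|i_n].
  apply: le_trans (ltW zn); apply: IH; first exact: leq_trans i_n nm.
  exact: leq_trans (ltnW i_n) nN.
have := H n (z n) nN zm.
have hz : h <= z n.
  apply: le_trans (ltW zn); rewrite -[leLHS]mul1r ler_wpM2r//.
  by rewrite lerDr addr_ge0.
have zn0 : 0 < z n by apply: le_lt_trans zn; rewrite mulr_ge0// !addr_ge0.
have e1 : A * h ^+ 2 <= A * h * z n by rewrite expr2 mulrA ler_wpM2l// mulr_ge0.
have e2 : (A + B) * h * z n < z n ^+ 2.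
  rewrite expr2 ltr_pM2r//; apply: le_lt_trans zn; rewrite ler_wpM2r//.
  by rewrite lerDl.
move=> e3; move: (lt_le_trans e2 e3).
rewrite mulrDl mulrDl ltrD2r => e4.
by have := lt_le_trans e4 e1; rewrite ltxx.
Qed.

Let young c x y z : 0 < c -> 0 <= z -> 0 <= x ->
  y * x * z <= c / 2 * x ^+ 2 * z + y ^+ 2 / (2 * c) * z.
Proof.
move=> c0 z0 x0; rewrite -mulrDl ler_wpM2r// -subr_ge0.
have -> : c / 2 * x ^+ 2 + y ^+ 2 / (2 * c) - y * x = (c * x - y) ^+ 2 / (2 * c).
  by field; rewrite gt_eqF.
by rewrite divr_ge0 ?sqr_ge0// mulr_ge0// ltW.
Qed.

Lemma L2dot_polarization (f g : R -> R) : L2 f -> L2 g ->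
  L2dot f g + L2dot f g <= L2dot f f + L2dot g g.
Proof.
move=> f2 g2; have := L2dot_ge0 (fun x => f x - g x).
rewrite L2dotBl ?L2dotBr//; last exact: L2B.
by rewrite (L2dotC g f); move: (L2dot f g) (L2dot f f) (L2dot g g) => *; lra.
Qed.

Lemma L2dot_sum n (c : nat -> R) (W : nat -> R -> R) (v : R -> R) : L2 v ->
  (forall i, (i < n)%N -> L2 (W i)) ->
  L2 (fun x => \sum_(i < n) c i * W i x) /\
  L2dot (fun x => \sum_(i < n) c i * W i x) v = \sum_(i < n) c i * L2dot (W i) v.
Proof.
move=> v2; elim: n => [_|n IH W2].
  have -> : (fun x => \sum_(i < 0) c i * W i x) = (fun=> 0).
    by apply/funext => x; rewrite big_ord0.
  split; first exact: L2_0.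
  rewrite big_ord0; apply/eqP; rewrite -normr_le0.
  by apply: le_trans (L2_CauchySchwarz L2_0 v2) _; rewrite L2norm0 mul0r.
have [I1 I2] := IH (fun i i_n => W2 i (ltnW i_n)); have Wn := W2 n (ltnSn n).
have -> : (fun x => \sum_(i < n.+1) c i * W i x) =
    (fun x => \sum_(i < n) c i * W i x + c n * W n x).
  by apply/funext => x; rewrite big_ord_recr.
have cW := L2Z (c n) Wn; split; first exact: L2D.
by rewrite (L2dotDl I1 cW v2) I2 (L2dotZl _ Wn v2) big_ord_recr.
Qed.

Let residual_identity (x1 x0 y1 y0 z : R) (t1 t0 q1 q0 b1 b0 f1 f0 : R) c e :
  y1 + t1 * q1 = z -> y0 + t0 * q0 = z ->
  x1 - x0 = - (t1 * (c * (b1 + f1) - (b0 + f0))) ->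
  x1 - y1 - (x0 - y0) + t1 * (c * b1 - b0) =
  (t1 * q1 - t0 * q0 - t1 * (c * f1 - f0) - e) + e.
Proof.
move=> h1 h2 h3.
have -> : x1 = x0 + (x1 - x0) by rewrite addrC subrK.
have -> : y1 = z - t1 * q1 by rewrite -h1 addrK.
have -> : y0 = z - t0 * q0 by rewrite -h2 addrK.
by rewrite h3; ring.
Qed.

Let energy_balance (x s q p y d w v g : R) : x <= s -> p <= q -> s + q <= y + d ->
  y <= p + w -> w <= v -> d <= g -> x <= v + g.
Proof. by move=> *; lra. Qed.

Let half_le x y z : x / 2 <= y -> 2 * y <= z -> x <= z.
Proof. by move=> *; lra. Qed.

Section Problem.
Variables (alpha beta T : R) (u0 : R -> R) (u ut utt ux utx uttx : R -> R -> R) (C : R).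
Hypotheses (alpha01 : 0 < alpha < 1) (beta01 : 0 < beta < 1) (T0 : 0 < T).
Hypothesis Hu0 : H2 u0.
Hypothesis sol : weak_solution alpha beta T u0 u ut ux.
Hypothesis dtut : weak_dt T ut utt.
Hypothesis Hx : forall t, 0 < t <= T ->
  H1_deriv (ut t) (utx t) /\ H1_deriv (utt t) (uttx t).
Hypothesis bound0 : forall t, 0 < t <= T ->
  L2norm (u t) + t `^ (1 - alpha) * L2norm (ut t)
    + t `^ (2 - alpha) * L2norm (utt t) <= C.
Hypothesis bound1 : forall t, 0 < t <= T ->
  L2norm (ux t) + t `^ (1 - alpha) * L2norm (utx t)
    + t `^ (2 - alpha) * L2norm (uttx t) <= C.
Let alpha0 : 0 < alpha. Proof. by case/andP: alpha01. Qed.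
Let beta0 : 0 < beta. Proof. by case/andP: beta01. Qed.
Local Notation kap := (EK_constant beta).
Let kap0 : 0 < kap. Proof. exact: EK_constant_gt0. Qed.

Let weighted_le x y z : 0 <= x -> 0 <= y -> 0 <= z -> x + y + z <= C ->
  [/\ y <= C, z <= C & 0 <= C].
Proof.
move=> x0 y0 z0 H; have xy := addr_ge0 x0 y0; split.
- by apply: le_trans H; rewrite -addrA addrCA lerDl addr_ge0.
- by apply: le_trans H; rewrite lerDr.
- by apply: le_trans H; rewrite addr_ge0.
Qed.

Let ut_bound t : 0 < t <= T -> t `^ (1 - alpha) * L2norm (ut t) <= C.
Proof.
by move=> /bound0 H; have [] := weighted_le _ _ _ H; rewrite ?mulr_ge0 ?powR_ge0 ?L2norm_ge0.
Qed.

Let utx_bound t : 0 < t <= T -> t `^ (1 - alpha) * L2norm (utx t) <= C.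
Proof.
by move=> /bound1 H; have [] := weighted_le _ _ _ H; rewrite ?mulr_ge0 ?powR_ge0 ?L2norm_ge0.
Qed.

Let uttx_bound t : 0 < t <= T -> t `^ (2 - alpha) * L2norm (uttx t) <= C.
Proof.
by move=> /bound1 H; have [] := weighted_le _ _ _ H; rewrite ?mulr_ge0 ?powR_ge0 ?L2norm_ge0.
Qed.

Let C0 : 0 <= C.
Proof.
have TT : 0 < T <= T by rewrite T0 lexx.
have [] := weighted_le _ _ _ (bound1 TT); rewrite ?mulr_ge0 ?powR_ge0 ?L2norm_ge0//.
Qed.

Lemma discrete_error_bound : exists2 D, 0 <= D &
  forall k (U Ux : nat -> R -> R), 0 < k ->
    discrete_solution alpha beta T k (u 0) U Ux ->
    forall n, n%:R * k <= T -> L2norm (fun x => U n x - u (n%:R * k) x) <= D * k `^ alpha.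
Proof.
have [u0x [u0xx [Hu1 Hu2]]] := Hu0.
have [cu u2] := (ws_continuous sol, (ws_continuous sol).1).
have u02 : L2 (u 0) by apply: u2; rewrite lexx ltW.
have Hu0' : H1_deriv (u 0) u0x.
  apply: ae_eq_H1 Hu1 => //; have := ws_initial sol.
  by apply: filterS; [exact: (ae_filter_ringOfSetsType mu)|move=> x H y; rewrite H].
(* [ux] is not prescribed at t = 0; the weak derivative of u_0 is put there, so that the Hoelder
   bound holds from s = 0 on. *)
pose vx t := if t == 0 then u0x else ux t.
have vxE t : 0 < t -> vx t = ux t by move=> t0; rewrite /vx gt_eqF.
have vx0 : vx 0 = u0x by rewrite /vx eqxx.
have Hvx t : 0 <= t <= T -> H1_deriv (u t) (vx t).
  move=> /andP[]; rewrite le_eqVlt => /predU1P[<- _|t0 tT]; first by rewrite vx0.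
  by rewrite vxE//; apply: (ws_dx sol); rewrite t0.
have [K K0 HK] := space_derivative_regularity alpha01 T0 C0 cu (ws_dt sol) dtut Hx
  utx_bound uttx_bound Hvx.
(* [P] is the constant of the residual. [A] is the Young remainder P^2 / (2 kap alpha) times T^alpha
   / alpha, and [Bc] the defect sum 2 alpha times [kap] |u0xx|, both doubled because the energy is
   half of the squared error. *)
pose P := kap * K * residual_constant alpha beta.
pose A := P ^+ 2 / (kap * alpha) / alpha * T `^ alpha.
pose Bc := 4 * kap * alpha * L2norm u0xx.
have A0 : 0 <= A.
  by rewrite mulr_ge0 ?powR_ge0// !divr_ge0 ?sqr_ge0 ?mulr_ge0 ?(ltW alpha0) ?(ltW kap0).
have Bc0 : 0 <= Bc by rewrite !mulr_ge0 ?L2norm_ge0 ?(ltW alpha0) ?(ltW kap0).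
exists (A + Bc + 1); first by rewrite !addr_ge0.
move=> k U Ux k0 dsol N NT; have k0' := ltW k0.
have nT n : (n <= N)%N -> 0 <= n%:R * k <= T.
  by move=> nN; rewrite mulr_ge0//= (le_trans _ NT)// ler_wpM2r// ler_nat.
pose e n x := U n x - u (n%:R * k) x.
pose V n x := Ux n x - vx (n%:R * k) x.
have He n : (n <= N)%N -> H1_deriv (e n) (V n).
  move=> nN; apply: H1B; last exact: Hvx (nT n nN).
  by apply: (ds_dx dsol); have /andP[] := nT n nN.
have e2 n : (n <= N)%N -> L2 (e n) by move=> /He[].
have V2 n : (n <= N)%N -> L2 (V n) by move=> /He[].
have U2 n : (n <= N)%N -> L2 (U n).
  by move=> nN; have /andP[_ /(ds_dx dsol)[]] := nT n nN.
have Ux2 n : (n <= N)%N -> L2 (Ux n).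
  by move=> nN; have /andP[_ /(ds_dx dsol)[]] := nT n nN.
have vx2 n : (n <= N)%N -> L2 (vx (n%:R * k)) by move=> /nT/Hvx[].
have uk2 n : (n <= N)%N -> L2 (u (n%:R * k)) by move=> /nT/u2.
pose z n := L2norm (e n).
have z0 n : 0 <= z n by exact: L2norm_ge0.
have e00 : z 0%N = 0.
  rewrite /z -L2norm0; apply: ae_eq_L2norm; [exact: e2|exact: L2_0|].
  have := ds_initial dsol; apply: filterS; first exact: (ae_filter_ringOfSetsType mu).
  by move=> x H y; rewrite /e mul0r H// subrr.
pose bb i j := L2dot (V i) (V j).
pose S n f := EK_sum alpha beta n f.
have EKdot n v : (n <= N)%N -> L2 v -> forall W : nat -> R -> R,
    (forall i, (i <= N)%N -> L2 (W i)) ->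
    L2 (fun x => \sum_(1 <= i < n.+1) EK_coef alpha beta n i * W i x) /\
    L2dot (fun x => \sum_(1 <= i < n.+1) EK_coef alpha beta n i * W i x) v =
      S n (fun i => L2dot (W i) v).
  move=> nN v2 W W2; rewrite /S /EK_sum.
  have -> : (fun x => \sum_(1 <= i < n.+1) EK_coef alpha beta n i * W i x) =
      (fun x => \sum_(i < n) EK_coef alpha beta n i.+1 * W i.+1 x).
    by apply/funext => x; rewrite big_add1/= big_mkord.
  apply: (@L2dot_sum n (fun i => EK_coef alpha beta n i.+1) (fun i => W i.+1) v v2) => i i_n; apply: W2; exact: leq_trans nN.
(* One step tested with chi = e_(n+1): the increment of the integrated identity is subtracted from
   the scheme, which leaves the residual of the exact solution on the right. *)
have step n : (n < N)%N ->
    L2dot (e n.+1) (e n.+1) - L2dot (e n) (e n.+1) +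
    (n.+1%:R * k) `^ alpha * ((1 + alpha / n.+1%:R) * S n.+1 (fun i => bb i n.+1) -
      S n (fun i => bb i n.+1)) <=
    P * L2norm (V n.+1) * (k `^ alpha * k `^ alpha) * n.+1%:R `^ (alpha - 1) +
    `|EK_defect alpha k n.+1| * (kap * L2norm u0xx * z n.+1).
  move=> nN; have n1N := nN; have nN' := ltnW nN.
  pose v := V n.+1; have v2 : L2 v := V2 _ n1N; have ee := e2 _ n1N.
  have t1T := nT _ n1N; have /andP[t10 t1T'] := t1T.
  have tp : 0 < n.+1%:R * k by rewrite mulr_gt0// ltr0n.
  pose phi t := L2dot (vx t) v.
  have [phi1 phi2] := HK v v2.
  have KL0 : 0 <= K * L2norm v by rewrite mulr_ge0 ?L2norm_ge0.
  have phiE s : 0 < s <= T -> phi s = L2dot (ux s) v.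
    by move=> /andP[s0 _]; rewrite /phi vxE.
  have res := EK_residual alpha01 beta01 KL0 T0 phi1 phi2 k0 t1T'.
  have int t (t0 : 0 <= t) (tT : t <= T) := weak_solution_integrated alpha01 beta01 T0 sol
    (He _ n1N) KL0 phi1 phiE ut_bound t0 tT.
  have i1 := int _ t10 t1T'; have /andP[t00 t0T] := nT _ nN'.
  have i0 := int _ t00 t0T.
  have [SU1 dSU1] := EKdot n.+1 v n1N v2 Ux Ux2.
  have [SU0 dSU0] := EKdot n v nN' v2 Ux Ux2.
  have deq := ds_equation dsol (ltn0Sn n) t1T' (He _ n1N).
  have dl : L2dot (fun x => (U n.+1 x - U n x) / k) (e n.+1) =
      k^-1 * (L2dot (U n.+1) (e n.+1) - L2dot (U n) (e n.+1)).
    rewrite -L2dotBl ?L2dotZl//; [|exact: U2..].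
    rewrite -L2dotZl//; last by apply: L2B; exact: U2.
    by congr L2dot; apply/funext => x; rewrite mulrC.
  have dr : L2dot (EK_discrete alpha beta k Ux n.+1) v =
      beta * S n.+1 (fun i => L2dot (Ux i) v) + beta / alpha * (n.+1%:R * k / k) *
      (S n.+1 (fun i => L2dot (Ux i) v) - S n (fun i => L2dot (Ux i) v)).
    rewrite -dSU1 -dSU0 /EK_discrete.
    rewrite L2dotDl; [|exact: L2Z|by apply: L2Z; exact: L2B|by []].
    by rewrite L2dotZl// L2dotZl ?L2dotBl//; exact: L2B.
  rewrite dl dr in deq.
  have SD m : (m <= n.+1)%N -> S m (fun i => L2dot (Ux i) v) =
      S m (fun i => bb i n.+1) + S m (fun i => phi (i%:R * k)).
    move=> mn; rewrite /S -EK_sumD; apply: eq_bigr => i _; congr (_ * _).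
    have iN : (i.+1 <= N)%N by apply: leq_trans n1N; apply: leq_trans mn; exact: ltn_ord.
    by rewrite /bb /phi -/v L2dotBl ?subrK//; [exact: Ux2|exact: vx2].
  rewrite (SD n.+1)// (SD n)// in deq.
  have dU : L2dot (U n.+1) (e n.+1) - L2dot (U n) (e n.+1) =
      - ((n.+1%:R * k) `^ alpha * ((1 + alpha / n.+1%:R) *
        (S n.+1 (fun i => bb i n.+1) + S n.+1 (fun i => phi (i%:R * k))) -
        (S n (fun i => bb i n.+1) + S n (fun i => phi (i%:R * k))))).
    have kn : k != 0 by rewrite gt_eqF.
    have nn : n.+1%:R != 0 :> R by rewrite pnatr_eq0.
    have an : alpha != 0 by rewrite gt_eqF.
    have bn : beta != 0 by rewrite gt_eqF.
    rewrite -[LHS](mulVKf kn) deq [in RHS](powR_succ alpha tp).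
    move: ((n.+1%:R * k) `^ (alpha - 1)) => tt.
    move: (S n.+1 _) (S n.+1 _) (S n _) (S n _) => s1 s2 s3 s4.
    move: (n.+1%:R) nn => x xn.
    by field; rewrite ?kn ?xn ?an ?bn.
  have eE m : (m <= N)%N -> L2dot (e m) (e n.+1) =
      L2dot (U m) (e n.+1) - L2dot (u (m%:R * k)) (e n.+1).
    by move=> mN; rewrite -L2dotBl//; [exact: U2|exact: uk2].
  rewrite (eE n.+1)// (eE n)//.
  (* Here u_0 in H^2 enters: the defect gets paired with the error itself and not with its
     x-derivative. *)
  have phi00 : phi 0 = - L2dot u0xx (e n.+1).
    by rewrite /phi vx0 (H1_integration_by_parts Hu2 (He _ n1N)) opprK.
  have p0 : `|phi 0| <= L2norm u0xx * z n.+1.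
    rewrite phi00 normrN; apply: L2_CauchySchwarz => //; by case: Hu2.
  move: res i1 i0 dU.
  rewrite /EK_dual -/(S n.+1 _) -/(S n _).
  set q1 := alpha * kap * \int[mu]_(y in `[0, 1]) (_ * phi (y * (n.+1%:R * k))).
  set q0 := alpha * kap * \int[mu]_(y in `[0, 1]) (_ * phi (y * (n%:R * k))).
  move=> res i1 i0 dU.
  have key := residual_identity (EK_defect alpha k n.+1 * (kap * phi 0)) i1 i0 dU.
  rewrite key; apply: lerD.
    apply: le_trans (ler_norm _) _; apply: le_trans res _.
    by rewrite le_eqVlt; apply/orP; left; apply/eqP; rewrite /P -/v; ring.
  apply: le_trans (ler_norm _) _; rewrite normrM ler_wpM2l// normrM (ger0_norm (ltW kap0)).
  by rewrite -mulrA ler_wpM2l// ltW.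
have ka0 : 0 < k `^ alpha by rewrite powR_gt0.
have energy n M : (n <= N)%N -> (forall m, (m <= n)%N -> z m <= M) ->
    z n ^+ 2 <= A * (k `^ alpha) ^+ 2 + Bc * k `^ alpha * M.
  move=> nN HM; have M0 : 0 <= M by apply: le_trans (HM 0%N (leq0n _)); rewrite e00.
  pose X m := L2norm (V m).
  (* By polarization each term is at least half the increment of the squared error, and e_0 = 0. *)
  have tele m : (m <= n)%N -> z m ^+ 2 / 2 <=
      \sum_(i < m) (L2dot (e i.+1) (e i.+1) - L2dot (e i) (e i.+1)).
    elim: m => [_|m IH mn]; first by rewrite big_ord0 e00 expr0n/= mul0r.
    rewrite big_ord_recr/=; apply: le_trans (lerD (IH (ltnW mn)) (lexx _)).
    have mN : (m.+1 <= N)%N by exact: leq_trans mn nN.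
    have em := e2 m (ltnW mN); have em1 := e2 _ mN.
    have := L2dot_polarization em em1; rewrite !L2dot_sqr// -/(z m) -/(z m.+1).
    by move: (L2dot _ _) (z m ^+ 2) (z m.+1 ^+ 2) => *; lra.
  (* The Gram matrix is set to 0 outside the indices up to n, since the [V] are known to be in L^2
     only up to N while [EK_coercivity] asks for its inequalities at all indices. *)
  have coer := EK_coercivity alpha01 beta01 (B := fun i j => if (i <= n)%N && (j <= n)%N then bb i j else 0) n.
  pose Q i := (i.+1%:R * k) `^ alpha * ((1 + alpha / i.+1%:R) * S i.+1 (fun j => bb j i.+1) -
      S i (fun j => bb j i.+1)).
  have coer' : k `^ alpha * (kap / 2 * \sum_(i < n) alpha * i.+1%:R `^ (alpha - 1) * X i.+1 ^+ 2) <=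
      \sum_(i < n) Q i.
    have b0 i : 0 <= (if (i <= n)%N && (i <= n)%N then bb i i else 0).
      by case: ifP => // _; exact: L2dot_ge0.
    have bs i j : (if (i <= n)%N && (j <= n)%N then bb i j else 0) +
        (if (i <= n)%N && (j <= n)%N then bb i j else 0) <=
        (if (i <= n)%N && (i <= n)%N then bb i i else 0) +
        (if (j <= n)%N && (j <= n)%N then bb j j else 0).
      case: ifP => [/andP[i_n jn]|_]; last by rewrite addr0 addr_ge0.
      rewrite i_n jn/=; apply: L2dot_polarization; apply: V2; exact: leq_trans nN.
    have := coer bs b0; have SB0 : 0 <= EK_sum alpha beta n
        (fun i => if (i <= n)%N && (i <= n)%N then bb i i else 0).
      by apply: sumr_ge0 => i _; rewrite mulr_ge0 ?b0// EK_coef_ge0.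
    move=> cc; have c2 : kap / 2 * \sum_(i < n) alpha * i.+1%:R `^ (alpha - 1) * X i.+1 ^+ 2 <=
        \sum_(i < n) i.+1%:R `^ alpha * ((1 + alpha / i.+1%:R) *
          S i.+1 (fun j => bb j i.+1) - S i (fun j => bb j i.+1)).
      have E1 : \sum_(i < n) alpha * i.+1%:R `^ (alpha - 1) * X i.+1 ^+ 2 =
          \sum_(i < n) alpha * i.+1%:R `^ (alpha - 1) *
            (if (i.+1 <= n)%N && (i.+1 <= n)%N then bb i.+1 i.+1 else 0).
        apply: eq_bigr => i _; rewrite ltn_ord/= /bb L2dot_sqr//.
        by apply: V2; exact: leq_trans (ltn_ord i) nN.
      have E2 : \sum_(i < n) i.+1%:R `^ alpha * ((1 + alpha / i.+1%:R) *
          S i.+1 (fun j => bb j i.+1) - S i (fun j => bb j i.+1)) =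
        \sum_(i < n) i.+1%:R `^ alpha * ((1 + alpha / i.+1%:R) *
          EK_sum alpha beta i.+1 (fun j => if (j <= n)%N && (i.+1 <= n)%N then bb j i.+1 else 0) -
          EK_sum alpha beta i (fun j => if (j <= n)%N && (i.+1 <= n)%N then bb j i.+1 else 0)).
        apply: eq_bigr => i _; have i_n := ltn_ord i.
        congr (_ * (_ * _ - _)); apply: eq_bigr => j _; congr (_ * _).
          by rewrite i_n (leq_trans (ltn_ord j) i_n).
        by rewrite i_n (leq_trans (ltn_ord j) (ltnW i_n)).
      rewrite E1 E2; apply: le_trans cc; rewrite lerDl mulr_ge0//.
    apply: le_trans (ler_wpM2l (ltW ka0) c2) _; rewrite mulr_sumr.
    by apply: ler_sum => i _; rewrite /Q powRM// mulrA [k `^ _ * _]mulrC.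
  have T1 := tele n (leqnn n).
  have S1 : \sum_(i < n) (L2dot (e i.+1) (e i.+1) - L2dot (e i) (e i.+1)) + \sum_(i < n) Q i <=
      \sum_(i < n) (P * X i.+1 * (k `^ alpha * k `^ alpha) * i.+1%:R `^ (alpha - 1)) +
      \sum_(i < n) `|EK_defect alpha k i.+1| * (kap * L2norm u0xx * M).
    rewrite -!big_split/=; apply: ler_sum => i _.
    have i_n := ltn_ord i; apply: le_trans (step i (leq_trans i_n nN)) _.
    rewrite lerD2l ler_wpM2l// ler_wpM2l ?mulr_ge0 ?L2norm_ge0 ?(ltW kap0)//.
    exact: HM.
  (* Young's inequality with weight [kap] alpha reproduces the coercive term exactly; the remainder
     is of order k^(3 alpha) n^(alpha - 1). *)
  have Y1 : \sum_(i < n) (P * X i.+1 * (k `^ alpha * k `^ alpha) * i.+1%:R `^ (alpha - 1)) <=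
      k `^ alpha * (kap / 2 * \sum_(i < n) alpha * i.+1%:R `^ (alpha - 1) * X i.+1 ^+ 2) +
      (P ^+ 2 / (2 * (kap * alpha)) * (k `^ alpha * k `^ alpha * k `^ alpha)) *
        \sum_(i < n) i.+1%:R `^ (alpha - 1).
    rewrite !mulr_sumr -big_split/=; apply: ler_sum => i _.
    have ca : 0 < kap * alpha by rewrite mulr_gt0.
    have zz : 0 <= k `^ alpha * i.+1%:R `^ (alpha - 1) by rewrite mulr_ge0 ?powR_ge0.
    have := young (P * k `^ alpha) ca zz (L2norm_ge0 (V i.+1)); rewrite -/(X i.+1).
    have -> : P * k `^ alpha * X i.+1 * (k `^ alpha * i.+1%:R `^ (alpha - 1)) =
       P * X i.+1 * (k `^ alpha * k `^ alpha) * i.+1%:R `^ (alpha - 1) by ring.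
    move=> /le_trans; apply; rewrite le_eqVlt; apply/orP; left; apply/eqP.
    by rewrite exprMn [(k `^ alpha) ^+ 2]expr2; field; rewrite !gt_eqF.
  (* One of the three factors k^alpha pays for the sum, of order n^alpha, because (n k)^alpha <=
     T^alpha. *)
  have Z1 : (k `^ alpha) * \sum_(i < n) i.+1%:R `^ (alpha - 1) <= T `^ alpha / alpha.
    apply: le_trans (ler_wpM2l (ltW ka0) (sum_powR_pred n alpha01)) _.
    rewrite mulrA ler_wpM2r ?invr_ge0 ?(ltW alpha0)// mulrC -powRM//.
    have /andP[_ nkT] := nT n nN.
    by rewrite ge0_ler_powR ?nnegrE ?(ltW alpha0) ?(ltW T0) ?mulr_ge0.
  have Df := EK_defect_sum alpha01 k n.
  have Y2 : \sum_(i < n) `|EK_defect alpha k i.+1| * (kap * L2norm u0xx * M) <=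
      2 * alpha * k `^ alpha * (kap * L2norm u0xx * M).
    by rewrite -mulr_suml ler_wpM2r// !mulr_ge0 ?L2norm_ge0 ?(ltW kap0).
  have c3 : 0 <= P ^+ 2 / (2 * (kap * alpha)) * (k `^ alpha * k `^ alpha).
    have kk0 : 0 <= k `^ alpha * k `^ alpha by rewrite mulr_ge0 ?(ltW ka0).
    have ck : 0 < 2 * (kap * alpha) by rewrite !mulr_gt0.
    by rewrite mulr_ge0// divr_ge0 ?sqr_ge0 ?(ltW ck).
  have Z2 := ler_wpM2l c3 Z1.
  have G1 : z n ^+ 2 / 2 <= P ^+ 2 / (2 * (kap * alpha)) * (k `^ alpha * k `^ alpha) * (T `^ alpha / alpha)
      + 2 * alpha * k `^ alpha * (kap * L2norm u0xx * M).
    have Z3 : P ^+ 2 / (2 * (kap * alpha)) * (k `^ alpha * k `^ alpha * k `^ alpha) *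
        \sum_(i < n) i.+1%:R `^ (alpha - 1) <=
        P ^+ 2 / (2 * (kap * alpha)) * (k `^ alpha * k `^ alpha) * (T `^ alpha / alpha).
      by move: Z2; rewrite !mulrA.
    exact: energy_balance T1 coer' S1 Y1 Z3 Y2.
  apply: half_le G1 _.
  rewrite le_eqVlt; apply/orP; left; apply/eqP.
  by rewrite /A /Bc; field; rewrite !gt_eqF.
exact: (quadratic_bootstrap A0 Bc0 (ltW ka0) z0 energy (leqnn N)).
Qed.

End Problem.
End Convergence.

Theorem theorem3 (R : realType) (alpha beta T : R) (u0 : R -> R)
    (u ut utt ux utx uttx : R -> R -> R) (C : R) :
  0 < alpha < 1 -> 0 < beta < 1 -> 0 < T ->
  H2 u0 ->
  weak_solution alpha beta T u0 u ut ux ->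
  (forall v vt vx, weak_solution alpha beta T u0 v vt vx ->
    forall t, 0 <= t <= T -> v t = u t %[ae (@lebesgue_measure R)]) ->
  weak_dt T ut utt ->
  (forall t, 0 < t <= T ->
    H1_deriv (ut t) (utx t) /\ H1_deriv (utt t) (uttx t)) ->
  (forall t, 0 < t <= T ->
    L2norm (u t) + t `^ (1 - alpha) * L2norm (ut t)
      + t `^ (2 - alpha) * L2norm (utt t) <= C) ->
  (forall t, 0 < t <= T ->
    L2norm (ux t) + t `^ (1 - alpha) * L2norm (utx t)
      + t `^ (2 - alpha) * L2norm (uttx t) <= C) ->
  forall m : R, 0 < m ->
  exists2 D : R, 0 < D &
    forall (k : R) (U Ux : nat -> R -> R),
      0 < k < 1 -> discrete_solution alpha beta T k (u 0) U Ux ->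
      forall n : nat, n%:R * k <= T ->
        L2norm (fun x => U n x - u (n%:R * k) x) <=
        D * (if alpha != beta then k `^ (alpha - m / 2)
             else k `^ alpha * (Num.sqrt (- ln k) + k `^ (- (m / 2)))).
Proof.
move=> a01 b01 T0 Hu0 sol _ dtut Hx bound0 bound1 m m0.
have [D D0 HD] := discrete_error_bound a01 b01 T0 Hu0 sol dtut Hx bound0 bound1.
(* The constant found above may be 0, and a positive one is asked for. *)
exists (D + 1); first by rewrite ltr_wpDl.
move=> k U Ux /andP[k0 k1] dsol n nT; have k01 : 0 < k <= 1 by rewrite k0 ltW.
have m2 : 0 <= m / 2 by rewrite divr_ge0// ltW.
have ka := powR_ge0 k alpha.
apply: le_trans (HD k U Ux k0 dsol n nT) _.
apply: ler_pM => //; first by rewrite lerDl.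
(* As k < 1, lowering the exponent of k enlarges the power, and k^(- m / 2) >= 1; so both right-hand
   sides dominate k^alpha. *)
case: ifP => _; first by apply: ger_powR => //; rewrite gerBl.
rewrite -[leLHS]mulr1 ler_wpM2l//.
have km : 1 <= k `^ (- (m / 2)).
  have mn : - (m / 2) <= 0 by rewrite oppr_le0.
  by have := ger_powR k01 mn; rewrite powRr0.
by apply: le_trans km _; rewrite lerDr sqrtr_ge0.
Qed.
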